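(* Let $\pi\in\mathcal A_{\mathbb G}$ with corresponding state processes $\mathbf X=(X,Y,Z)$. Suppose that $(p_i,q_i,r_i)$, $i=1,2$, is the solution of the two-dimensional time-advanced BSDE corresponding to $\pi$. Define $p(t):=p_1(t)$, $q(t):=q_1(t)$, $r(t,\zeta):=r_1(t,\zeta)$, and suppose that $\mathbb E\big[\int_0^T\big(\frac{\partial\mathcal H}{\partial z}(t)\big)^2dt\big]<\infty$. Then $(p,q,r)$ solves the noisy memory BSDE corresponding to $\pi$. Moreover, $$q_2(t)=\int_t^{t+\delta}\mathbb E\Big[D_t\Big(\frac{\partial\mathcal H}{\partial z}(s)\Big)\,\Big|\,\mathcal F_t\Big]\mathbf 1_{[0,T]}(s)\,ds.$$
   Context: Setting. Fix $T>0$ and $\delta>0$. Let $(\Omega,\mathcal F,\{\mathcal F_t\}_{t\ge 0},P)$ be a complete filtered probability space with a Brownian motion $B(t)$, $t\in[-\delta,\infty)$, and an independent compensated Poisson random measure $\tilde N(dt,d\zeta)=N(dt,d\zeta)-\nu(d\zeta)dt$ with Lévy measure $\nu$; $\mathbb F=\{\mathcal F_t\}$ is the filtration generated by $B$ and $\tilde N$, augmented with the $P$-null sets. $\mathbb G=\{\mathcal G_t\}$ is a subfiltration, $\mathcal G_t\subset\mathcal F_t$, each $\mathcal G_t$ augmented with the $P$-null sets. $\mathcal V\subset\mathbb R$ is the set of control values, and the set of admissible controls $\mathcal A_{\mathbb G}$ is a given set of càdlàg, $\mathbb G$-adapted, $\mathcal V$-valued processes in $L^2(\Omega\times[0,T])$.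 State equation. For $\pi\in\mathcal A_{\mathbb G}$, $X=X^\pi$ is the solution of $$dX(t)=b(t,X(t),Y(t),Z(t),\pi(t))dt+\sigma(t,X(t),Y(t),Z(t),\pi(t))dB(t)+\int_{\mathbb R}\gamma(t,X(t),Y(t),Z(t),\pi(t),\zeta)\tilde N(dt,d\zeta),\ t\in[0,T],$$ $X(t)=\xi(t)$ for $t\in[-\delta,0]$ ($\xi$ a given initial process), where $Y(t)=X(t-\delta)$, $Z(t)=\int_{t-\delta}^tX(s)dB(s)$. The $\tilde N$-integral is taken with respect to the predictable version of the integrand. Write $\mathbf X=(X,Y,Z)$. Assumption 1 on $b,\sigma:\Omega\times[0,T]\times\mathbb R^3\times\mathcal V\to\mathbb R$ and $\gamma:\Omega\times[0,T]\times\mathbb R^3\times\mathcal V\times\mathbb R\to\mathbb R$: (a) they are $C^1$ in $(x,y,z,u)$ for fixed $\omega,t,\zeta$; (b) they are predictable for fixed $x,y,z,u$ (and $\zeta$); (c) $b,\sigma$ are Lipschitz in $(x,y,z)$ with constant independent of $t,u,\omega$, and there is $\mathcal L\in L^2(\nu)$, independent of $t,u,\omega$, with $|\gamma(\omega,t,x_1,y_1,z_1,u,\zeta)-\gamma(\omega,t,x_2,y_2,z_2,u,\zeta)|\le\mathcal L(\zeta)\{|x_1-x_2|+|y_1-y_2|+|z_1-z_2|\}$ for $\nu$-a.e. $\zeta$; (d) $b,\sigma$ have linear growth in $(x,y,z)$ with constant independent of $t,u,\omega$, and there is a non-negative $\mathcal K\in L^2(\nu)$, independent of $t,u,\omega$,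 with $|\gamma(\omega,t,x,y,z,u,\zeta)|\le\mathcal K(\zeta)\{1+|x|+|y|+|z|\}$ for $\nu$-a.e. $\zeta$. Under these assumptions, for every $\pi\in\mathcal A_{\mathbb G}$ there is a unique càdlàg adapted solution $X^\pi$, and $\mathbb E[\sup_{t\in[-\delta,T]}|X(t)|^2]<\infty$. Assumption 2 on $f:\Omega\times[0,T]\times\mathbb R^3\times\mathcal V\to\mathbb R$, $g:\Omega\times\mathbb R\to\mathbb R$: $f(\omega,t,\cdot)$ and $g(\omega,\cdot)$ are $C^1$; $f(\cdot,x,y,z,u)$ is progressively measurable and $g(\cdot,x)$ is $\mathcal F_T$-measurable; for every $\pi\in\mathcal A_{\mathbb G}$, $\mathbb E[\int_0^T(|f|+|\nabla f|^2)(t,\mathbf X(t),\pi(t))dt+(|g|+(g')^2)(X(T))]<\infty$. ($\nabla$ is the gradient in $(x,y,z,u)$.) Generalized Malliavin derivative. $D_t$ is the Malliavin derivative with respect to $B$, extended from $\mathbb D_{1,2}$ to $L^2(P)$ with values in the Hida space of stochastic distributions $(\mathcal S)^*$. For $F\in L^2(\mathcal F_T,P)$ the process $(t,\omega)\mapsto\mathbb E[D_tF|\mathcal F_t]$ belongs to $L^2(\lambda\times P)$ ($\lambda$ Lebesgue measure on $[0,T]$) and is characterized by $\mathbb E[F\int_0^T\varphi(t)dB(t)]=\mathbb E[\int_0^T\mathbb E[D_tF|\mathcal F_t]\varphi(t)dt]$ for all adapted $\varphi\in L^2(\lambda\times P)$. Hamiltonian: $$\mathcal H(t,x,y,z,u,p,q,r(\cdot))=f(t,x,y,z,u)+b(t,x,y,z,u)p+\sigma(t,x,y,z,u)q+\int_{\mathbb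 R}\gamma(t,x,y,z,u,\zeta)r(\zeta)\nu(d\zeta).$$ Below and in the claim, $\frac{\partial\mathcal H}{\partial x}(t)$ abbreviates $\frac{\partial\mathcal H}{\partial x}(t,\mathbf X(t),\pi(t),p(t),q(t),r(t,\cdot))$ (with $p=p_1$, $q=q_1$, $r=r_1$ in the two-dimensional system), and similarly for $y,z$. Noisy memory BSDE corresponding to $\pi$: $$dp(t)=-\mathbb E[\mu(t)|\mathcal F_t]dt+q(t)dB(t)+\int_{\mathbb R}r(t,\zeta)\tilde N(dt,d\zeta),\ 0\le t\le T,\qquad p(T)=g'(X(T)),$$ $$\mu(t)=\frac{\partial\mathcal H}{\partial x}(t)+\frac{\partial\mathcal H}{\partial y}(t+\delta)\mathbf 1_{[0,T-\delta]}(t)+\int_t^{t+\delta}\mathbb E\Big[D_t\Big(\frac{\partial\mathcal H}{\partial z}(s)\Big)\Big|\mathcal F_t\Big]\mathbf 1_{[0,T]}(s)ds.$$ $p,q,r$ is a solution if $q,r$ are predictable, these equations hold, and $\mathbb E[\sup_{t\in[0,T]}p(t)^2+\int_0^T\{q(t)^2+\int_{\mathbb R}r(t,\zeta)^2\nu(d\zeta)+(\frac{\partial\mathcal H}{\partial z}(t))^2\}dt]<\infty$. Two-dimensional time-advanced BSDE corresponding to $\pi$ (for $p_i,q_i,r_i$, $i=1,2$): $$dp_i(t)=-\mathbb E[\mu_i(t)|\mathcal F_t]dt+q_i(t)dB(t)+\int_{\mathbb R}r_i(t,\zeta)\tilde N(dt,d\zeta),\ i=1,2,\qquad p_1(T)=g'(X(T)),\quad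 p_2(T)=0,$$ $$\mu_1(t)=q_2(t)+\frac{\partial\mathcal H}{\partial x}(t)+\frac{\partial\mathcal H}{\partial y}(t+\delta)\mathbf 1_{[0,T]}(t+\delta),\qquad \mu_2(t)=\frac{\partial\mathcal H}{\partial z}(t)-\frac{\partial\mathcal H}{\partial z}(t+\delta)\mathbf 1_{[0,T]}(t+\delta).$$ A solution consists of processes satisfying these equations with $q_i,r_i$ predictable and $\mathbb E[\sup_{t\in[0,T]}|p_i(t)|^2+\int_0^T\{|q_i(t)|^2+\int_{\mathbb R}|r_i(t,\zeta)|^2\nu(d\zeta)\}dt]<\infty$ for $i=1,2$. *)

(* Defs.v *)
From HB Require Import structures.
From mathcomp Require Export all_boot all_order all_algebra.
From mathcomp Require Export all_classical all_reals all_analysis measurable_realfun.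

Set Implicit Arguments.
Unset Strict Implicit.
Unset Printing Implicit Defensive.

Import Order.TTheory GRing.Theory Num.Theory.
Import numFieldNormedType.Exports.

Local Open Scope classical_set_scope.
Local Open Scope ring_scope.

Section partial_derivatives.
Context {R : realType}.
Implicit Types (h : R -> R -> R -> R -> R) (x y z u : R).

Definition partial_x h x y z u := derive1 (fun a => h a y z u) x.
Definition partial_y h x y z u := derive1 (fun a => h x a z u) y.
Definition partial_z h x y z u := derive1 (fun a => h x y a u) z.
Definition partial_u h x y z u := derive1 (fun a => h x y z a) u.

Definition uncurry4 h (v : R * R * R * R) := h v.1.1.1 v.1.1.2 v.1.2 v.2.

Definition has_partials h x y z u :=
  [/\ derivable (fun a => h a y z u) x 1, derivable (fun a => h x a z u) y 1,
      derivable (fun a => h x y a u) z 1 & derivable (fun a => h x y z a) u 1].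

(* The set V of control values is not assumed to be open, so that C^1 on
   R^3 x V means C^1 on some open set containing R^3 x V. *)
Definition C1_on (V : set R) h := exists U : set (R * R * R * R),
  [/\ open U, (forall x y z u, V u -> U (x, y, z, u)) &
      forall v, U v -> has_partials h v.1.1.1 v.1.1.2 v.1.2 v.2 /\
        [/\ {for v, continuous (uncurry4 (partial_x h))},
            {for v, continuous (uncurry4 (partial_y h))},
            {for v, continuous (uncurry4 (partial_z h))} &
            {for v, continuous (uncurry4 (partial_u h))}]].

Definition C1_real (h : R -> R) :=
  (forall x, derivable h x 1) /\ continuous (derive1 h).

End partial_derivatives.

(* The data fixed throughout.  The coefficients are total functions, and are
   constrained only for times in [0, T] and control values in V. *)
Record model d (Om : measurableType d) (R : realType) := Model {
  horizon : R;
  delay : R;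
  prob : probability Om R;
  bm : R -> Om -> R;
  levy : {sigma_finite_measure set R -> \bar R};
  prm : Om -> {measure set (R * R) -> \bar R};
  controls : set R;
  initial : R -> Om -> R;
  (* b, sigma, gamma, f and g; arguments: t, omega, x, y, z, u (, zeta) *)
  drift : R -> Om -> R -> R -> R -> R -> R;
  diffusion : R -> Om -> R -> R -> R -> R -> R;
  jump_coef : R -> Om -> R -> R -> R -> R -> R -> R;
  running : R -> Om -> R -> R -> R -> R -> R;
  terminal : Om -> R -> R }.

Section setting.
Context {d : measure_display} {Om : measurableType d} {R : realType}.
Variable M : model Om R.

Local Notation T := (horizon M).
Local Notation delta := (delay M).
Local Notation P := (prob M).
Local Notation B := (bm M).
Local Notation nu := (levy M).
Local Notation N := (prm M).
Local Notation V := (controls M).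
Local Notation leb := (@lebesgue_measure R).
Local Notation process := (R -> Om -> R).
Local Notation field := (R -> Om -> R -> R).
Local Notation slab := (fun a c : R => `[a, c] `*` [set: Om]).

Implicit Types (X Y Z pi p q phi : process) (r : field) (I F : Om -> R).

Definition brownian_motion :=
  [/\ (forall t, - delta <= t -> measurable_fun [set: Om] (B t)),
      {ae P, forall w, B 0 w = 0},
      {ae P, forall w, {within `[- delta, +oo[, continuous (fun t => B t w)}},
      (forall s t, - delta <= s -> s < t -> forall A : set R, measurable A ->
         P [set w | A (B t w - B s w)] = normal_prob 0 (Num.sqrt (t - s)) A) &
      (forall (n : nat) (u : nat -> R) (A : nat -> set R),
         - delta <= u 0%N -> (forall i, (i < n)%N -> u i <= u i.+1) ->
         (forall i, measurable (A i)) ->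
         P (\bigcap_(i in `I_n) [set w | A i (B (u i.+1) w - B (u i) w)]) =
         (\big[*%E/1%E]_(i < n) P [set w | A i (B (u i.+1) w - B (u i) w)%R])%E)].

Definition levy_measure :=
  nu [set 0] = 0%E /\
  (\int[nu]_(zeta in setT) (Num.min 1 (zeta ^+ 2))%:E < +oo)%E.

Definition intensity (E : set (R * R)) : \bar R := (leb \x nu)%E E.

(* first coordinate: time, second coordinate: jump size *)
Definition poisson_random_measure :=
  [/\ (forall E : set (R * R), measurable E -> E `<=` `]0, +oo[ `*` setT ->
         measurable_fun [set: Om] (fun w => N w E)),
      (forall E : set (R * R), measurable E -> E `<=` `]0, +oo[ `*` setT ->
         (intensity E < +oo)%E -> forall k : nat,
         P [set w | N w E = k%:R%:E] =
           (fine (intensity E) ^+ k / k`!%:R * expR (- fine (intensity E)))%:E) &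
      (forall (n : nat) (E : nat -> set (R * R)) (A : nat -> set (\bar R)),
         (forall i, (i < n)%N -> measurable (E i)) ->
         (forall i, (i < n)%N -> E i `<=` `]0, +oo[ `*` setT) ->
         trivIset `I_n E -> (forall i, measurable (A i)) ->
         P (\bigcap_(i in `I_n) [set w | A i (N w (E i))]) =
         (\big[*%E/1%E]_(i < n) P [set w | A i (N w (E i))])%E)].

Definition compensated (w : Om) (E : set (R * R)) : R :=
  fine (N w E) - fine (intensity E).

(* Generators of the filtration.  Increments from time -delta are used because
   they do not depend on whether B is normalized at time -delta or at time 0;
   for t >= 0 they generate sigma(B(s), -delta <= s <= t) up to null sets. *)
Definition bm_events (t : R) : set (set Om) :=
  [set E | exists s (A : set R), [/\ - delta <= s <= t, measurable A &
     E = [set w | A (B s w - B (- delta) w)]]].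

Definition prm_events (t : R) : set (set Om) :=
  [set E | exists (D : set (R * R)) (A : set R),
     [/\ measurable D, D `<=` `]0, t] `*` setT, (intensity D < +oo)%E,
         measurable A & E = [set w | A (compensated w D)]]].

Definition independent_noises := forall E E' : set Om,
  <<s \bigcup_(t in setT) bm_events t >> E ->
  <<s \bigcup_(t in setT) prm_events t >> E' ->
  P (E `&` E') = (P E * P E')%E.

(* For -delta <= t < 0 this is generated by B alone; these times only serve to
   give a meaning to Z(t) = \int_{t-delta}^t X dB when t < delta. *)
Definition filtration (t : R) : set (set Om) :=
  <<s bm_events t `|` prm_events t `|` P.-negligible >>.

Definition noisy_setting :=
  [/\ 0 < T, 0 < delta & measure_is_complete P] /\
  [/\ brownian_motion, levy_measure, poisson_random_measure &
      independent_noises].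

Definition subfiltration (G : R -> set (set Om)) :=
  [/\ (forall t, 0 <= t -> sigma_algebra setT (G t)),
      (forall s t, 0 <= s -> s <= t -> G s `<=` G t),
      (forall t, 0 <= t -> P.-negligible `<=` G t) &
      (forall t, 0 <= t -> G t `<=` filtration t)].

Definition measurable_wrt S (D : set S) (GG : set (set S)) (h : S -> R) :=
  forall A : set R, measurable A -> GG (D `&` h @^-1` A).

Definition adapted (G : R -> set (set Om)) a c phi :=
  forall t, a <= t <= c -> measurable_wrt setT (G t) (phi t).

Definition cadlag a c phi := forall w,
  (forall t, a <= t < c -> phi s w @[s --> t^'+] --> phi t w) /\
  (forall t, a < t <= c -> cvg (phi s w @[s --> t^'-])).

Definition jointly_measurable a c phi :=
  measurable_fun (slab a c) (fun v : R * Om => phi v.1 v.2).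

Definition predictable_sets : set (set (R * Om)) :=
  <<s slab 0 T,
    [set E | (exists2 A, filtration 0 A & E = [set 0] `*` A) \/
             (exists s t A, [/\ 0 <= s, s <= t, t <= T, filtration s A &
                                E = `]s, t] `*` A])] >>.

Definition predictable phi :=
  measurable_wrt (slab 0 T) predictable_sets (fun v => phi v.1 v.2).

Definition predictable_field r :=
  measurable_wrt (slab 0 T `*` setT)
    <<s slab 0 T `*` setT,
      [set E | exists (C : set (R * Om)) (A : set R),
         [/\ predictable_sets C, measurable A & E = C `*` A]] >>
    (fun v => r v.1.1 v.1.2 v.2).

Definition progressive phi := forall t, 0 <= t <= T ->
  measurable_wrt (slab 0 t)
    <<s slab 0 t,
      [set E | exists (A : set R) (C : set Om),
         [/\ measurable A, A `<=` `[0, t], filtration t C & E = A `*` C]] >>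
    (fun v => phi v.1 v.2).

(* phi belongs to L^2(lambda x P) on [a, c] *)
Definition square_integrable a c phi :=
  jointly_measurable a c phi /\
  (\int[leb \x P]_(v in slab a c) ((phi v.1 v.2) ^+ 2)%:E < +oo)%E.

Definition sup_square_finite a c phi :=
  (\int[P]_w ereal_sup [set ((phi t w) ^+ 2)%:E | t in `[a, c]] < +oo)%E.

(* Stochastic integrals: L^2 limits of integrals of simple processes, which are
   finite sums of terms e(omega) 1_{]s, t]} (times 1_A(zeta) for the jumps). *)

Record step := Step { lo : R ; hi : R ; coef : Om -> R }.

Definition adapted_step a c (h : step) :=
  [/\ a <= lo h, lo h <= hi h & hi h <= c] /\
  measurable_wrt setT (filtration (lo h)) (coef h) /\
  exists C : R, forall w, `|coef h w| <= C.

Definition step_fun (h : step) (t : R) (w : Om) : R :=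
  coef h w * \1_`]lo h, hi h] t.

(* I = \int_a^c phi(t) dB(t) *)
Definition ito_integral a c phi I :=
  [/\ jointly_measurable a c phi, measurable_fun [set: Om] I &
   exists (n : nat -> nat) (S : nat -> nat -> step),
   [/\ (forall k i, (i < n k)%N -> adapted_step a c (S k i)),
       (fun k => \int[leb \x P]_(v in slab a c)
          ((phi v.1 v.2 - \sum_(i < n k) step_fun (S k i) v.1 v.2) ^+ 2)%:E)%E
         @ \oo --> 0%E &
       (fun k => \int[P]_w
          ((I w - \sum_(i < n k) coef (S k i) w *
                    (B (hi (S k i)) w - B (lo (S k i)) w)) ^+ 2)%:E)%E
         @ \oo --> 0%E]].

(* I = \int_a^c \int_R r(t, zeta) \tilde N(dt, dzeta).  Since r only matters up
   to lambda x P x nu-null sets, an integrand and its predictable version have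
   the same integral. *)
Definition jump_integral a c r I :=
  [/\ measurable_fun (slab a c `*` setT)
        (fun v : R * Om * R => r v.1.1 v.1.2 v.2),
      measurable_fun [set: Om] I &
   exists (n : nat -> nat) (S : nat -> nat -> step) (A : nat -> nat -> set R),
   [/\ (forall k i, (i < n k)%N ->
          [/\ adapted_step a c (S k i), measurable (A k i) &
              (nu (A k i) < +oo)%E]),
       (fun k => \int[(leb \x P) \x nu]_(v in slab a c `*` setT)
          ((r v.1.1 v.1.2 v.2 -
            \sum_(i < n k) step_fun (S k i) v.1.1 v.1.2 * \1_(A k i) v.2)
            ^+ 2)%:E)%E
         @ \oo --> 0%E &
       (fun k => \int[P]_w
          ((I w - \sum_(i < n k) coef (S k i) w *
             compensated w (`]lo (S k i), hi (S k i)] `*` A k i)) ^+ 2)%:E)%E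
         @ \oo --> 0%E]].

Definition admissible_controls (G : R -> set (set Om)) (AG : set process) :=
  forall pi, AG pi ->
  [/\ cadlag 0 T pi, adapted G 0 T pi,
      (forall t w, 0 <= t <= T -> V (pi t w)) & square_integrable 0 T pi].

(* the process Y *)
Definition delayed X : process := fun t w => X (t - delta) w.

(* the coefficient h(t, X(t), Y(t), Z(t), pi(t)) *)
Definition along (h : R -> Om -> R -> R -> R -> R -> R) X Z pi : process :=
  fun t w => h t w (X t w) (delayed X t w) (Z t w) (pi t w).

Definition gamma_along X Z pi : field :=
  fun t w zeta => jump_coef M t w (X t w) (delayed X t w) (Z t w) (pi t w) zeta.

Definition noisy_memory X Z :=
  [/\ cadlag 0 T Z, adapted filtration 0 T Z &
      forall t, 0 <= t <= T -> ito_integral (t - delta) t X (Z t)].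

Definition state_solution pi X Z :=
  [/\ cadlag (- delta) T X, adapted filtration (- delta) T X,
      sup_square_finite (- delta) T X & noisy_memory X Z] /\
  {ae P, forall w, forall t, - delta <= t <= 0 -> X t w = initial M t w} /\
  (forall t, 0 <= t <= T -> exists I J,
     [/\ ito_integral 0 t (along (diffusion M) X Z pi) I,
         jump_integral 0 t (gamma_along X Z pi) J &
         {ae P, forall w, X t w =
            X 0 w + \int[leb]_(s in `[0, t]) along (drift M) X Z pi s w
            + I w + J w}]).

Definition lipschitz_growth (h : R -> Om -> R -> R -> R -> R -> R) :=
  exists C : R, forall t w u, 0 <= t <= T -> V u ->
    (forall x1 y1 z1 x2 y2 z2, `|h t w x1 y1 z1 u - h t w x2 y2 z2 u| <=
       C * (`|x1 - x2| + `|y1 - y2| + `|z1 - z2|)) /\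
    (forall x y z, `|h t w x y z u| <= C * (1 + `|x| + `|y| + `|z|)).

Definition in_L2_levy (L : R -> R) :=
  measurable_fun [set: R] (L : R -> R) /\
  (\int[nu]_zeta ((L zeta) ^+ 2)%:E < +oo)%E.

Definition assumption1 :=
  [/\ (forall t w, 0 <= t <= T ->
         [/\ C1_on V (drift M t w), C1_on V (diffusion M t w) &
             forall zeta, C1_on V (fun x y z u => jump_coef M t w x y z u zeta)]),
      (forall x y z u, V u ->
         [/\ predictable (fun t w => drift M t w x y z u),
             predictable (fun t w => diffusion M t w x y z u) &
             predictable_field (fun t w zeta => jump_coef M t w x y z u zeta)]),
      lipschitz_growth (drift M) /\ lipschitz_growth (diffusion M),
      (exists2 L, in_L2_levy L &
         forall t w u x1 y1 z1 x2 y2 z2, 0 <= t <= T -> V u ->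
         {ae nu, forall zeta,
            `|jump_coef M t w x1 y1 z1 u zeta - jump_coef M t w x2 y2 z2 u zeta| <=
            L zeta * (`|x1 - x2| + `|y1 - y2| + `|z1 - z2|)}) &
      (exists2 K, in_L2_levy K /\ (forall zeta, 0 <= K zeta) &
         forall t w u x y z, 0 <= t <= T -> V u ->
         {ae nu, forall zeta, `|jump_coef M t w x y z u zeta| <=
            K zeta * (1 + `|x| + `|y| + `|z|)})].

Definition grad_f_square t w x y z u :=
  partial_x (running M t w) x y z u ^+ 2 + partial_y (running M t w) x y z u ^+ 2 +
  partial_z (running M t w) x y z u ^+ 2 + partial_u (running M t w) x y z u ^+ 2.

Definition assumption2 (AG : set process) :=
  [/\ (forall t w, 0 <= t <= T -> C1_on V (running M t w)),
      (forall w, C1_real (terminal M w)),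
      (forall x y z u, V u -> progressive (fun t w => running M t w x y z u)),
      (forall x, measurable_wrt setT (filtration T) (fun w => terminal M w x)) &
      forall pi X Z, AG pi -> state_solution pi X Z ->
        (\int[leb \x P]_(v in slab 0%R T)
            (`|along (running M) X Z pi v.1 v.2| +
             along grad_f_square X Z pi v.1 v.2)%:E < +oo)%E /\
        (\int[P]_w (`|terminal M w (X T w)| +
                    derive1 (terminal M w) (X T w) ^+ 2)%:E < +oo)%E].

Definition is_cond_exp (GG : set (set Om)) F (F' : Om -> R) :=
  [/\ P.-integrable setT (EFin \o F), P.-integrable setT (EFin \o F'),
      measurable_wrt setT GG F' &
      forall A, GG A -> (\int[P]_(w in A) (F w)%:E = \int[P]_(w in A) (F' w)%:E)%E].

(* m is a (jointly measurable) version of t |-> E[mu(t) | F_t] on [0, T] *)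
Definition is_cond_exp_process (mu m : process) :=
  jointly_measurable 0 T m /\
  {ae leb, forall t, 0 <= t <= T -> is_cond_exp (filtration t) (mu t) (m t)}.

(* Phi is a version of the process t |-> E[D_t F | F_t] on [0, T], for F in
   L^2(F_T, P) and D the generalized Malliavin derivative with respect to B.
   It is determined, up to lambda x P-null sets, as the adapted element of
   L^2(lambda x P) satisfying the duality formula with the Ito integral. *)
Definition is_cond_malliavin F (Phi : process) :=
  [/\ adapted filtration 0 T Phi, square_integrable 0 T Phi &
      forall phi I, adapted filtration 0 T phi -> square_integrable 0 T phi ->
        ito_integral 0 T phi I ->
        \int[P]_w (F w * I w) =
        \int[(leb \x P)%E]_(v in slab 0 T) (Phi v.1 v.2 * phi v.1 v.2)].

(* K is a (jointly measurable) version of (s, t) |-> E[D_t H(s) | F_t];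
   the arguments of K are s, t, omega. *)
Definition is_cond_malliavin_kernel (H : process) (K : R -> process) :=
  measurable_fun (`[0, T] `*` slab 0 T)
    (fun v : R * (R * Om) => K v.1 v.2.1 v.2.2) /\
  {ae leb, forall s, 0 <= s <= T -> is_cond_malliavin (H s) (K s)}.

(* t |-> \int_t^{t+delta} E[D_t H(s) | F_t] 1_{[0,T]}(s) ds *)
Definition memory_integral (K : R -> process) : process := fun t w =>
  \int[leb]_(s in `[t, t + delta]) (K s t w * \1_`[0, T] s).

Definition hamiltonian (t : R) (w : Om) (x y z u p q : R) (r : R -> R) : R :=
  running M t w x y z u + drift M t w x y z u * p + diffusion M t w x y z u * q
  + \int[nu]_zeta (jump_coef M t w x y z u zeta * r zeta).

Definition dH_dx X Z pi p q r : process := fun t w =>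
  partial_x (fun x y z u => hamiltonian t w x y z u (p t w) (q t w) (r t w))
    (X t w) (delayed X t w) (Z t w) (pi t w).

Definition dH_dy X Z pi p q r : process := fun t w =>
  partial_y (fun x y z u => hamiltonian t w x y z u (p t w) (q t w) (r t w))
    (X t w) (delayed X t w) (Z t w) (pi t w).

Definition dH_dz X Z pi p q r : process := fun t w =>
  partial_z (fun x y z u => hamiltonian t w x y z u (p t w) (q t w) (r t w))
    (X t w) (delayed X t w) (Z t w) (pi t w).

(* dp(t) = - E[mu(t) | F_t] dt + q(t) dB(t) + \int r(t,zeta) \tilde N(dt,dzeta)
   on [0, T], p(T) = F, with q and r predictable *)
Definition backward_equation (mu : process) F p q r :=
  [/\ cadlag 0 T p, adapted filtration 0 T p, predictable q &
      predictable_field r] /\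
  {ae P, forall w, p T w = F w} /\
  exists m, [/\ is_cond_exp_process mu m,
    {ae P, forall w, leb.-integrable `[0, T] (fun t => (m t w)%:E)} &
    forall t, 0 <= t <= T -> exists I J,
      [/\ ito_integral t T q I, jump_integral t T r J &
          {ae P, forall w, p t w =
             F w + \int[leb]_(s in `[t, T]) m s w - I w - J w}]].

Definition bsde_bound p q r :=
  [/\ sup_square_finite 0 T p,
      (\int[leb \x P]_(v in slab 0%R T) ((q v.1 v.2) ^+ 2)%:E < +oo)%E &
      (\int[leb \x P]_(v in slab 0%R T)
         \int[nu]_zeta ((r v.1 v.2 zeta) ^+ 2)%:E < +oo)%E].

Definition terminal_value X : Om -> R := fun w => derive1 (terminal M w) (X T w).

Definition mu_noisy X Z pi p q r (K : R -> process) : process := fun t w =>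
  dH_dx X Z pi p q r t w
  + dH_dy X Z pi p q r (t + delta) w * \1_`[0, T - delta] t
  + memory_integral K t w.

(* K stands for E[D_t (dH/dz)(s) | F_t] *)
Definition noisy_memory_bsde_solution pi X Z (K : R -> process) p q r :=
  [/\ is_cond_malliavin_kernel (dH_dz X Z pi p q r) K,
      backward_equation (mu_noisy X Z pi p q r K) (terminal_value X) p q r,
      bsde_bound p q r &
      square_integrable 0 T (dH_dz X Z pi p q r)].

Definition mu_first X Z pi p1 q1 r1 q2 : process := fun t w =>
  q2 t w + dH_dx X Z pi p1 q1 r1 t w
  + dH_dy X Z pi p1 q1 r1 (t + delta) w * \1_`[0, T] (t + delta).

Definition mu_second X Z pi p1 q1 r1 : process := fun t w =>
  dH_dz X Z pi p1 q1 r1 t w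
  - dH_dz X Z pi p1 q1 r1 (t + delta) w * \1_`[0, T] (t + delta).

Definition advanced_bsde_solution pi X Z p1 q1 r1 p2 q2 r2 :=
  [/\ backward_equation (mu_first X Z pi p1 q1 r1 q2) (terminal_value X)
        p1 q1 r1,
      backward_equation (mu_second X Z pi p1 q1 r1) (fun=> 0) p2 q2 r2,
      bsde_bound p1 q1 r1 & bsde_bound p2 q2 r2].

End setting.

(* Main.v *)
From HB Require Import structures.
Require Import Defs.
From mathcomp Require Import ring lra.

(** Write H for dH/dz, extended by zero after T. The content lies in the second
    equation of the advanced system: its terminal value is 0 and its drift m(s) is
    the conditional expectation of mu_2(s) = H(s) - H(s + delta). Once q_2 is known
    to be the memory integral, mu_1(t) and the drift of the noisy memory equation
    agree almost surely for almost every t, so that the same version of the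
    conditional expectation, and hence the same solution, serves both equations.

    To identify q_2, pair the second equation at time a with c (B(b) - B(a)), for a
    bounded c known at time a. The value p_2(a) and the jump integral contribute
    nothing, and the Ito isometry turns the Ito integral of q_2 into the pairing of
    q_2 with the elementary process c 1_]a, b] (control_pairing). In the
    contribution of the drift m(s), the increment of B after s is orthogonal to the
    past of s; against the increment before s, m(s) may be replaced by mu_2(s), and
    the duality formula turns H(s) and H(s + delta) into their kernels
    (drift_pairing). Translating the second term by delta and exchanging integrals
    gives the pairing of c 1_]a, b] with the memory integral: the half-lines s >= t
    and s >= t + delta differ by the window [t, t + delta[ (memory_pairing).

    So q_2 and the memory integral have the same pairings with the elementary
    processes. Instead of a density theorem for these, the following argument is
    used. The slice at time u of an adapted process is the coefficient of an
    elementary process on ]u, x]; hence the difference of q_2 and the memory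
    integral is orthogonal to the elementary processes built from any adapted k,
    and integrating over u gives a pairing of k that vanishes (later_orth). It
    vanishes for q_2, and for the memory integral, a superposition over s of
    adapted processes; so it vanishes for their difference. By the symmetry of the
    triangle u < t <= x, that pairing is half the second moment of the integral of
    the difference over ]-oo, x]. These integrals determine the difference, which
    is therefore 0 (later_self_orth_eq0).

    All this takes place in L^2, so the kernel has to be square integrable in all
    its variables together. This follows from a Bessel inequality: the integral of
    the square of the kernel at s is at most E H(s)^2 (represents_bound). The Ito
    sums S of a truncated kernel over a grid satisfy 0 <= E (H(s) - S)^2; averaging
    over the origin of the grid makes E S^2 at most an integral, and makes
    E (H(s) S) a moving average, which converges by Lebesgue differentiation.

    The computations rest on the independence of the later increments of B and of
    the jumps from the past, and on the first two moments of the normal and the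
    Poisson laws; the isometry and orthogonality relations are proved for elementary
    integrals (expectation_step_step, expectation_jump_step) and pass to L^2 limits
    (ito_pairing, jump_pairing). *)

Set Implicit Arguments.
Unset Strict Implicit.
Unset Printing Implicit Defensive.

Import Order.TTheory GRing.Theory Num.Theory.
Import numFieldNormedType.Exports.

Local Open Scope classical_set_scope.
Local Open Scope ring_scope.

(** * Integration of real functions *)

Section integrability.
Context d (T : measurableType d) (R : realType) (mu : {measure set T -> \bar R}).
Implicit Types (f g : T -> R).

Definition summable_fun f := mu.-integrable [set: T] (EFin \o f).

Definition sqint f := measurable_fun [set: T] f /\ summable_fun (fun x => f x ^+ 2).

Lemma summable_measurable f : summable_fun f -> measurable_fun [set: T] f.
Proof. by move=> /(measurable_int mu) /measurable_EFinP. Qed.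

Lemma summable_le f g : measurable_fun [set: T] f ->
  (forall x, `|f x| <= g x) -> summable_fun g -> summable_fun f.
Proof.
move=> mf fg; apply: le_integrable => //; first exact/measurable_EFinP.
by move=> x _ /=; rewrite lee_fin (le_trans (fg x))// ler_norm.
Qed.

Lemma summableD f g : summable_fun f -> summable_fun g ->
  summable_fun (fun x => f x + g x).
Proof. by move=> sf sg; apply: eq_integrable (integrableD measurableT sf sg). Qed.

Lemma summableZ r f : summable_fun f -> summable_fun (fun x => r * f x).
Proof. by move=> sf; apply: eq_integrable (integrableZl measurableT r sf). Qed.

Lemma summableN f : summable_fun f -> summable_fun (fun x => - f x).
Proof. by move=> sf; apply: eq_integrable (integrableN sf). Qed.

Lemma summableB f g : summable_fun f -> summable_fun g ->
  summable_fun (fun x => f x - g x).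
Proof. by move=> sf sg; apply: summableD => //; exact: summableN. Qed.

Lemma summable_norm f : summable_fun f -> summable_fun (fun x => `|f x|).
Proof. by move=> sf; apply: eq_integrable (integrable_norm sf). Qed.

Lemma summable0 : summable_fun (fun=> 0).
Proof. by apply: eq_integrable (integrable0 _ _). Qed.

Lemma Rintegral_eq0 f : (forall x, f x = 0) -> \int[mu]_x f x = 0.
Proof. by move=> f0; rewrite /Rintegral integral0_eq// => x _; rewrite f0. Qed.

Lemma summable_sum n (F : nat -> T -> R) :
  (forall i, (i < n)%N -> summable_fun (F i)) ->
  summable_fun (fun x => \sum_(i < n) F i x).
Proof.
elim: n => [|n IH] sF.
  by under [X in summable_fun X]eq_fun do rewrite big_ord0; exact: summable0.
under [X in summable_fun X]eq_fun do rewrite big_ord_recr.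
by apply: summableD; [apply: IH => i ni; apply: sF; exact: ltnW|exact: sF].
Qed.

Lemma Rintegral_sum_ord n (F : nat -> T -> R) :
  (forall i, (i < n)%N -> summable_fun (F i)) ->
  \int[mu]_x (\sum_(i < n) F i x) = \sum_(i < n) \int[mu]_x F i x.
Proof.
elim: n => [|n IH] sF.
  under eq_Rintegral do rewrite big_ord0.
  by rewrite big_ord0 Rintegral_cst// mul0r.
under eq_Rintegral do rewrite big_ord_recr.
rewrite RintegralD//; last 2 first.
- by apply: summable_sum => i ni; apply: sF; exact: ltnW.
- exact: sF.
by rewrite IH ?big_ord_recr// => i ni; apply: sF; exact: ltnW.
Qed.

Lemma summable_bounded_mul f g C : measurable_fun [set: T] f ->
  (forall x, `|f x| <= C) -> summable_fun g -> summable_fun (fun x => f x * g x).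
Proof.
move=> mf fC sg; apply: (@summable_le _ (fun x => C * `|g x|)).
- by apply: measurable_funM => //; exact: summable_measurable.
- by move=> x; rewrite normrM ler_wpM2r.
- exact/summableZ/summable_norm.
Qed.

Lemma sqint_mul f g : sqint f -> sqint g -> summable_fun (fun x => f x * g x).
Proof.
move=> [mf sf] [mg sg]; apply: (@summable_le _ (fun x => f x ^+ 2 + g x ^+ 2)).
- exact: measurable_funM.
- by move=> x; rewrite normrM -(real_normK (num_real (f x)))
    -(real_normK (num_real (g x))); move: `|f x| `|g x| (normr_ge0 (f x))
    (normr_ge0 (g x)) => a b a0 b0; have := sqr_ge0 (a - b);
    rewrite sqrrB; have := mulr_ge0 a0 b0; lra.
- exact: summableD.
Qed.

Lemma sqintD f g : sqint f -> sqint g -> sqint (fun x => f x + g x).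
Proof.
move=> sf sg; split; first by apply: measurable_funD; [case: sf|case: sg].
under [X in summable_fun X]eq_fun do rewrite sqrrD.
apply: summableD; last by case: sg.
apply: summableD; first by case: sf.
under [X in summable_fun X]eq_fun do rewrite -mulr_natl.
exact/summableZ/sqint_mul.
Qed.

Lemma sqint_bounded_mul f g C : measurable_fun [set: T] f ->
  (forall x, `|f x| <= C) -> sqint g -> sqint (fun x => f x * g x).
Proof.
move=> mf fC [mg sg]; split; first exact: measurable_funM.
under [X in summable_fun X]eq_fun do rewrite exprMn.
apply: (@summable_bounded_mul _ _ (C ^+ 2)) => //.
- exact: measurable_funX.
- by move=> x; rewrite normrX lerXn2r// ?nnegrE// (le_trans _ (fC x)).
Qed.

Lemma sqintZ r f : sqint f -> sqint (fun x => r * f x).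
Proof. by move=> sf; apply: (@sqint_bounded_mul (fun=> r) _ `|r|). Qed.

Lemma sqintN f : sqint f -> sqint (fun x => - f x).
Proof.
by move=> /(sqintZ (-1)); under [X in sqint X -> _]eq_fun do rewrite mulN1r.
Qed.

Lemma sqintB f g : sqint f -> sqint g -> sqint (fun x => f x - g x).
Proof. by move=> sf sg; apply: sqintD => //; exact: sqintN. Qed.

Lemma sqint0 : sqint (fun=> 0).
Proof.
split; first exact: measurable_cst.
by under [X in summable_fun X]eq_fun do rewrite expr0n/=; exact: summable0.
Qed.

Lemma sqint_sum n (F : nat -> T -> R) : (forall i, (i < n)%N -> sqint (F i)) ->
  sqint (fun x => \sum_(i < n) F i x).
Proof.
elim: n => [|n IH] sF.
  by under [X in sqint X]eq_fun do rewrite big_ord0; exact: sqint0.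
under [X in sqint X]eq_fun do rewrite big_ord_recr.
by apply: sqintD; [apply: IH => i ni; apply: sF; exact: ltnW|exact: sF].
Qed.

Lemma sqint_lty f : measurable_fun [set: T] f ->
  (\int[mu]_x (f x ^+ 2)%:E < +oo)%E -> sqint f.
Proof.
move=> mf foo; split => //; apply/integrableP; split.
  by apply/measurable_EFinP; exact: measurable_funX.
by under eq_integral do rewrite /= ger0_norm ?sqr_ge0//.
Qed.

Lemma summable_lty f : measurable_fun [set: T] f ->
  (\int[mu]_x (`|f x|)%:E < +oo)%E -> summable_fun f.
Proof. by move=> mf foo; apply/integrableP; split=> //; exact/measurable_EFinP. Qed.

Lemma Rintegral_fineK f : summable_fun f ->
  (\int[mu]_x f x)%:E = (\int[mu]_x (f x)%:E)%E.
Proof. by move=> sf; rewrite /Rintegral fineK//; exact: integrable_fin_num. Qed.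

Lemma ae_eq_Rintegral f g : measurable_fun [set: T] f ->
  measurable_fun [set: T] g -> {ae mu, forall x, f x = g x} ->
  \int[mu]_x f x = \int[mu]_x g x.
Proof.
move=> mf mg fg; rewrite /Rintegral; congr fine; apply: ae_eq_integral => //;
  [exact/measurable_EFinP|exact/measurable_EFinP|].
by apply: filterS fg => x fg _; rewrite /= fg.
Qed.

End integrability.

Section finite_measure_integrability.
Context d (T : measurableType d) (R : realType).
Variable mu : {finite_measure set T -> \bar R}.
Implicit Types f : T -> R.

Lemma summable_cst r : summable_fun mu (fun=> r).
Proof. exact: finite_measure_integrable_cst. Qed.

Lemma summable_bounded f C : measurable_fun [set: T] f ->
  (forall x, `|f x| <= C) -> summable_fun mu f.
Proof. by move=> mf fC; apply: summable_le (summable_cst C). Qed.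

Lemma sqint_bounded f C : measurable_fun [set: T] f ->
  (forall x, `|f x| <= C) -> sqint mu f.
Proof.
move=> mf fC; split=> //; apply: (@summable_bounded _ (C ^+ 2)).
  exact: measurable_funX.
by move=> x; rewrite normrX lerXn2r// ?nnegrE// (le_trans _ (fC x)).
Qed.

Lemma sqint_summable f : sqint mu f -> summable_fun mu f.
Proof.
move=> sf; have s1 : sqint mu (fun=> 1) by apply: (@sqint_bounded _ 1) => // x; rewrite normr1.
by have := sqint_mul sf s1; under [X in summable_fun _ X -> _]eq_fun do rewrite mulr1.
Qed.

End finite_measure_integrability.

Section fubini_real.
Context d1 d2 (T1 : measurableType d1) (T2 : measurableType d2) (R : realType).
Variables (m1 : {sigma_finite_measure set T1 -> \bar R})
          (m2 : {sigma_finite_measure set T2 -> \bar R}).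
Variable f : T1 * T2 -> R.
Hypothesis sf : summable_fun (m1 \x m2)%E f.

Lemma ae_summable1 : {ae m1, forall x, summable_fun m2 (fun y => f (x, y))}.
Proof. by have := ae_integrable1 sf. Qed.

Lemma ae_summable2 : {ae m2, forall y, summable_fun m1 (fun x => f (x, y))}.
Proof. by have := ae_integrable2 sf. Qed.

Lemma measurable_Rintegral1 : measurable_fun [set: T1] (fun x => \int[m2]_y f (x, y)).
Proof. by apply: measurableT_comp => //; have := measurable_fubini_F sf. Qed.

Lemma measurable_Rintegral2 : measurable_fun [set: T2] (fun y => \int[m1]_x f (x, y)).
Proof. by apply: measurableT_comp => //; have := measurable_fubini_G sf. Qed.

Let aeF : {ae m1, forall x, (\int[m2]_y f (x, y))%:E = fubini_F m2 (EFin \o f) x}.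
Proof.
by apply: filterS ae_summable1 => x sx; rewrite Rintegral_fineK.
Qed.

Let aeG : {ae m2, forall y, (\int[m1]_x f (x, y))%:E = fubini_G m1 (EFin \o f) y}.
Proof.
by apply: filterS ae_summable2 => x sx; rewrite Rintegral_fineK.
Qed.

Lemma summable_Rintegral1 : summable_fun m1 (fun x => \int[m2]_y f (x, y)).
Proof.
have iF := integrable_fubini_F sf; apply/integrableP; split.
  by apply/measurable_EFinP; exact: measurable_Rintegral1.
have /integrableP[mF] := iF; apply: le_lt_trans; apply: ae_ge0_le_integral => //.
- by apply/measurableT_comp => //; apply/measurable_EFinP; exact: measurable_Rintegral1.
- exact: measurableT_comp.
- by apply: filterS aeF => x /= xE _; rewrite -xE.
Qed.

Lemma summable_Rintegral2 : summable_fun m2 (fun y => \int[m1]_x f (x, y)).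
Proof.
have mf : measurable_fun setT (abse \o (EFin \o f)).
  by apply: measurableT_comp => //; exact: measurable_int sf.
apply/integrableP; split.
  by apply/measurable_EFinP; exact: measurable_Rintegral2.
have := (integrable21ltyP m1 m2 (measurable_int _ sf)).1 sf.
apply: le_lt_trans; apply: ae_ge0_le_integral => //.
- by apply/measurableT_comp => //; apply/measurable_EFinP; exact: measurable_Rintegral2.
- by move=> y _; exact: integral_ge0.
- by apply: (measurable_fun_fubini_tonelli_G (abse \o (EFin \o f))) => //= ?; exact: abse_ge0.
- apply: filterS ae_summable2 => y sy _; rewrite /= EFin_normr_Rintegral//.
  by apply: le_abse_integral => //; exact: measurable_int sy.
Qed.

Lemma Rfubini1 : \int[m1]_x \int[m2]_y f (x, y) = \int[(m1 \x m2)%E]_z f z.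
Proof.
rewrite [RHS]/Rintegral -(integral12_prod_meas1 sf) [LHS]/Rintegral; congr fine.
apply: ae_eq_integral => //.
- by apply/measurable_EFinP; exact: measurable_Rintegral1.
- exact: (measurable_fubini_F sf).
- by apply: filterS aeF => x + _.
Qed.

Lemma Rfubini2 : \int[m2]_y \int[m1]_x f (x, y) = \int[(m1 \x m2)%E]_z f z.
Proof.
rewrite [RHS]/Rintegral -(integral21_prod_meas1 sf) [LHS]/Rintegral; congr fine.
apply: ae_eq_integral => //.
- by apply/measurable_EFinP; exact: measurable_Rintegral2.
- exact: (measurable_fubini_G sf).
- by apply: filterS aeG => x + _.
Qed.

Lemma Rfubini : \int[m1]_x \int[m2]_y f (x, y) = \int[m2]_y \int[m1]_x f (x, y).
Proof. by rewrite Rfubini1 Rfubini2. Qed.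

End fubini_real.

Lemma measurable_wrtI (S : Type) (R : realType) (G G' : set (set S)) (h : S -> R) :
  G `<=` G' -> measurable_wrt setT G h -> measurable_wrt setT G' h.
Proof. by move=> GG' hG A mA; exact/GG'/hG. Qed.

Lemma measurable_wrt_fun d (T : measurableType d) (R : realType)
    (G : set (set T)) (h : T -> R) : G `<=` measurable ->
  measurable_wrt setT G h -> measurable_fun setT h.
Proof. by move=> Gm hG _ A mA; exact/Gm/hG. Qed.

(** * Orthogonality to a sigma-algebra *)

Section subgraph.
Context d (T : measurableType d) (R : realType).

(** Its indicator writes a nonnegative psi x as the measure of [0, psi x[. *)
Definition subgraph (psi : T -> R) : set (T * R) := [set v | 0 <= v.2 < psi v.1].

Lemma measurable_subgraph (psi : T -> R) : measurable_fun setT psi ->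
  measurable (subgraph psi).
Proof.
move=> mpsi.
have -> : subgraph psi = (snd @^-1` `[0, +oo[) `&` ((fun v => psi v.1 - v.2) @^-1` `]0, +oo[).
  apply/seteqP; split => v /=; rewrite !in_itv/= !andbT subr_gt0.
    by move=> /andP[].
  by move=> [h1 h2]; rewrite /subgraph/= h1 h2.
apply: measurableI.
  by rewrite -[X in measurable X]setTI; apply: measurable_snd.
rewrite -[X in measurable X]setTI.
by apply: (measurable_funB (measurableT_comp mpsi measurable_fst) measurable_snd).
Qed.

Lemma indic_subgraph (psi : T -> R) x t :
  \1_(subgraph psi) (x, t) = \1_(`[0, psi x[%classic : set R) t :> R.
Proof.
by rewrite !indicE; congr ((_ : bool)%:R); apply/idP/idP; rewrite !inE /subgraph/= in_itv.
Qed.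

End subgraph.

Section orthogonality.
Context d (T : measurableType d) (R : realType).
Variable mu : {sigma_finite_measure set T -> \bar R}.
Local Notation leb := (@lebesgue_measure R).

Lemma Rintegral_mulr_indic (g : T -> R) (A : set T) :
  \int[mu]_x (\1_A x * g x) = \int[mu]_(x in A) g x.
Proof.
rewrite [RHS]Rintegral_mkcond; apply: eq_Rintegral => x _.
by rewrite patchE indicE; case: (x \in A); rewrite ?mul1r ?mul0r.
Qed.

Lemma fine_lebesgue_itv (y : R) : 0 <= y -> fine (leb `[0, y[%classic) = y.
Proof.
move=> y0; rewrite lebesgue_measure_itv/= lte_fin.
by case: ltgtP y0 => //= _ _; rewrite oppr0 addr0.
Qed.

Lemma Rintegral_subgraph (y c : R) : 0 <= y ->
  \int[leb]_t (\1_(`[0, y[%classic : set R) t * c) = y * c.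
Proof.
move=> y0; rewrite RintegralZr//; last exact: integrable_indic_itv.
by congr (_ * _); rewrite /Rintegral integral_indic// setIT; exact: fine_lebesgue_itv.
Qed.

(** Writing psi as an integral of indicators of sets {t < psi}, which belong to G,
    reduces the claim to these indicators by Fubini. *)
Lemma integral_mul_ge0_eq0 (G : set (set T)) (g psi : T -> R) :
  G `<=` measurable -> summable_fun mu g ->
  (forall A, G A -> \int[mu]_(x in A) g x = 0) ->
  measurable_wrt setT G psi -> (forall x, 0 <= psi x) ->
  summable_fun mu (fun x => psi x * g x) -> \int[mu]_x (psi x * g x) = 0.
Proof.
move=> Gm sg g0 mpsi psi0 spg.
have mf : measurable_fun setT psi by exact: measurable_wrt_fun mpsi.
have mg := summable_measurable sg.
pose A := subgraph psi; have mA : measurable A by exact: measurable_subgraph.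
have AE := indic_subgraph psi.
pose f (v : T * R) := \1_A v * g v.1.
have mfv : measurable_fun setT f.
  apply: measurable_funM; first exact: measurable_indic.
  exact: measurableT_comp.
have sf : summable_fun (mu \x leb)%E f.
  apply/(integrable12ltyP mu leb); first exact/measurable_EFinP.
  have /integrableP[_] := summable_norm spg.
  apply: le_lt_trans; rewrite le_eqVlt; apply/orP; left; apply/eqP.
  apply: eq_integral => x _ /=; rewrite normr_id normrM (ger0_norm (psi0 x)).
  rewrite -(Rintegral_subgraph `|g x| (psi0 x)) Rintegral_fineK; last first.
    under [X in summable_fun _ X]eq_fun do rewrite mulrC.
    by apply: summableZ; exact: integrable_indic_itv.
  apply: eq_integral => t _; rewrite /f normrM AE ger0_norm//.
have <- : \int[mu]_x \int[leb]_t f (x, t) = \int[mu]_x (psi x * g x).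
  apply: eq_Rintegral => x _; rewrite -(Rintegral_subgraph (g x) (psi0 x)).
  by apply: eq_Rintegral => t _; rewrite /f/= AE.
rewrite (Rfubini sf).
transitivity (\int[leb]_(t in setT) (0 : R)); last by rewrite Rintegral_cst// mul0r.
apply: eq_Rintegral => t _; have [t0|t0] := leP 0 t.
  rewrite -(g0 _ (mpsi `]t, +oo[%classic (measurable_itv _))) setTI.
  rewrite -(Rintegral_mulr_indic g); apply: eq_Rintegral => x _; rewrite /f; congr (_ * _).
  rewrite !indicE; congr ((_ : bool)%:R).
  by apply/idP/idP; rewrite !inE /A /subgraph/= t0 in_itv/= andbT// => -[].
apply: Rintegral_eq0 => x; rewrite /f/= AE indicE memNset ?mul0r//=.
by rewrite in_itv/= leNgt t0.
Qed.

(** Orthogonality to the indicators of G extends to functions measurable with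
    respect to G. This is how conditional expectations and independence enter. *)
Lemma integral_mul_eq0 (G : set (set T)) (g psi : T -> R) :
  G `<=` measurable -> summable_fun mu g ->
  (forall A, G A -> \int[mu]_(x in A) g x = 0) ->
  measurable_wrt setT G psi ->
  summable_fun mu (fun x => psi x * g x) -> \int[mu]_x (psi x * g x) = 0.
Proof.
move=> Gm sg g0 mpsi spg.
have mg := summable_measurable sg.
have mpn (s : R) : measurable_fun setT (fun x => Num.max 0 (s * x)).
  by apply: measurable_maxr => //; apply: measurable_funM.
have mp s : measurable_wrt setT G (fun x => Num.max 0 (s * psi x)).
  by move=> A mA; have := mpsi _ (mpn s measurableT A mA); rewrite setTI.
have sp s : `|s| = 1 -> summable_fun mu (fun x => Num.max 0 (s * psi x) * g x).
  move=> s1; apply: summable_le (summable_norm spg).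
    by apply: measurable_funM => //; exact: measurable_wrt_fun (mp s).
  move=> x; rewrite !normrM ler_wpM2r// -[leRHS]mul1r -s1 -normrM.
  by have [h|h] := leP 0 (s * psi x); rewrite ?normr0//.
have i0 s : `|s| = 1 -> \int[mu]_x (Num.max 0 (s * psi x) * g x) = 0.
  move=> s1; apply: (integral_mul_ge0_eq0 Gm) => //; last exact: sp.
  by move=> x; rewrite le_max lexx.
have := RintegralB measurableT (sp 1 (normr1 _)) (sp (-1) (normrN1 _)).
rewrite !i0 ?normr1 ?normrN1// subr0 => <-; apply: eq_Rintegral => x _.
rewrite -mulrBl mul1r mulN1r; congr (_ * _).
by case: (leP 0 (psi x)) => h; case: (leP 0 (- psi x)); lra.
Qed.

End orthogonality.

(** * Translations of the line *)

Section translation.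
Context {R : realType}.
Local Notation leb := (@lebesgue_measure R).

Lemma measurable_shift (c : R) : measurable_fun [set: R] (fun x => x + c).
Proof. exact: measurable_funD. Qed.

(** Lebesgue measure is determined by its values on the intervals ]a, b]. *)
Lemma lebesgue_measure_shift (c : R) (A : set R) : measurable A ->
  leb ((fun x => x + c) @^-1` A) = leb A.
Proof.
move=> mA.
rewrite -[LHS]/(pushforward leb ((fun x => x + c) : _ -> measurableTypeR R) A).
apply/esym/lebesgue_measure_unique => //=; first exact: measurable_shift.
move=> mf _ [[a b]] _ <-; rewrite /pushforward.
have -> : (fun x => x + c) @^-1` [set` `]a, b]] = [set` `](a - c), (b - c)]].
  by apply/seteqP; split => x /=; rewrite !in_itv/= ltrBlDr lerBrDr.
rewrite /= !lebesgue_measure_itv/= !lte_fin.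
by rewrite ltrD2r; case: ifPn => // _; rewrite -!EFinD; congr EFin; ring.
Qed.

Lemma ge0_integral_shift (f : R -> \bar R) (c : R) : measurable_fun setT f ->
  (forall x, 0 <= f x)%E -> (\int[leb]_x f (x + c)%R = \int[leb]_x f x)%E.
Proof.
move=> mf f0.
have := @ge0_integral_pushforward _ _ _ (measurableTypeR R) R
  ((fun x => x + c) : measurableTypeR R -> measurableTypeR R)
  (measurable_shift c) lebesgue_measure setT f
  measurableT mf (fun x _ => f0 x).
rewrite preimage_setT => <-.
apply: eq_measure_integral => [|mf' A mA _]; first exact: measurable_shift.
exact: lebesgue_measure_shift.
Qed.

Lemma Rintegral_shift (f : R -> R) (c : R) : measurable_fun setT f ->
  \int[leb]_x f (x + c) = \int[leb]_x f x.
Proof.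
move=> mf; rewrite /Rintegral; congr fine; rewrite integralE [RHS]integralE.
have mE : measurable_fun setT (EFin \o f) by exact/measurable_EFinP.
have h (g : R -> \bar R) : measurable_fun setT g -> (forall x, (0 <= g x)%E) ->
    (\int[leb]_x g (x + c)%R = \int[leb]_x g x)%E by exact: ge0_integral_shift.
congr (_ - _)%E.
  rewrite -[RHS](h _ (measurable_funepos mE) (fun x => funepos_ge0 _ x)).
  by apply: eq_integral => x _; rewrite !funeposE.
rewrite -[RHS](h _ (measurable_funeneg mE) (fun x => funeneg_ge0 _ x)).
by apply: eq_integral => x _; rewrite !funenegE.
Qed.

Lemma ae_shift (Q : R -> Prop) (c : R) : {ae leb, forall x, Q x} ->
  {ae leb, forall x, Q (x + c)}.
Proof.
move=> [N [mN N0 QN]]; exists ((fun x => x + c) @^-1` N); split.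
- by rewrite -[X in measurable X]setTI; exact: measurable_shift.
- by rewrite lebesgue_measure_shift.
- by move=> x /= nQ; apply: QN.
Qed.

End translation.

(** * Independence *)

Section finite_intersections.
Context {T : Type}.
Implicit Types G : set (set T).

(** The pi-system generated by G. *)
Definition finI G : set (set T) := [set E | exists n (F : nat -> set T),
  (forall i, (i < n)%N -> G (F i)) /\ E = \bigcap_(i in `I_n) F i].

Lemma finI_setI G : setI_closed (finI G).
Proof.
move=> _ _ [n [F [GF ->]]] [n' [F' [GF' ->]]].
exists (n + n')%N, (fun i => if (i < n)%N then F i else F' (i - n)%N); split.
  move=> i ni; case: ifPn => [/GF//|]; rewrite -leqNgt => n_i.
  by apply: GF'; rewrite ltn_subLR.
apply/seteqP; split => x /=.
  move=> [Fx F'x] i /= ni; case: ifPn => [/Fx//|]; rewrite -leqNgt => n_i.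
  by apply: F'x; rewrite /= ltn_subLR.
move=> FF'; split => i /= ni.
  by have /= := FF' i (ltn_addr _ ni); rewrite ni.
have := FF' (n + i)%N; rewrite /= ltn_add2l ni => /(_ isT).
by rewrite ltnNge leq_addr/= addKn.
Qed.

Lemma finI_sub G : G `<=` finI G.
Proof.
move=> E GE; exists 1%N, (fun=> E); split => //.
by apply/seteqP; split => x /=; [move=> Ex i|apply; exact: (erefl : (0 < 1)%N)].
Qed.

Lemma finI_setT G : finI G setT.
Proof. by exists 0%N, (fun=> setT); split => //; apply/seteqP. Qed.

Lemma finI_mono G G' : G `<=` G' -> finI G `<=` finI G'.
Proof.
by move=> GG' _ [n [F [GF ->]]]; exists n, F; split => // i /GF /GG'.
Qed.

Lemma sigma_algebra_bigcapI (S : set (set T)) n (F : nat -> set T) :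
  sigma_algebra setT S -> (forall i, (i < n)%N -> S (F i)) ->
  S (\bigcap_(i in `I_n) F i).
Proof.
move=> [S0 SC SU] SF.
have SCC A : S A -> S (~` A) by move=> SA; rewrite -setTD; exact: SC.
rewrite -[X in S X]setCK setC_bigcap; apply: (SCC).
have -> : \bigcup_(i in `I_n) ~` F i =
    \bigcup_i (if (i < n)%N then ~` F i else set0).
  apply/seteqP; split => x [i]; first by move=> /= ni ?; exists i => //; rewrite ni.
  by move=> _; case: ifPn => // ni; exists i.
by apply: SU => i; case: ifPn => // /SF; exact: SCC.
Qed.

Lemma finI_sigma G : finI G `<=` <<s G >>.
Proof.
move=> _ [n [F [GF ->]]]; apply: sigma_algebra_bigcapI.
  exact: smallest_sigma_algebra.
by move=> i /GF; exact: sub_sigma_algebra.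
Qed.

End finite_intersections.

Section independence.
Context d (T : measurableType d) (R : realType) (P : probability T R).

Definition independent_of (F E : set T) := P (E `&` F) = (P E * P F)%E.

Lemma independent_dynkin F : measurable F ->
  dynkin [set E | measurable E /\ independent_of F E].
Proof.
move=> mF; split.
- by split => //; rewrite /independent_of setTI probability_setT mul1e.
- move=> E [mE iE]; split; first exact: measurableC.
  rewrite /independent_of.
  have -> : ~` E `&` F = F `\` (E `&` F) by rewrite setDIr setDv setU0 setDE setIC.
  rewrite measureD//; last 2 first.
  - exact: measurableI.
  - by rewrite ltey_eq fin_num_measure.
  have -> : F `&` (E `&` F) = E `&` F by rewrite setICA setIid.
  rewrite [X in (_ - X)%E](iE) probability_setC//.
  transitivity ((fine (P F))%:E - (fine (P E))%:E * (fine (P F))%:E)%E.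
    by rewrite !fineK ?fin_num_measure.
  transitivity ((1 - (fine (P E))%:E) * (fine (P F))%:E)%E.
    by rewrite -!EFinM -!EFinB; congr EFin; ring.
  by rewrite !fineK ?fin_num_measure.
- move=> A tA mA; split; first by apply: bigcup_measurable => k _; case: (mA k).
  rewrite /independent_of setI_bigcupl !measure_bigcup//; last 3 first.
  - by move=> k _; case: (mA k).
  - by move=> k _; apply: measurableI => //; case: (mA k).
  - under eq_fun do rewrite setIC.
    exact: trivIset_setIl.
  have PF : P F = (fine (P F))%:E by rewrite fineK ?fin_num_measure.
  rewrite [X in (_ * X)%E]PF muleC -nneseriesZl//.
  apply: eq_eseriesr => k _ /=; have [_ iA] := mA k; rewrite -PF muleC; exact: iA.
Qed.

(** The events independent of F form a Dynkin system. *)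
Lemma independent_sigma (Pi : set (set T)) F : Pi `<=` measurable ->
  setI_closed Pi -> measurable F -> (forall E, Pi E -> independent_of F E) ->
  forall E, <<s Pi >> E -> independent_of F E.
Proof.
move=> mPi IPi mF iPi E; rewrite -setI_closed_g_dynkin_g_sigma_algebra// => sE.
suff [] : [set E | measurable E /\ independent_of F E] E by [].
apply: sE; split; first exact: independent_dynkin.
by move=> A PA; split; [exact: mPi|exact: iPi].
Qed.

Lemma negligible_independent F E : measurable F -> measure_is_complete P ->
  P.-negligible E -> independent_of F E.
Proof.
move=> mF cP nE; rewrite /independent_of.
have h A : P.-negligible A -> P A = 0%E.
  by move=> nA; apply/negligibleP; [exact: cP|].
rewrite [in RHS]h// mul0e; apply: h; apply: negligibleS nE; exact: subIsetl.
Qed.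

(** The pi-system on which the independence of finitely many coordinates is
    postulated. *)
Definition rectangles d' (T' : measurableType d') n (xi : nat -> T -> T') :=
  [set E | exists A : nat -> set T', (forall i, measurable (A i)) /\
     E = \bigcap_(i in `I_n) [set w | A i (xi i w)]].

Lemma rectangles_setI d' (T' : measurableType d') n (xi : nat -> T -> T') :
  setI_closed (rectangles n xi).
Proof.
move=> _ _ [A [mA ->]] [A' [mA' ->]].
exists (fun i => A i `&` A' i); split; first by move=> i; exact: measurableI.
by rewrite -bigcapI; apply: eq_bigcapr => i _.
Qed.

Lemma measurable_rectangles_coord d' (T' : measurableType d') n
    (xi : nat -> T -> T') i : (i < n)%N ->
  measurable_fun [set: g_sigma_algebraType (rectangles n xi)] (xi i).
Proof.
move=> ni _ A mA; apply: sub_sigma_algebra.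
exists (fun j => if j == i then A else setT); split.
  by move=> j; case: ifPn.
rewrite setTI; apply/seteqP; split => w /=.
  by move=> Aw j _; case: ifPn => // /eqP ->.
by move=> /(_ i ni)/=; rewrite eqxx.
Qed.

(** Compare the product formulas for n + 1 and for n coordinates. *)
Lemma independent_last d' (T' : measurableType d') n (xi : nat -> T -> T') :
  (forall i, measurable_fun setT (xi i)) ->
  (forall m (A : nat -> set T'), (m <= n.+1)%N -> (forall i, measurable (A i)) ->
     P (\bigcap_(i in `I_m) [set w | A i (xi i w)]) =
     (\big[*%E/1%E]_(i < m) P [set w | A i (xi i w)])%E) ->
  forall (C : set T') (E : set T), measurable C -> <<s rectangles n xi >> E ->
  independent_of [set w | C (xi n w)] E.
Proof.
move=> mxi prodP C E mC.
have mpre i (A : set T') : measurable A -> measurable [set w | A (xi i w)].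
  by move=> mA; rewrite -[X in measurable X]setTI; exact: mxi.
apply: independent_sigma; [|exact: rectangles_setI|exact: mpre|].
  move=> _ [A [mA ->]]; apply: bigcap_measurableType => i _; exact: mpre.
move=> _ [A [mA ->]]; rewrite /independent_of.
pose A' i := if i == n then C else A i.
have mA' i : measurable (A' i) by rewrite /A'; case: ifP.
have e1 : \bigcap_(i in `I_n) [set w | A i (xi i w)] =
          \bigcap_(i in `I_n) [set w | A' i (xi i w)].
  by apply: eq_bigcapr => i /= ni; rewrite /A' ltn_eqF.
have -> : (\bigcap_(i in `I_n) [set w | A i (xi i w)]) `&` [set w | C (xi n w)] =
          \bigcap_(i in `I_n.+1) [set w | A' i (xi i w)].
  rewrite e1; apply/seteqP; split => w /=.
    move=> [H Cw] i /=; rewrite ltnS leq_eqVlt => /predU1P[->|/H//].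
    by rewrite /A' eqxx.
  move=> H; split; first by move=> i /= ni; apply: H; rewrite /= ltnW.
  by have := H n (ltnSn _); rewrite /= /A' eqxx.
by rewrite e1 !prodP// big_ord_recr/= {2}/A' eqxx.
Qed.

End independence.

Lemma sigma_sub_measurable (S : Type) (G G' : set (set S)) :
  G `<=` <<s G' >> -> <<s G >> `<=` <<s G' >>.
Proof. by move=> GG'; apply: smallest_sub => //; exact: smallest_sigma_algebra. Qed.

(** * Independence of later noise from the past *)

Section noise.
Context {d : measure_display} {Om : measurableType d} {R : realType}.
Variable M : model Om R.
Hypothesis hM : noisy_setting M.

Local Notation delta := (delay M).
Local Notation P := (prob M).
Local Notation B := (bm M).
Local Notation N := (prm M).

Lemma delay_gt0 : 0 < delta. Proof. by case: hM => -[]. Qed.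

Lemma horizon_gt0 : 0 < horizon M. Proof. by case: hM => -[]. Qed.

Lemma complete_prob : measure_is_complete P. Proof. by case: hM => -[]. Qed.

Lemma measurable_bm t : - delta <= t -> measurable_fun setT (B t).
Proof. by case: hM => _ [[+ _ _ _ _] _ _ _]; exact. Qed.

Lemma measurable_prm (D : set (R * R)) : measurable D -> D `<=` `]0, +oo[ `*` setT ->
  measurable_fun setT (fun w => N w D).
Proof. by case: hM => _ [_ _ [+ _ _] _]; exact. Qed.

Lemma measurable_compensated (D : set (R * R)) : measurable D ->
  D `<=` `]0, +oo[ `*` setT -> measurable_fun setT (fun w => compensated M w D).
Proof.
move=> mD D0; apply: measurable_funB => //.
by apply: measurableT_comp => //; exact: measurable_prm.
Qed.

Lemma strip_sub (t : R) : `]0, t] `*` setT `<=` (`]0, +oo[ `*` setT : set (R * R)).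
Proof.
by move=> -[s x] [] /=; rewrite !in_itv/= => /andP[s0 _] _; rewrite s0.
Qed.

Lemma bm_events_measurable t : bm_events M t `<=` measurable.
Proof.
move=> _ [s [A [/andP[s0 st] mA ->]]]; rewrite -[X in measurable X]setTI.
apply: (measurable_funB (measurable_bm s0) _) => //; apply: measurable_bm; exact: lexx.
Qed.

Lemma prm_events_measurable t : prm_events M t `<=` measurable.
Proof.
move=> _ [D [A [mD Dt _ mA ->]]]; rewrite -[X in measurable X]setTI.
by apply: measurable_compensated => //; apply: subset_trans Dt (@strip_sub t).
Qed.

Lemma negligible_measurable : P.-negligible `<=` measurable.
Proof. by move=> A nA; apply: complete_prob. Qed.

Lemma finI_measurable (G : set (set Om)) : G `<=` measurable -> finI G `<=` measurable.
Proof.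
move=> Gm _ [n [F [GF ->]]]; apply: bigcap_measurableType => i /= ni.
exact/Gm/GF.
Qed.

(** Only increments over consecutive intervals are postulated to be independent.
    Sorting the times of the events in E writes these events in terms of the
    increments over one grid, which ends with a and b. *)
Lemma bm_increment_indep a b (C : set R) (E : set Om) : - delta <= a -> a <= b ->
  measurable C -> finI (bm_events M a) E ->
  independent_of P [set w | C (B b w - B a w)] E.
Proof.
move=> da ab mC [n [F [GF ->]]].
have [p Hp] : exists p : nat -> R * set R, forall i, (i < n)%N ->
    [/\ - delta <= (p i).1 <= a, measurable (p i).2 &
      F i = [set w | (p i).2 (B (p i).1 w - B (- delta) w)]].
  have /choice [p Hp] : forall i, exists q : R * set R, (i < n)%N ->
    [/\ - delta <= q.1 <= a, measurable q.2 &
      F i = [set w | q.2 (B q.1 w - B (- delta) w)]].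
    move=> i; have [ni|] := boolP (i < n)%N; last by exists (0, set0).
    by have [s [A HA]] := GF i ni; exists (s, A).
  by exists p.
pose l := sort <=%R [seq (p i).1 | i <- iota 0 n].
have sl : size l = n by rewrite size_sort size_map size_iota.
have lP x : x \in l -> - delta <= x <= a.
  rewrite mem_sort => /mapP[i]; rewrite mem_iota add0n => /andP[_ ni] ->.
  by have [] := Hp i ni.
pose L := - delta :: l ++ [:: a; b].
have sL : sorted <=%R L.
  rewrite /L/= cat_path; apply/andP; split.
    rewrite path_sortedE; last exact: le_trans.
    apply/andP; split; first by apply/allP => x /lP /andP[].
    exact: sort_le_sorted.
  rewrite /= ab !andbT.
  have : last (- delta) l \in - delta :: l by exact: mem_last.
  by rewrite inE => /predU1P[->//|/lP /andP[]].
pose u k := nth b L k.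
have szL : size L = n.+3 by rewrite /L/= size_cat sl addn2.
have u0 : u 0%N = - delta by [].
have un1 : u n.+1 = a by rewrite /u /L/= nth_cat sl ltnn subnn.
have un2 : u n.+2 = b by rewrite /u /L/= nth_cat sl ltnNge leqnSn/= subSnn.
have umon i : (i < n.+2)%N -> u i <= u i.+1.
  by move=> ni; move/(sortedP b): sL; apply; rewrite szL ltnS.
pose xi i w := B (u i.+1) w - B (u i) w.
have mu i : - delta <= u i.
  have [iL|] := ltnP i (size L); last by move=> Li; rewrite /u nth_default// (le_trans da).
  have : u i \in L by exact: mem_nth.
  rewrite /L inE mem_cat !inE => /or3P[/eqP->//|/lP/andP[]//|/orP[/eqP->//|/eqP->]].
  exact: le_trans ab.
have mxi i : measurable_fun setT (xi i).
  by apply: measurable_funB; exact: measurable_bm.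
have [_ [[_ _ _ _ indB] _ _ _]] := hM.
have -> : [set w | C (B b w - B a w)] = [set w | C (xi n.+1 w)] by rewrite /xi un1 un2.
apply: independent_last => //.
  by move=> k A kn mA; apply: (indB k u A) => // i ik; apply: umon; exact: leq_trans kn.
apply: sigma_algebra_bigcapI; first exact: smallest_sigma_algebra.
move=> i ni; have [_ mA ->] := Hp i ni.
have [k kn uk] : exists2 k, (k < n.+1)%N & u k = (p i).1.
  have : (p i).1 \in l by rewrite mem_sort; apply/mapP; exists i => //; rewrite mem_iota.
  move=> pl; exists (index (p i).1 l).+1; first by rewrite ltnS -sl index_mem.
  by rewrite /u /L/= nth_cat index_mem pl nth_index.
pose S := fun w => \sum_(j < k) xi j w.
have SE w : B (p i).1 w - B (- delta) w = S w.
  rewrite -uk -u0 /S; elim: k {kn uk S} => [|k IH]; first by rewrite big_ord0 subrr.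
  by rewrite big_ord_recr/= -IH /xi; lra.
have mS : measurable_fun [set: g_sigma_algebraType (rectangles n.+1 xi)] S.
  rewrite /S; apply: measurable_sum => j.
  by apply: measurable_rectangles_coord; exact: ltn_trans kn.
have := mS measurableT _ mA; rewrite setTI.
by under [X in _ -> _ X]eq_set do rewrite SE.
Qed.

(** The atoms of the algebra generated by D_0, ..., D_{n-1}: the points that lie
    in D_i exactly for the i in S. The empty S is excluded, so that all atoms lie
    in the union of the D_i. *)
Definition cell n (D : nat -> set (R * R)) (S : {set 'I_n}) : set (R * R) :=
  [set x | (exists2 i : 'I_n, i \in S & True) /\
           S = [set i : 'I_n | `[< D i x >]]%SET].

Lemma measurable_cell n (D : nat -> set (R * R)) (S : {set 'I_n}) :
  (forall i, (i < n)%N -> measurable (D i)) -> measurable (cell D S).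
Proof.
move=> mD; have [[j jS _]|h] := pselect (exists2 i : 'I_n, i \in S & True); last first.
  by rewrite (_ : cell _ _ = set0)//; apply/seteqP; split => x // -[].
have -> : cell D S = \bigcap_(i in [set: 'I_n]) (if i \in S then D i else ~` D i).
  apply/seteqP; split => x /=.
    by move=> [_ SE] i _; case: ifPn; rewrite SE inE => /asboolP.
  move=> H; split; first by exists j.
  apply/setP => i; rewrite inE; have := H i I; case: ifPn => iS Dx.
    by apply/esym/asboolP.
  by apply/esym/asboolP.
apply: fin_bigcap_measurable => // i _; case: ifPn => _; first exact: mD.
by apply: measurableC; exact: mD.
Qed.

(** Independence is postulated for disjoint sets only: the D_i of the events in E
    are cut into atoms, which are disjoint from one another and from D'. *)
Lemma prm_increment_indep l (D' : set (R * R)) (C : set (\bar R)) (E : set Om) :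
  measurable D' -> D' `<=` `]0, +oo[ `*` setT ->
  D' `&` (`]0, l] `*` setT) = set0 -> measurable C -> finI (prm_events M l) E ->
  independent_of P [set w | C (N w D')] E.
Proof.
move=> mD' D'0 D'l mC [n [F [GF ->]]].
have [D HD] : exists D : nat -> set (R * R), forall i, (i < n)%N ->
    [/\ measurable (D i), D i `<=` `]0, l] `*` setT &
      exists2 A : set R, measurable A &
      F i = [set w | A (compensated M w (D i))]].
  have /choice [p Hp] : forall i, exists D : set (R * R), (i < n)%N ->
    [/\ measurable D, D `<=` `]0, l] `*` setT & exists2 A : set R, measurable A &
      F i = [set w | A (compensated M w D)]].
    move=> i; have [ni|] := boolP (i < n)%N; last by exists set0.
    by have [D [A [mD Dl _ mA FE]]] := GF i ni; exists D => _; split=> //; exists A.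
  by exists p.
pose sS := enum {set 'I_n}; pose m := size sS.
pose K k := if (k < m)%N then cell D (nth finset.set0 sS k) else D'.
have mK k : measurable (K k).
  rewrite /K; case: ifPn => // _; apply: measurable_cell => i /HD[]//.
have KD k : (k < m)%N -> K k `<=` `]0, l] `*` setT.
  move=> km x; rewrite /K km => -[[i iS _] SE].
  by move: iS; rewrite SE inE => /asboolP; have [_ + _] := HD i (ltn_ord i); exact.
have K0 k : K k `<=` `]0, +oo[ `*` setT.
  have [km|km] := boolP (k < m)%N; first exact: subset_trans (KD _ km) (@strip_sub l).
  by rewrite /K (negbTE km).
have tK : trivIset `I_m.+1 K.
  have disj k : (k < m)%N -> K k `&` D' = set0.
    move=> km; rewrite -subset0 -D'l => x [Kx D'x]; split => //; exact: KD Kx.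
  move=> i j /=; rewrite !ltnS => im jm [x [Ki Kj]].
  have [ilt|] := boolP (i < m)%N; have [jlt|] := boolP (j < m)%N.
  - move: Ki Kj; rewrite /K ilt jlt => -[_ Si] [_ Sj].
    apply/eqP; rewrite -(nth_uniq finset.set0 ilt jlt (enum_uniq _)).
    by rewrite Si Sj.
  - move=> jlt'; have /seteqP[+ _] := disj i ilt; move=> /(_ x); case; split => //.
    by move: Kj; rewrite /K (negbTE jlt').
  - move=> ilt'; have /seteqP[+ _] := disj j jlt; move=> /(_ x); case; split => //.
    by move: Ki; rewrite /K (negbTE ilt').
  - by rewrite -!leqNgt => mj mi; apply/eqP; rewrite eqn_leq !(leq_trans _ mi, leq_trans _ mj).
pose xi k w := N w (K k).
have mxi k : measurable_fun setT (xi k) by exact: measurable_prm.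
have [_ [_ _ [_ _ indN] _]] := hM.
have -> : [set w | C (N w D')] = [set w | C (xi m w)] by rewrite /xi /K ltnn.
apply: independent_last => //.
  move=> k A km mA; apply: indN => //; apply: sub_trivIset tK => i /= ik; exact: leq_trans km.
apply: sigma_algebra_bigcapI; first exact: smallest_sigma_algebra.
move=> i ni; have [mDi Dil [A mA ->]] := HD i ni.
pose io := Ordinal ni.
pose K' k := if (k < m)%N && (io \in nth finset.set0 sS k) then K k else set0.
have mK' k : measurable (K' k) by rewrite /K'; case: ifP.
have tK' : trivIset setT K'.
  move=> k k' _ _; rewrite /K'; case: ifPn => [/andP[km _]|_]; last by rewrite set0I => -[].
  case: ifPn => [/andP[km' _]|_]; last by rewrite setI0 => -[].
  by apply: tK => /=; exact: ltnW.
have DE : D i = \big[setU/set0]_(k < m) K' k.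
  rewrite -bigcup_mkord; apply/seteqP; split => x.
    move=> Dx; pose S : {set 'I_n} := [set j : 'I_n | `[< D j x >]]%SET.
    have Sm : (index S sS < m)%N by rewrite index_mem mem_enum.
    have iS : io \in S by rewrite inE; apply/asboolP.
    exists (index S sS) => //=.
    rewrite /K' Sm nth_index ?mem_enum//= iS /K Sm nth_index ?mem_enum//.
    by split=> //; exists io.
  move=> [k /= km]; rewrite /K' km/=; case: ifPn => // ik; rewrite /K km => -[_ SE].
  by move: ik; rewrite SE inE => /asboolP.
have NE w : N w (D i) = (\sum_(k < m) N w (K' k))%E.
  by rewrite DE measure_bigsetU.
have mN : measurable_fun [set: g_sigma_algebraType (rectangles m xi)] (fun w => compensated M w (D i)).
  rewrite /compensated; apply: measurable_funB => //.
  apply: measurableT_comp => //.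
  under eq_fun do rewrite NE.
  apply: emeasurable_sum => k; rewrite /K'; case: ifPn => [/andP[km _]|_].
    exact: (@measurable_rectangles_coord _ _ _ _ m xi k km).
  by under eq_fun do rewrite measure0; exact: measurable_cst.
by have := mN measurableT _ mA; rewrite setTI.
Qed.

Lemma bm_events_mono s t : s <= t -> bm_events M s `<=` bm_events M t.
Proof.
move=> st _ [r [A [/andP[r0 rs] mA ->]]]; exists r, A; split=> //.
by rewrite r0 (le_trans rs).
Qed.

Lemma prm_events_mono s t : s <= t -> prm_events M s `<=` prm_events M t.
Proof.
move=> st _ [D [A [mD Ds iD mA ->]]]; exists D, A; split=> //.
move=> [r x] /Ds[] /=; rewrite !in_itv/= => /andP[-> rs] _; split => //.
exact: le_trans st.
Qed.

Lemma filtration_mono s t : s <= t -> filtration M s `<=` filtration M t.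
Proof.
move=> st; apply: sigma_sub_measurable => E H; apply: sub_sigma_algebra.
by move: H => [[/(bm_events_mono st)|/(prm_events_mono st)]|];
  [left; left|left; right|right].
Qed.

(** A pi-system; the null sets are included because the filtration is augmented. *)
Definition noise_events (a : R) (G : set (set Om)) : set (set Om) :=
  [set E | exists E1 E2, [/\ finI (bm_events M a) E1, finI G E2 & E = E1 `&` E2]]
  `|` P.-negligible.

Lemma noise_events_setI a G : setI_closed (noise_events a G).
Proof.
move=> E E' [|nE]; last by move=> _; right; apply: negligibleS nE => ? [].
move=> [E1 [E2 [bE1 GE2 ->]]] [|nE']; last by right; apply: negligibleS nE' => ? [].
move=> [E1' [E2' [bE1' GE2' ->]]]; left; exists (E1 `&` E1'), (E2 `&` E2').
by split; [exact: finI_setI|exact: finI_setI|rewrite setIACA].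
Qed.

Lemma noise_events_measurable a G : G `<=` measurable ->
  noise_events a G `<=` measurable.
Proof.
move=> Gm E [[E1 [E2 [bE1 GE2 ->]]]|]; last exact: negligible_measurable.
apply: measurableI; first exact: (finI_measurable (@bm_events_measurable a)).
exact: finI_measurable Gm _ _.
Qed.

Lemma noise_events_bm a G : bm_events M a `<=` noise_events a G.
Proof.
move=> E bE; left; exists E, setT; split; [exact: finI_sub|exact: finI_setT|].
by rewrite setIT.
Qed.

Lemma noise_events_prm a G : G `<=` noise_events a G.
Proof.
move=> E bE; left; exists setT, E; split; [exact: finI_setT|exact: finI_sub|].
by rewrite setTI.
Qed.

(** Increments of B after a are independent even of the later jumps; this serves
    when such an increment is multiplied by jumps that occur at the same time. *)
Definition enlarged (a : R) : set (set Om) :=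
  <<s noise_events a (\bigcup_(t in setT) prm_events M t) >>.

Lemma all_prm_measurable : \bigcup_(t in setT) prm_events M t `<=` measurable.
Proof. by move=> E [t _]; exact: prm_events_measurable. Qed.

Lemma filtration_enlarged a : filtration M a `<=` enlarged a.
Proof.
apply: sigma_sub_measurable => E H; apply: sub_sigma_algebra.
case: H => [[bE|pE]|nE].
- exact: noise_events_bm.
- by apply: noise_events_prm; exists a.
- by right.
Qed.

Lemma enlarged_measurable a : enlarged a `<=` measurable.
Proof.
apply: smallest_sub; first exact: sigma_algebra_measurable.
by apply: noise_events_measurable; exact: all_prm_measurable.
Qed.

Lemma filtration_measurable a : filtration M a `<=` measurable.
Proof. exact: subset_trans (@filtration_enlarged a) (@enlarged_measurable a). Qed.

Lemma bm_event_sigma a b (C : set R) : - delta <= a -> - delta <= b -> measurable C ->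
  <<s \bigcup_(t in setT) bm_events M t >> [set w | C (B b w - B a w)].
Proof.
move=> da db mC.
pose G := \bigcup_(t in setT) bm_events M t.
have mB s : - delta <= s ->
    measurable_fun [set: g_sigma_algebraType G] (fun w => B s w - B (- delta) w).
  move=> ds _ A mA; rewrite setTI; apply: sub_sigma_algebra; exists s => //.
  by exists s, A; split => //; rewrite ds lexx.
have := measurable_funB (mB b db) (mB a da) measurableT mC.
rewrite setTI; congr (<<s _ >> _); apply/seteqP; split => w /=;
  by rewrite opprB addrA subrK.
Qed.

(** On the generating pi-system, the jumps are independent of all of B, and the
    events of B before a of the increment after a. *)
Lemma bm_indep a b (C : set R) (E : set Om) : - delta <= a -> a <= b ->
  measurable C -> enlarged a E -> independent_of P [set w | C (B b w - B a w)] E.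
Proof.
move=> da ab mC.
have db : - delta <= b := le_trans da ab.
have mF : measurable [set w | C (B b w - B a w)].
  rewrite -[X in measurable X]setTI.
  by apply: (measurable_funB (measurable_bm db) (measurable_bm da)).
have [_ [_ _ _ indBN]] := hM.
apply: independent_sigma => //.
- by apply: noise_events_measurable; exact: all_prm_measurable.
- exact: noise_events_setI.
move=> {}E [[E1 [E2 [bE1 GE2 ->]]]|]; last exact: negligible_independent complete_prob.
have sB1 : <<s \bigcup_(t in setT) bm_events M t >> E1.
  by apply: finI_sigma; apply: finI_mono bE1 => A bA; exists a.
have sN2 := finI_sigma GE2.
have iBC := bm_increment_indep da ab mC bE1.
rewrite /independent_of setIAC.
rewrite [LHS]indBN//; last first.
  apply: (@measurableI _ (g_sigma_algebraType (\bigcup_(t in setT) bm_events M t))) => //.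
  exact: bm_event_sigma.
have -> : P (E1 `&` E2) = (P E1 * P E2)%E by exact: indBN.
by rewrite [X in (X * _)%E]iBC muleAC.
Qed.

(** As for B, with the roles of B and of the jumps exchanged, except that here the
    jumps up to l are part of the past. *)
Lemma prm_indep l h (D' : set (R * R)) (C : set R) (E : set Om) :
  measurable D' -> D' `<=` `]0, h] `*` setT ->
  D' `&` (`]0, l] `*` setT) = set0 -> (intensity M D' < +oo)%E ->
  measurable C -> filtration M l E ->
  independent_of P [set w | C (compensated M w D')] E.
Proof.
move=> mD' D'h D'l iD' mC.
have D'0 := subset_trans D'h (@strip_sub h).
have mF : measurable [set w | C (compensated M w D')].
  by rewrite -[X in measurable X]setTI; apply: (measurable_compensated mD' D'0).
have [_ [_ _ _ indBN]] := hM.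
have FE : filtration M l `<=` <<s noise_events l (prm_events M l) >>.
  apply: sigma_sub_measurable => A H; apply: sub_sigma_algebra.
  case: H => [[bE|pE]|nE]; [exact: noise_events_bm|exact: noise_events_prm|by right].
move=> /FE; apply: independent_sigma => //.
- by apply: noise_events_measurable; exact: prm_events_measurable.
- exact: noise_events_setI.
move=> {}E [[E1 [E2 [bE1 GE2 ->]]]|]; last exact: negligible_independent complete_prob.
have sB1 : <<s \bigcup_(t in setT) bm_events M t >> E1.
  by apply: finI_sigma; apply: finI_mono bE1 => A bA; exists l.
have GE2' : finI (\bigcup_(t in setT) prm_events M t) E2.
  by apply: finI_mono GE2 => A pA; exists l.
have sN2 := finI_sigma GE2'.
have GF : finI (\bigcup_(t in setT) prm_events M t) [set w | C (compensated M w D')].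
  by apply: finI_sub; exists h => //; exists D', C.
pose C' := (fun x : \bar R => fine x - fine (intensity M D')) @^-1` C.
have mC' : measurable C'.
  rewrite /C' -[X in measurable X]setTI.
  have mf : measurable_fun setT (fun x : \bar R => fine x - fine (intensity M D')).
    by apply: measurable_funB.
  exact: mf.
have iNC : independent_of P [set w | C (compensated M w D')] E2.
  exact: (prm_increment_indep mD' D'0 D'l mC' GE2).
rewrite /independent_of -setIA [LHS]indBN//; last first.
  by apply: finI_sigma; apply: finI_setI.
have -> : P (E1 `&` E2) = (P E1 * P E2)%E by exact: indBN.
by rewrite [X in (_ * X)%E]iNC muleA.
Qed.

End noise.

Lemma normr_indic_le1 (T : Type) (R : realType) (A : set T) x : `|\1_A x| <= 1 :> R.
Proof. by rewrite indicE; case: (x \in A); rewrite ?normr1 ?normr0. Qed.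

Lemma cvg_EFin_comp (R : realType) (u : nat -> R) (l : R) :
  u @ \oo --> l -> (fun n => (u n)%:E) @ \oo --> l%:E.
Proof. by move=> ul; apply/fine_cvgP; split => //; exact: nearW. Qed.

(** * Expectations and laws *)

Section expectation_of_independent.
Context d (T : measurableType d) (R : realType) (P : probability T R).

(** After centring Y, the orthogonality principle is used twice: for g against the
    centred Y, and for Y against the centred indicators of G. *)
Lemma integral_mul_independent (G : set (set T)) (g Y : T -> R) :
  G `<=` measurable -> measurable_wrt setT G g -> measurable_fun setT Y ->
  (forall E (C : set R), G E -> measurable C -> independent_of P [set w | C (Y w)] E) ->
  summable_fun P g -> summable_fun P Y -> summable_fun P (fun w => g w * Y w) ->
  \int[P]_w (g w * Y w) = \int[P]_w g w * \int[P]_w Y w.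
Proof.
move=> Gm mg mY iGY sg sY sgY; set y := \int[P]_w Y w.
have sY0 : summable_fun P (fun w => Y w - y) by apply: summableB => //; exact: summable_cst.
suff : \int[P]_w (g w * (Y w - y)) = 0.
  under eq_Rintegral do rewrite mulrBr.
  rewrite RintegralB//; last first.
    by under [X in _.-integrable _ (EFin \o X)]eq_fun do rewrite mulrC; exact: summableZ.
  by rewrite RintegralZr// => /eqP; rewrite subr_eq0 => /eqP.
apply: (integral_mul_eq0 Gm) => //; last first.
  under [X in summable_fun _ X]eq_fun do rewrite mulrBr.
  apply: summableB => //.
  by under [X in summable_fun _ X]eq_fun do rewrite mulrC; exact: summableZ.
move=> A GA; have mA := Gm _ GA.
pose a := fine (P A).
have mF (C : set R) : measurable C -> measurable [set w | C (Y w)].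
  by move=> mC; rewrite -[X in measurable X]setTI; exact: mY.
have s1 : summable_fun P (\1_A : T -> R).
  by apply: (@summable_bounded _ _ _ _ _ 1) => // w; exact: normr_indic_le1.
have s1a : summable_fun P (fun w => \1_A w - a) by apply: summableB => //; exact: summable_cst.
have sYa : summable_fun P (fun w => Y w * (\1_A w - a)).
  under [X in summable_fun _ X]eq_fun do rewrite mulrC.
  apply: (@summable_bounded_mul _ _ _ _ _ _ (1 + `|a|)) => //.
    by apply: measurable_funB => //; exact: measurable_indic.
  move=> w; rewrite (le_trans (ler_normB _ _))// lerD2r.
  exact: normr_indic_le1.
have h : \int[P]_w (Y w * (\1_A w - a)) = 0.
  apply: (@integral_mul_eq0 _ _ _ _ [set F | exists2 C : set R, measurable C & F = [set w | C (Y w)]]) => //.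
  - by move=> _ [C mC ->]; exact: mF.
  - move=> _ [C mC ->]; have := iGY A C GA mC; rewrite /independent_of => e.
    have mC' := mF C mC.
    rewrite RintegralB//; last 2 first.
    + by apply: integrableS s1.
    + by apply: integrableS (summable_cst P a).
    rewrite Rintegral_cst; last exact: mF.
    rewrite /Rintegral integral_indic//.
    by rewrite [X in fine X](e) fineM ?fin_num_measure ?subrr.
  - by move=> C mC; rewrite setTI; exists C.
rewrite -Rintegral_mulr_indic.
under eq_Rintegral do rewrite mulrBr.
rewrite RintegralB//; last 2 first.
- apply: (@summable_bounded_mul _ _ _ _ _ _ 1) => // w; exact: normr_indic_le1.
- by under [X in _.-integrable _ (EFin \o X)]eq_fun do rewrite mulrC; exact: summableZ.
rewrite RintegralZr//.
have -> : \int[P]_w \1_A w = a by rewrite /Rintegral integral_indic// setIT.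
move: h; under eq_Rintegral do rewrite mulrBr.
rewrite RintegralB//; last 2 first.
- under [X in _.-integrable _ (EFin \o X)]eq_fun do rewrite mulrC.
  by apply: (@summable_bounded_mul _ _ _ _ _ _ 1) => // w; exact: normr_indic_le1.
- by under [X in _.-integrable _ (EFin \o X)]eq_fun do rewrite mulrC; exact: summableZ.
by rewrite RintegralZr// -/y mulrC => <-; congr (_ - _); apply: eq_Rintegral => w _; rewrite mulrC.
Qed.

End expectation_of_independent.

Section layer_cake.
Context d (T : measurableType d) (R : realType).
Variable mu : {sigma_finite_measure set T -> \bar R}.
Local Notation leb := (@lebesgue_measure R).

(** Tonelli on the subgraph of psi. *)
Lemma integral_layer_cake (psi g : T -> R) : measurable_fun setT psi ->
  measurable_fun setT g -> (forall x, 0 <= psi x) -> (forall x, 0 <= g x) ->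
  (\int[mu]_x (psi x * g x)%:E =
   \int[leb]_(t in `[0%R, +oo[) \int[mu]_(x in [set x | (t < psi x)%R]) (g x)%:E)%E.
Proof.
move=> mpsi mg psi0 g0.
pose A := subgraph psi; have mA : measurable A by exact: measurable_subgraph.
have AE := indic_subgraph psi.
pose f (v : T * R) := (\1_A v * g v.1)%:E.
have mfv : measurable_fun setT f.
  apply/measurable_EFinP/measurable_funM; first exact: measurable_indic.
  exact: measurableT_comp.
have f0 v : (0 <= f v)%E by rewrite lee_fin mulr_ge0.
transitivity (\int[mu]_x \int[leb]_t f (x, t))%E.
  apply: eq_integral => x _; rewrite -(Rintegral_subgraph (g x) (psi0 x)).
  rewrite Rintegral_fineK; first by apply: eq_integral => t _; rewrite /f AE.
  by under [X in summable_fun _ X]eq_fun do rewrite mulrC;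
     apply: summableZ; exact: integrable_indic_itv.
transitivity (\int[leb]_t \int[mu]_x f (x, t))%E; first exact: fubini_tonelli.
rewrite [RHS]integral_mkcond; apply: eq_integral => t _.
rewrite patchE; case: ifPn => t0.
  rewrite [RHS]integral_mkcond; apply: eq_integral => x _.
  rewrite patchE /f; move: t0; rewrite inE/= in_itv/= andbT => t0.
  case: ifPn => tx.
    by rewrite indicE mem_set ?mul1r//=; move: tx; rewrite inE /A /subgraph/= t0.
  rewrite indicE memNset ?mul0r//=; move: tx; rewrite notin_setE /A /subgraph/=.
  by apply: contra_not => /andP[].
apply: integral0_eq => x _; rewrite /f indicE memNset ?mul0r//=.
by move: t0; rewrite notin_setE /A /subgraph/= in_itv/= andbT; apply: contra_not => /andP[].
Qed.

End layer_cake.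

Section density.
Context d (T : measurableType d) (R : realType) (P : probability T R).
Local Notation leb := (@lebesgue_measure R).

(** The layer cake formula involves phi through the sets {t < phi} only, whose
    probabilities the density gives. *)
Lemma expectation_density (Y : T -> R) (p phi : R -> R) :
  measurable_fun setT Y -> measurable_fun setT p -> (forall x, 0 <= p x) ->
  (forall A : set R, measurable A -> P [set w | A (Y w)] = (\int[leb]_(x in A) (p x)%:E)%E) ->
  measurable_fun setT phi -> (forall x, 0 <= phi x) ->
  (\int[P]_w (phi (Y w))%:E = \int[leb]_x (phi x * p x)%:E)%E.
Proof.
move=> mY mp p0 PY mphi phi0.
under eq_integral do rewrite -[phi _]mulr1.
rewrite (@integral_layer_cake _ _ _ P (phi \o Y) (fun=> 1))//; [|exact: measurableT_comp|by move=> x; exact: phi0].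
rewrite (@integral_layer_cake _ _ _ leb)//; apply: eq_integral => t _.
have mphit : measurable [set x | t < phi x].
  have := mphi measurableT `]t, +oo[%classic (measurable_itv _).
  rewrite setTI; congr (measurable _); apply/seteqP.
  by split => x /=; rewrite in_itv/= andbT.
rewrite integral_cst ?mul1e; first exact: PY.
by rewrite -[X in measurable X]setTI; exact: (mY measurableT _ mphit).
Qed.

End density.

Section normal_moment.
Context {R : realType}.
Local Notation leb := (@lebesgue_measure R).
Variable s : R.
Hypothesis s0 : 0 < s.

(** F vanishes at 0 and at infinity, so the integral of its derivative f over the
    half-line is zero: the second moment is s^2 times the mass. The half-line is
    cut at s, where f changes sign. *)
Let e (x : R) := expR (- x ^+ 2 / (s ^+ 2 *+ 2)).
Let F (x : R) := - (s ^+ 2) * (x * e x).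
Let f (x : R) := (x ^+ 2 - s ^+ 2) * e x.

Let s2_gt0 : 0 < s ^+ 2 *+ 2.
Proof. by rewrite pmulrn_lgt0// exprn_gt0. Qed.

Let is_derive_F (x : R) : is_derive x 1 F (f x).
Proof.
rewrite /F /f /e; apply: is_derive_eq.
rewrite /GRing.scale/= !mulr1 ?mul1r.
have := s2_gt0 => h; field; rewrite ?gt_eqF//.
Qed.

Let continuous_e : continuous e.
Proof.
move=> x; rewrite /e; apply: continuous_comp; last exact: continuous_expR.
apply: cvgM; last exact: cvg_cst.
by apply: cvgN; apply: exprn_continuous.
Qed.

Let continuous_F : continuous F.
Proof.
move=> x; rewrite /F; apply: cvgM; first exact: cvg_cst.
by apply: cvgM; [exact: cvg_id|exact: continuous_e].
Qed.

Let continuous_f : continuous f.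
Proof.
move=> x; rewrite /f; apply: cvgM; last exact: continuous_e.
by apply: cvgB; [exact: exprn_continuous|exact: cvg_cst].
Qed.

Let F_cvg0 : F x @[x --> +oo] --> 0.
Proof.
have h : x * e x @[x --> +oo] --> (0 : R).
  apply: (@squeeze_cvgr _ _ _ _ (cst 0) (fun x => (s ^+ 2 *+ 2) * x^-1)).
  - near=> x; have x0 : 0 < x by near: x; exact: nbhs_pinfty_gt.
    have y0 : 0 < x ^+ 2 / (s ^+ 2 *+ 2) by rewrite divr_gt0// exprn_gt0.
    have ey : e x <= (x ^+ 2 / (s ^+ 2 *+ 2))^-1.
      rewrite /e mulNr expRN lef_pV2 ?posrE ?expR_gt0//.
      by apply: le_trans (expR_ge1Dx _); rewrite lerDr.
    apply/andP; split; first by rewrite mulr_ge0 ?expR_ge0// ltW.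
    apply: le_trans (ler_wpM2l (ltW x0) ey) _; rewrite le_eqVlt; apply/orP; left; apply/eqP.
    by have := s2_gt0 => h; field; rewrite !gt_eqF.
  - exact: cvg_cst.
  - rewrite -[X in _ --> X](mulr0 (s ^+ 2 *+ 2)).
    apply: cvgM; first exact: cvg_cst.
    apply/gtr0_cvgV0; last exact: cvg_id.
    by near=> x; near: x; exact: nbhs_pinfty_gt.
rewrite -[X in _ --> X](mulr0 (- s ^+ 2)).
by apply: cvgM => //; exact: cvg_cst.
Unshelve. all: by end_near. Qed.

Let e_ge0 x : 0 <= e x. Proof. exact: expR_ge0. Qed.

Let derivable_F x : derivable F x 1.
Proof. by have [] := is_derive_F x. Qed.

Let derive_F x : F^`()%classic x = f x.
Proof. by rewrite derive1E; have [_ ->] := is_derive_F x. Qed.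

Let tail : (\int[leb]_(x in `[s, +oo[) (f x)%:E = (- F s)%:E)%E.
Proof.
rewrite (@ge0_continuous_FTC2y _ f F s 0).
- by rewrite sub0e.
- move=> x sx; rewrite /f mulr_ge0// subr_ge0 lerXn2r// ?nnegrE ltW//.
  exact: lt_le_trans sx.
- exact: continuous_subspaceT.
- exact: F_cvg0.
- by move=> x _; exact: derivable_F.
- by apply: cvg_at_right_filter; exact: continuous_F.
- by move=> x _; exact: derive_F.
Qed.

Let body : (\int[leb]_(x in `[0%R, s]) (- f x)%:E = (- F s)%:E)%E.
Proof.
rewrite (@continuous_FTC2 _ (\- f) (\- F) 0 s)//.
- by rewrite -EFinB /F /=; congr EFin; lra.
- by apply: continuous_subspaceT => x; apply: cvgN; exact: continuous_f.
- split.
  + by move=> x _; apply: derivableN; exact: derivable_F.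
  + by apply: cvgN; apply: cvg_at_right_filter; exact: continuous_F.
  + by apply: cvgN; apply: cvg_at_left_filter; exact: continuous_F.
- by move=> x _; rewrite derive1E deriveN ?derive1E//; rewrite -derive1E derive_F.
Qed.

Let mE (h : R -> R) (A : set R) : continuous h -> measurable_fun A (EFin \o h).
Proof.
move=> ch; apply/measurable_EFinP/measurable_funTS.
exact: continuous_measurable_fun.
Qed.

Let continuous_x2e : continuous (fun x : R => x ^+ 2 * e x).
Proof.
by move=> x; apply: cvgM; [exact: exprn_continuous|exact: continuous_e].
Qed.

Let continuous_s2e : continuous (fun x => s ^+ 2 * e x).
Proof. by move=> x; apply: cvgM; [exact: cvg_cst|exact: continuous_e]. Qed.

Let half_moment : (\int[leb]_(x in `[0%R, +oo[) (x ^+ 2 * e x)%:E =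
  \int[leb]_(x in `[0%R, +oo[) (s ^+ 2 * e x)%:E)%E.
Proof.
have U : `[0, +oo[%classic = `[0, s[%classic `|` `[s, +oo[%classic :> set R.
  by rewrite -itv_bndbnd_setU// bnd_simp ltW.
have D : [disjoint `[0, s[%classic & `[s, +oo[%classic].
  apply/disj_setPS => x [] /=; rewrite !in_itv/= andbT => /andP[_ xs].
  by rewrite leNgt xs.
have pos (h : R -> R) (A : set R) : (forall x, 0 <= h x) -> forall x, A x -> (0 <= (h x)%:E)%E.
  by move=> h0 x _; rewrite lee_fin.
have x2e0 x : 0 <= x ^+ 2 * e x by rewrite mulr_ge0// sqr_ge0.
have s2e0 x : 0 <= s ^+ 2 * e x by rewrite mulr_ge0// sqr_ge0.
rewrite U !ge0_integral_setU//; do ?[exact: mE|exact: pos].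
have nfc : continuous (\- f) by move=> x; apply: cvgN; exact: continuous_f.
have -> : (\int[leb]_(x in `[s, +oo[) (x ^+ 2 * e x)%:E =
    (- F s)%:E + \int[leb]_(x in `[s, +oo[) (s ^+ 2 * e x)%:E)%E.
  rewrite -tail -ge0_integralD//; do ?[exact: mE|exact: pos]; last first.
    move=> x /=; rewrite in_itv/= andbT => sx; rewrite lee_fin /f mulr_ge0//.
    by rewrite subr_ge0 lerXn2r// ?nnegrE ltW//; exact: lt_le_trans sx.
  by apply: eq_integral => x _; rewrite -EFinD; congr EFin; rewrite /f; lra.
have -> : (\int[leb]_(x in `[0%R, s[) (s ^+ 2 * e x)%:E =
    (\int[leb]_(x in `[0%R, s[) (x ^+ 2 * e x)%:E + (- F s)%:E))%E.
  rewrite -body -(@integral_itv_bndo_bndc _ _ s (fun x => (- f x)%:E)); last exact: mE.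
  rewrite -ge0_integralD//; do ?[exact: mE|exact: pos]; last first.
    move=> x /=; rewrite in_itv/= => /andP[x0 xs]; rewrite lee_fin /f -mulNr mulr_ge0//.
    by rewrite opprB subr_ge0 lerXn2r// ?nnegrE ltW.
  by apply: eq_integral => x _; rewrite -EFinD; congr EFin; rewrite /f; lra.
by rewrite addeA.
Qed.

Lemma normal_second_moment :
  (\int[leb]_x (x ^+ 2 * normal_pdf 0 s x)%:E = (s ^+ 2)%:E)%E.
Proof.
have sn0 : s != 0 by rewrite gt_eqF.
pose c := normal_peak s.
have pdfE x : normal_pdf 0 s x = c * e x.
  by rewrite normal_pdfE// /normal_fun subr0.
have c0 : 0 <= c by exact: normal_peak_ge0.
have sym (h : R -> R) : (forall x, 0 <= h x) -> continuous h -> h =1 h \o -%R ->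
    (\int[leb]_x (c * h x)%:E = c%:E * (2%:E * \int[leb]_(x in `[0%R, +oo[) (h x)%:E))%E.
  move=> h0 ch he; under eq_integral do rewrite EFinM.
  rewrite ge0_integralZl_EFin//; last 2 first.
  - by move=> x _; rewrite lee_fin.
  - exact: mE.
  by rewrite ge0_symfun_integralT// set_itvcy.
have eN x : e (- x) = e x by rewrite /e sqrrN.
transitivity (\int[leb]_x (c * (x ^+ 2 * e x))%:E)%E.
  by apply: eq_integral => x _; rewrite pdfE mulrCA.
rewrite sym//; last 2 first.
- by move=> x; rewrite mulr_ge0// sqr_ge0.
- by move=> x /=; rewrite sqrrN eN.
rewrite half_moment -sym//; last 2 first.
- by move=> x; rewrite mulr_ge0// sqr_ge0.
- by move=> x /=; rewrite eN.
transitivity (\int[leb]_x ((s ^+ 2)%:E * (normal_pdf 0 s x)%:E))%E.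
  by apply: eq_integral => x _; rewrite pdfE -EFinM mulrCA.
rewrite ge0_integralZl_EFin ?sqr_ge0//; last 2 first.
- by move=> x _; rewrite lee_fin normal_pdf_ge0.
- by apply/measurable_EFinP; exact: measurable_normal_pdf.
by rewrite integral_normal_pdf mule1.
Qed.

Lemma normal_prob_opp (A : set R) : measurable A ->
  normal_prob 0 s (-%R @^-1` A) = normal_prob 0 s A.
Proof.
move=> mA; rewrite /normal_prob.
have mpdf : measurable_fun setT (EFin \o normal_pdf 0 s).
  by apply/measurable_EFinP; exact: measurable_normal_pdf.
have pdfN x : normal_pdf 0 s (- x) = normal_pdf 0 s x.
  have sn0 : s != 0 by rewrite gt_eqF.
  by rewrite !normal_pdfE// /normal_fun !subr0 sqrrN.
have mN : measurable_fun setT (-%R : measurableTypeR R -> measurableTypeR R).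
  exact: oppr_measurable.
have := @ge0_integral_pushforward _ _ _ (measurableTypeR R) R
  (-%R : measurableTypeR R -> measurableTypeR R) mN lebesgue_measure A
  (EFin \o normal_pdf 0 s) mA (measurable_funTS mpdf).
have h0 : {in A, forall y, (0 <= (EFin \o normal_pdf 0 s) y)%E}.
  by move=> x _; rewrite lee_fin normal_pdf_ge0.
move=> /(_ h0) H; transitivity (\int[leb]_(x in -%R @^-1` A) ((EFin \o normal_pdf 0 s) \o -%R) x)%E.
  by apply: eq_integral => x _; rewrite /= pdfN.
rewrite -[LHS]H; apply: eq_measure_integral => D mD _.
exact: lebesgue_measureN.
Qed.

End normal_moment.

Section poisson_moments.
Context {R : realType}.
Variable la : R.

Let p k : R := la ^+ k / k`!%:R * expR (- la).

Let series_p : series p @ \oo --> (1 : R).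
Proof.
have -> : series p = (fun n => series (exp_coeff la) n * expR (- la)).
  by apply/funext => n; rewrite /series/= mulr_suml; apply: eq_bigr => k _.
rewrite -[X in _ --> X](expRxMexpNx_1 la); apply: cvgM; last exact: cvg_cst.
exact: (is_cvg_series_exp_coeff la).
Qed.

Let la_series : (fun n => la * series p n) @ \oo --> la.
Proof.
by rewrite -[X in _ --> X]mulr1; apply: cvgM; [exact: cvg_cst|exact: series_p].
Qed.

(** The recursion turns the moments into shifted copies of the series of p. *)
Let p_rec k : k.+1%:R * p k.+1 = la * p k.
Proof.
rewrite /p factS natrM exprS.
have h1 : k.+1%:R != 0 :> R by rewrite pnatr_eq0.
have h2 : k`!%:R != 0 :> R by rewrite pnatr_eq0 -lt0n fact_gt0.
by field; rewrite h2 addrC natr1 h1.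
Qed.

Lemma poisson_sum0 : 0 <= la -> (\sum_(k <oo) (p k)%:E = 1)%E.
Proof.
move=> la0; apply/cvg_lim => //.
under eq_fun do rewrite sumEFin.
exact: cvg_EFin_comp series_p.
Qed.

Let series1 n : series (fun k => k%:R * p k) n.+1 = la * series p n.
Proof.
elim: n => [|n IH]; first by rewrite /series/= big_nat1 big_geq// mul0r mulr0.
by rewrite seriesSr IH p_rec [in RHS]seriesSr mulrDr.
Qed.

Lemma poisson_sum1 : 0 <= la -> (\sum_(k <oo) (k%:R * p k)%:E = la%:E)%E.
Proof.
move=> la0; apply/cvg_lim => //.
under eq_fun do rewrite sumEFin.
apply: cvg_EFin_comp; rewrite -cvg_shiftS.
rewrite [X in X @ _ --> _](_ : _ = (fun n => la * series p n)); last first.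
  by apply/funext => n; rewrite -series1.
exact: la_series.
Qed.

Let series2 n : series (fun k => k%:R ^+ 2 * p k) n.+1 =
  la * (series (fun k => k%:R * p k) n + series p n).
Proof.
elim: n => [|n IH]; first by rewrite /series/= big_nat1 !big_geq// expr0n mul0r addr0 mulr0.
rewrite seriesSr IH expr2 -mulrA p_rec [in RHS]seriesSr [in RHS]seriesSr -natr1; lra.
Qed.

Lemma poisson_sum2 : 0 <= la -> (\sum_(k <oo) (k%:R ^+ 2 * p k)%:E = (la * (la + 1))%:E)%E.
Proof.
move=> la0; apply/cvg_lim => //.
under eq_fun do rewrite sumEFin.
apply: cvg_EFin_comp; rewrite -cvg_shiftS.
rewrite [X in X @ _ --> _](_ : _ = (fun n => la * (series (fun k => k%:R * p k) n + series p n))); last first.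
  by apply/funext => n; rewrite -series2.
apply: cvgM; first exact: cvg_cst.
apply: cvgD => //; rewrite -cvg_shiftS.
rewrite [X in X @ _ --> _](_ : _ = (fun n => la * series p n)); last first.
  by apply/funext => n; rewrite -series1.
exact: la_series.
Qed.

End poisson_moments.

Section discrete_law.
Context d (T : measurableType d) (R : realType) (P : probability T R).

(** The values k carry the whole mass, and off them X may be ignored. *)
Lemma expectation_discrete (X : T -> \bar R) (p : nat -> R) (phi : \bar R -> \bar R) :
  measurable_fun setT X -> (forall k, P [set w | X w = k%:R%:E] = (p k)%:E) ->
  (\sum_(k <oo) (p k)%:E = 1)%E -> measurable_fun setT phi -> (forall x, 0 <= phi x)%E ->
  (\int[P]_w phi (X w) = \sum_(k <oo) phi k%:R%:E * (p k)%:E)%E.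
Proof.
move=> mX PX p1 mphi phi0.
pose A k := [set w | X w = k%:R%:E].
have mA k : measurable (A k).
  by rewrite -[X in measurable X]setTI; exact: (mX measurableT [set k%:R%:E]).
have tA : trivIset setT A.
  by move=> i j _ _ [w []]; rewrite /A /subgraph/= => -> [] /eqP; rewrite eqr_nat => /eqP.
have mU : measurable (\bigcup_k A k) by exact: bigcup_measurable.
have PU : P (\bigcup_k A k) = 1%E.
  rewrite measure_bigcup//; under eq_eseriesl do rewrite in_setT.
  by rewrite -p1; apply: eq_eseriesr => k _; exact: PX.
have PC : P (~` (\bigcup_k A k)) = 0%E by rewrite probability_setC// PU subee.
have mphiX : measurable_fun setT (phi \o X) by exact: measurableT_comp.
rewrite (ge0_negligible_integral (measurableC mU) measurableT mphiX)//; last by move=> w _; exact: phi0.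
rewrite setTD setCK ge0_integral_bigcup//; last 2 first.
- exact: measurable_funTS.
- by move=> w _; exact: phi0.
apply: eq_eseriesr => k _.
transitivity (\int[P]_(w in A k) phi k%:R%:E)%E.
  by apply: eq_integral => w; rewrite inE => /= ->.
by rewrite integral_cst//; congr (_ * _)%E; exact: PX.
Qed.

End discrete_law.

(** * Moments of the increments of the noise *)

Section measurable_wrt_theory.
Context {d : measure_display} {T : measurableType d} {R : realType}.
Variable X : set (set T).
Implicit Types f g : T -> R.

Lemma measurable_wrt_sigmaP f : measurable_wrt setT <<s X >> f <->
  measurable_fun [set: g_sigma_algebraType X] f.
Proof. by split => [fX _ A mA|fX A mA]; [exact: fX|exact: (fX measurableT A mA)]. Qed.

Lemma measurable_wrt_cst (r : R) : measurable_wrt setT <<s X >> (fun=> r).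
Proof. exact/measurable_wrt_sigmaP. Qed.

Lemma measurable_wrtM f g : measurable_wrt setT <<s X >> f ->
  measurable_wrt setT <<s X >> g -> measurable_wrt setT <<s X >> (fun x => f x * g x).
Proof.
move=> /measurable_wrt_sigmaP mf /measurable_wrt_sigmaP mg.
by apply/measurable_wrt_sigmaP; exact: measurable_funM.
Qed.

Lemma measurable_wrtD f g : measurable_wrt setT <<s X >> f ->
  measurable_wrt setT <<s X >> g -> measurable_wrt setT <<s X >> (fun x => f x + g x).
Proof.
move=> /measurable_wrt_sigmaP mf /measurable_wrt_sigmaP mg.
by apply/measurable_wrt_sigmaP; exact: measurable_funD.
Qed.

Lemma measurable_wrtB f g : measurable_wrt setT <<s X >> f ->
  measurable_wrt setT <<s X >> g -> measurable_wrt setT <<s X >> (fun x => f x - g x).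
Proof.
move=> /measurable_wrt_sigmaP mf /measurable_wrt_sigmaP mg.
by apply/measurable_wrt_sigmaP; exact: measurable_funB.
Qed.

End measurable_wrt_theory.

Lemma Rintegral_prob_cst d (T : measurableType d) (R : realType)
  (P : probability T R) (r : R) : \int[P]_w r = r.
Proof. by rewrite /Rintegral integral_cst//= probability_setT mule1. Qed.

Lemma lebesgue_measure_oc (R : realType) (l h : R) :
  @lebesgue_measure R `]l, h]%classic = (Num.max 0 (h - l))%:E.
Proof.
rewrite lebesgue_measure_itv/= lte_fin; case: ltP => lh.
  by rewrite -EFinB max_r// subr_ge0 ltW.
by rewrite max_l// subr_le0.
Qed.

Section noise_moments.
Context {d : measure_display} {Om : measurableType d} {R : realType}.
Variable M : model Om R.
Hypothesis hM : noisy_setting M.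

Local Notation delta := (delay M).
Local Notation P := (prob M).
Local Notation B := (bm M).
Local Notation nu := (levy M).
Local Notation N := (prm M).
Local Notation leb := (@lebesgue_measure R).

Definition dB a b (w : Om) : R := B b w - B a w.

Lemma dB_split a x b w : dB a b w = dB a x w + dB x b w.
Proof. by rewrite /dB; lra. Qed.

Lemma dBii a w : dB a a w = 0. Proof. exact: subrr. Qed.

Lemma measurable_dB a b : - delta <= a -> a <= b -> measurable_fun setT (dB a b).
Proof.
move=> da ab; apply: measurable_funB; apply: (measurable_bm hM) => //.
exact: le_trans ab.
Qed.

Lemma filtration_cst t r : measurable_wrt setT (filtration M t) (fun=> r : R).
Proof. exact: measurable_wrt_cst. Qed.

Lemma filtration_dB a b : - delta <= a -> a <= b ->
  measurable_wrt setT (filtration M b) (dB a b).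
Proof.
move=> da ab; have db := le_trans da ab.
have gen s : - delta <= s -> s <= b ->
    measurable_wrt setT (filtration M b) (fun w => B s w - B (- delta) w).
  move=> ds sb A mA; rewrite setTI; apply: sub_sigma_algebra; left; left.
  by exists s, A; rewrite ds sb.
have := measurable_wrtB (gen b db (lexx b)) (gen a da ab).
rewrite (_ : (fun x => _) = dB a b)//; apply/funext => w; rewrite /dB; lra.
Qed.

Lemma measurable_wrt_filtration_mono s t (g : Om -> R) : s <= t ->
  measurable_wrt setT (filtration M s) g -> measurable_wrt setT (filtration M t) g.
Proof. by move=> st; apply: measurable_wrtI; exact: filtration_mono. Qed.

Lemma measurable_filtration t (g : Om -> R) :
  measurable_wrt setT (filtration M t) g -> measurable_fun setT g.
Proof. by move=> mg; exact: measurable_wrt_fun (filtration_measurable hM (a := t)) mg. Qed.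

Lemma dB_law a b (A : set R) : - delta <= a -> a < b -> measurable A ->
  P [set w | A (dB a b w)] = normal_prob 0 (Num.sqrt (b - a)) A.
Proof. by case: hM => _ [[_ _ _ + _] _ _ _] => H *; exact: H. Qed.

Let sqrt_gt0 a b : a < b -> 0 < Num.sqrt (b - a) :> R.
Proof. by move=> ab; rewrite sqrtr_gt0 subr_gt0. Qed.

Lemma integral_dB_sqr a b : - delta <= a -> a <= b ->
  (\int[P]_w (dB a b w ^+ 2)%:E = (b - a)%:E)%E.
Proof.
move=> da; rewrite le_eqVlt => /predU1P[<-|ab].
  by under eq_integral do rewrite dBii expr0n/=; rewrite integral0 subrr.
rewrite (@expectation_density _ _ _ P _ (normal_pdf 0 (Num.sqrt (b - a))) (fun x => x ^+ 2)) //.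
- by rewrite normal_second_moment ?sqrt_gt0// sqr_sqrtr// subr_ge0 ltW.
- by apply: measurable_dB => //; exact: ltW.
- exact: measurable_normal_pdf.
- exact: normal_pdf_ge0.
- by move=> A mA; rewrite dB_law.
- by move=> x; exact: sqr_ge0.
Qed.

Lemma sqint_dB a b : - delta <= a -> a <= b -> sqint P (dB a b).
Proof.
move=> da ab; apply: sqint_lty; first exact: measurable_dB.
by rewrite integral_dB_sqr// ltry.
Qed.

(** The law is symmetric: the positive and the negative parts have equal means. *)
Lemma expectation_dB a b : - delta <= a -> a <= b -> \int[P]_w dB a b w = 0.
Proof.
move=> da; rewrite le_eqVlt => /predU1P[<-|ab].
  by under eq_Rintegral do rewrite dBii; rewrite Rintegral_prob_cst.
have mdB := measurable_dB da (ltW ab).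
pose pos := fun x : R => Num.max 0 x.
have mpos : measurable_fun setT pos by apply: measurable_maxr.
have pos0 x : 0 <= pos x by rewrite le_max lexx.
have spos (Y : Om -> R) : sqint P Y -> summable_fun P (pos \o Y).
  move=> sY; have sY' := sqint_summable sY; apply: summable_le (summable_norm sY').
    by apply: measurableT_comp => //; exact: summable_measurable sY'.
  move=> x; rewrite /pos/=; have [h|h] := leP 0 (Y x); first exact: lexx.
  by rewrite normr0.
have sB := sqint_dB da (ltW ab).
have -> : \int[P]_w dB a b w = \int[P]_w (pos (dB a b w) - pos (- dB a b w)).
  apply: eq_Rintegral => w _; rewrite /pos.
  by case: (leP 0 (dB a b w)) => h; case: (leP 0 (- dB a b w)); lra.
rewrite RintegralB//; last 2 first.
- exact: (spos _ sB).
- exact: (spos _ (sqintN sB)).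
have E (Y : Om -> R) : measurable_fun setT Y ->
    (forall A : set R, measurable A ->
       P [set w | A (Y w)] = normal_prob 0 (Num.sqrt (b - a)) A) ->
    (\int[P]_w (pos (Y w))%:E =
     \int[leb]_x (pos x * normal_pdf 0 (Num.sqrt (b - a)) x)%:E)%E.
  move=> mY PY; apply: expectation_density => //.
  - exact: measurable_normal_pdf.
  - exact: normal_pdf_ge0.
rewrite /Rintegral (E (dB a b))//; last by move=> A mA; exact: dB_law.
rewrite (E (fun w => - dB a b w)) ?subrr//.
  exact: measurableT_comp.
move=> A mA; rewrite -(normal_prob_opp (sqrt_gt0 ab) mA).
have mNA : measurable (-%R @^-1` A).
  by rewrite -[X in measurable X]setTI; exact: oppr_measurable.
by rewrite -[RHS](dB_law da ab mNA).
Qed.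

(** The increment is centred and independent of g. *)
Lemma expectation_mul_dB a b (g : Om -> R) : - delta <= a -> a <= b ->
  measurable_wrt setT (enlarged M a) g -> sqint P g ->
  \int[P]_w (g w * dB a b w) = 0.
Proof.
move=> da ab mg sg; have sB := sqint_dB da ab.
rewrite (integral_mul_independent (enlarged_measurable hM (a := a)) mg).
- by rewrite expectation_dB// mulr0.
- by case: sB.
- by move=> E C GE mC; exact: (bm_indep hM).
- exact: sqint_summable.
- exact: sqint_summable.
- exact: sqint_mul.
Qed.

Lemma expectation_mul_dB_sqr a b (g : Om -> R) C : - delta <= a -> a <= b ->
  measurable_wrt setT (enlarged M a) g -> (forall w, `|g w| <= C) ->
  \int[P]_w (g w * dB a b w ^+ 2) = \int[P]_w g w * (b - a).
Proof.
move=> da ab mg gC; have sB := sqint_dB da ab.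
have mg' := measurable_wrt_fun (enlarged_measurable hM (a := a)) mg.
rewrite (integral_mul_independent (enlarged_measurable hM (a := a)) mg).
- by congr (_ * _); rewrite /Rintegral integral_dB_sqr.
- by apply: measurable_funX; case: sB.
- move=> E D GE mD; have mD' : measurable ((fun x => x ^+ 2) @^-1` D).
    by rewrite -[X in measurable X]setTI; exact: (measurable_funX 2 (measurable_id (D := setT))).
  exact: (bm_indep hM da ab mD' GE).
- exact: summable_bounded gC.
- by case: sB.
- by apply: summable_bounded_mul gC _ => //; case: sB.
Qed.

Lemma intensity_poisson (D : set (R * R)) : measurable D ->
  D `<=` `]0, +oo[ `*` setT -> (intensity M D < +oo)%E -> forall k : nat,
  P [set w | N w D = k%:R%:E] =
    (fine (intensity M D) ^+ k / k`!%:R * expR (- fine (intensity M D)))%:E.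
Proof. by case: hM => _ [_ _ [_ + _] _]; exact. Qed.

Section compensated_moments.
Variable D : set (R * R).
Hypotheses (mD : measurable D) (D0 : D `<=` `]0, +oo[ `*` setT)
  (iD : (intensity M D < +oo)%E).

Let la := fine (intensity M D).

Let la0 : 0 <= la. Proof. by apply: fine_ge0; exact: measure_ge0. Qed.

Let mN := measurable_prm hM mD D0.

Let E_fine n : (\int[P]_w (fine (N w D) ^+ n)%:E =
  \sum_(k <oo) (k%:R ^+ n * (la ^+ k / k`!%:R * expR (- la)))%:E)%E.
Proof.
have fN0 w : 0 <= fine (N w D) by rewrite fine_ge0.
pose phi (x : \bar R) : \bar R := (`|fine x| ^+ n)%:E.
transitivity (\int[P]_w phi (N w D))%E.
  by apply: eq_integral => w _; rewrite /phi ger0_norm.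
rewrite (expectation_discrete mN (intensity_poisson mD D0 iD))//.
- apply: eq_eseriesr => k _; rewrite /phi /= ger0_norm ?ler0n//.
- exact: poisson_sum0.
- apply/measurable_EFinP; apply: measurable_funX; apply: measurableT_comp => //.
- by move=> x; rewrite lee_fin exprn_ge0.
Qed.

Let mfN : measurable_fun setT (fun w => fine (N w D)).
Proof. exact: measurableT_comp. Qed.

Let sqint_N : sqint P (fun w => fine (N w D)).
Proof. by apply: sqint_lty => //; rewrite E_fine poisson_sum2// ltry. Qed.

Lemma sqint_compensated : sqint P (fun w => compensated M w D).
Proof.
apply: sqintB; first exact: sqint_N.
by apply: (@sqint_bounded _ _ _ _ _ `|fine (intensity M D)|) => // w; exact: measurable_cst.
Qed.

Lemma expectation_compensated : \int[P]_w compensated M w D = 0.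
Proof.
rewrite /compensated RintegralB//; last 2 first.
- exact: sqint_summable sqint_N.
- exact: summable_cst.
rewrite Rintegral_prob_cst; apply/eqP; rewrite subr_eq0; apply/eqP.
have := E_fine 1; rewrite poisson_sum1//; under eq_integral do rewrite expr1.
by rewrite /Rintegral => ->.
Qed.

End compensated_moments.

Lemma expectation_mul_compensated l h (D : set (R * R)) (g : Om -> R) :
  measurable D -> D `<=` `]0, h] `*` setT -> D `&` (`]0, l] `*` setT) = set0 ->
  (intensity M D < +oo)%E -> measurable_wrt setT (filtration M l) g -> sqint P g ->
  \int[P]_w (g w * compensated M w D) = 0.
Proof.
move=> mD Dh Dl iD mg sg.
have D0 := subset_trans Dh (@strip_sub _ h).
have sN := sqint_compensated mD D0 iD.
rewrite (integral_mul_independent (filtration_measurable hM (a := l)) mg).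
- by rewrite expectation_compensated// mulr0.
- by case: sN.
- by move=> E C GE mC; exact: (prm_indep hM (l := l) (h := h)).
- exact: sqint_summable.
- exact: sqint_summable.
- exact: sqint_mul.
Qed.

Lemma measurable_wrt_enlarged t (g : Om -> R) :
  measurable_wrt setT (filtration M t) g -> measurable_wrt setT (enlarged M t) g.
Proof. by apply: measurable_wrtI; exact: filtration_enlarged. Qed.

Lemma expectation_mul_dB_filtration a b (g : Om -> R) : - delta <= a -> a <= b ->
  measurable_wrt setT (filtration M a) g -> sqint P g ->
  \int[P]_w (g w * dB a b w) = 0.
Proof. by move=> *; apply: expectation_mul_dB => //; exact: measurable_wrt_enlarged. Qed.

Lemma sqint_bounded_dB a b (g : Om -> R) C : - delta <= a -> a <= b ->
  measurable_fun setT g -> (forall w, `|g w| <= C) -> sqint P (fun w => g w * dB a b w).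
Proof.
move=> da ab mg gC; apply: (sqint_bounded_mul mg gC); exact: sqint_dB.
Qed.

(** The Ito isometry. Splitting the increments at the ends of their common
    interval leaves the square of the common increment; in each other product one
    increment comes last, and it is centred given the remaining factors. *)
Lemma expectation_step_step a b l h (xi c : Om -> R) Cx Cc :
  - delta <= a -> a <= b -> a <= l -> l <= h ->
  measurable_wrt setT (filtration M l) xi -> (forall w, `|xi w| <= Cx) ->
  measurable_wrt setT (filtration M a) c -> (forall w, `|c w| <= Cc) ->
  \int[P]_w (xi w * dB l h w * (c w * dB a b w)) =
  \int[P]_w (xi w * c w) * Num.max 0 (Num.min h b - l).
Proof.
move=> da ab al lh mxi xiC mc cC.
have dl := le_trans da al; have dh := le_trans dl lh.
have mc' := measurable_wrt_filtration_mono al mc.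
have mxic : measurable_wrt setT (filtration M l) (fun w => xi w * c w).
  exact: measurable_wrtM.
have xicC w : `|xi w * c w| <= Cx * Cc by rewrite normrM ler_pM.
have mf := measurable_filtration mxi; have mcf := measurable_filtration mc.
have mxicf := measurable_filtration mxic.
have S x y : - delta <= x -> x <= y -> sqint P (fun w => xi w * c w * dB x y w).
  by move=> dx xy; exact: (sqint_bounded_dB _ _ mxicf xicC).
have past x : a <= x -> x <= l -> \int[P]_w (xi w * c w * dB a x w * dB l h w) = 0.
  move=> ax xl; apply: expectation_mul_dB_filtration => //; last exact: S.
  apply: measurable_wrtM => //; apply: measurable_wrt_filtration_mono xl _.
  exact: filtration_dB.
have [bl|lb] := leP b l.
  rewrite max_l; last by rewrite subr_le0 ge_min bl orbT.
  rewrite mulr0 -(past b ab bl); apply: eq_Rintegral => w _; ring.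
have lb' := ltW lb.
have ortho x y : l <= x -> x <= y ->
    \int[P]_w (xi w * c w * dB l x w * dB x y w) = 0.
  move=> lx xy; apply: expectation_mul_dB_filtration => //.
  - exact: le_trans lx.
  - apply: measurable_wrtM; last exact: filtration_dB.
    exact: measurable_wrt_filtration_mono mxic.
  - exact: S.
have sm x y x' y' : - delta <= x -> x <= y -> - delta <= x' -> x' <= y' ->
    summable_fun P (fun w => xi w * c w * dB x y w * dB x' y' w).
  by move=> *; apply: sqint_mul; [exact: S|exact: sqint_dB].
have sq x : l <= x -> \int[P]_w (xi w * c w * dB l x w * dB l x w) =
    \int[P]_w (xi w * c w) * (x - l).
  move=> lx; rewrite -(expectation_mul_dB_sqr dl lx (measurable_wrt_enlarged mxic) xicC).
  by apply: eq_Rintegral => w _; ring.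
have [hb|bh] := leP h b.
  rewrite max_r ?subr_ge0//.
  rewrite -(sq h lh) -[RHS]addr0 -[in X in _ + X](past l al (lexx l)).
  rewrite -[RHS]addr0 -[in X in _ + X](ortho h b lh hb).
  rewrite -RintegralD//; [|exact: sm|exact: sm].
  rewrite -RintegralD//; [|by apply: summableD; exact: sm|exact: sm].
  by apply: eq_Rintegral => w _; rewrite (dB_split a l b) (dB_split l h b); ring.
have bh' := ltW bh.
rewrite max_r ?subr_ge0//.
rewrite -(sq b lb') -[RHS]addr0 -[in X in _ + X](past l al (lexx l)).
rewrite -[RHS]addr0 -[in X in _ + X](ortho b h lb' bh').
rewrite -RintegralD//; [|exact: sm|exact: sm].
have db := le_trans dl lb'.
rewrite -RintegralD//; [|by apply: summableD; exact: sm|exact: sm].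
by apply: eq_Rintegral => w _; rewrite (dB_split a l b) (dB_split l b h); ring.
Qed.

Lemma intensity_strip l h (A : set R) : measurable A -> (nu A < +oo)%E ->
  (intensity M (`]l, h] `*` A) < +oo)%E.
Proof.
move=> mA nA; rewrite /intensity product_measure1E//.
rewrite lte_mul_pinfty//.
by rewrite [X in X \is a fin_num](lebesgue_measure_oc l h).
Qed.

(** The increment of B is split at l. Before l everything but the compensated
    jumps is known at l, and these are centred; after l, the jumps belong to the
    enlarged past of the increment of B. *)
Lemma expectation_jump_step a b l h (xi c : Om -> R) Cx Cc (A : set R) :
  0 <= a -> a <= b -> a <= l -> l <= h -> measurable A -> (nu A < +oo)%E ->
  measurable_wrt setT (filtration M l) xi -> (forall w, `|xi w| <= Cx) ->
  measurable_wrt setT (filtration M a) c -> (forall w, `|c w| <= Cc) ->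
  sqint P (fun w => xi w * compensated M w (`]l, h] `*` A)) /\
  \int[P]_w (xi w * compensated M w (`]l, h] `*` A) * (c w * dB a b w)) = 0.
Proof.
move=> a0 ab al lh mA nA mxi xiC mc cC.
have da : - delta <= a by rewrite (le_trans _ a0)// oppr_le0 ltW// (delay_gt0 hM).
have dl := le_trans da al.
have l0 := le_trans a0 al.
set D := `]l, h] `*` A.
have mD : measurable D by apply: measurableX.
have Dh : D `<=` `]0, h] `*` setT.
  move=> [t x] [] /=; rewrite !in_itv/= => /andP[lt ->] _; split => //.
  by rewrite (le_lt_trans l0 lt).
have Dl : D `&` (`]0, l] `*` setT) = set0.
  rewrite -subset0 => -[t x] [[]] /=; rewrite !in_itv/= => /andP[lt _] _ [/andP[_ tl] _].
  by move: lt; rewrite ltNge tl.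
have iD : (intensity M D < +oo)%E by exact: intensity_strip.
have D0 := subset_trans Dh (@strip_sub _ h).
have sN := sqint_compensated mD D0 iD.
have mc' := measurable_wrt_filtration_mono al mc.
have mxic : measurable_wrt setT (filtration M l) (fun w => xi w * c w).
  exact: measurable_wrtM.
have xicC w : `|xi w * c w| <= Cx * Cc by rewrite normrM ler_pM.
have mf := measurable_filtration mxi.
have mxicf := measurable_filtration mxic.
split; first exact: (sqint_bounded_mul mf xiC).
have S x y : - delta <= x -> x <= y -> sqint P (fun w => xi w * c w * dB x y w).
  by move=> dx xy; exact: (sqint_bounded_dB _ _ mxicf xicC).
have past x : a <= x -> x <= l ->
    \int[P]_w (xi w * c w * dB a x w * compensated M w D) = 0.
  move=> ax xl; apply: (expectation_mul_compensated mD Dh Dl iD); last exact: S.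
  apply: measurable_wrtM => //; apply: measurable_wrt_filtration_mono xl _.
  exact: filtration_dB.
have [bl|lb] := leP b l.
  by rewrite -(past b ab bl); apply: eq_Rintegral => w _; ring.
have SN : sqint P (fun w => xi w * c w * compensated M w D).
  exact: (sqint_bounded_mul mxicf xicC).
have mN : measurable_wrt setT (enlarged M l) (fun w => compensated M w D).
  move=> C mC; rewrite setTI; apply: sub_sigma_algebra; apply: noise_events_prm.
  by exists h => //; exists D, C.
have lb' := ltW lb.
rewrite -(past l al (lexx l)) -[RHS]addr0.
have futur : \int[P]_w (xi w * c w * compensated M w D * dB l b w) = 0.
  apply: expectation_mul_dB => //; apply: measurable_wrtM => //.
  exact: measurable_wrt_enlarged mxic.
rewrite -[in X in _ + X]futur -RintegralD//.
- by apply: eq_Rintegral => w _; rewrite (dB_split a l b); ring.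
- by apply: sqint_mul => //; exact: S.
- by apply: sqint_mul => //; exact: sqint_dB.
Qed.

End noise_moments.

(** * Pairings of stochastic integrals *)

Section cauchy_schwarz.
Context d (T : measurableType d) (R : realType) (mu : {measure set T -> \bar R}).
Implicit Types f g : T -> R.

(** The integral of (f - t g)^2 is a nonnegative quadratic polynomial in t. *)
Lemma cauchy_schwarz f g : sqint mu f -> sqint mu g ->
  (\int[mu]_x (f x * g x)) ^+ 2 <= \int[mu]_x (f x ^+ 2) * \int[mu]_x (g x ^+ 2).
Proof.
move=> sf sg; set a := \int[mu]_x (f x ^+ 2); set b := \int[mu]_x _; set c := \int[mu]_x _.
have c0 : 0 <= c by apply: Rintegral_ge0 => x _; exact: sqr_ge0.
have quad t : 0 <= a - 2 * t * b + t ^+ 2 * c.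
  have -> : a - 2 * t * b + t ^+ 2 * c = \int[mu]_x ((f x - t * g x) ^+ 2).
    rewrite /a /b /c -RintegralZl//; [|exact: sqint_mul].
    rewrite -RintegralZl//; [|by case: sg].
    rewrite -RintegralB//; [|by case: sf|by apply: summableZ; exact: sqint_mul].
    rewrite -RintegralD//; [|apply: summableB; [by case: sf|by apply: summableZ; exact: sqint_mul]|by apply: summableZ; case: sg].
    by apply: eq_Rintegral => x _; ring.
  by apply: Rintegral_ge0 => x _; exact: sqr_ge0.
move: c0; rewrite le_eqVlt => /predU1P[c0|c0]; last first.
  have := quad (b / c); have cn0 : c != 0 by rewrite gt_eqF.
  rewrite (_ : _ + _ = a - b ^+ 2 / c); last by field.
  by rewrite subr_ge0 ler_pdivrMr.
rewrite -c0 mulr0; have [->|b0] := eqVneq b 0; first by rewrite expr0n.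
have := quad ((a + 1) / (2 * b)); rewrite -c0 mulr0 addr0.
rewrite (_ : _ - _ = -1); last by field.
by rewrite ler0N1.
Qed.

Lemma sqint_dist f g : sqint mu g -> measurable_fun setT f ->
  (\int[mu]_x ((f x - g x) ^+ 2)%:E < +oo)%E -> sqint mu f.
Proof.
move=> sg mf fg; have : sqint mu (fun x => f x - g x).
  by apply: sqint_lty => //; apply: measurable_funB => //; case: sg.
by move=> /sqintD /(_ sg); under [X in sqint _ X -> _]eq_fun do rewrite subrK.
Qed.

(** Stochastic integrals are L^2 limits; their pairings are limits of pairings. *)
Lemma cvg_sqint_pairing (F : nat -> T -> R) f g : (forall k, sqint mu (F k)) ->
  measurable_fun setT f ->
  (fun k => \int[mu]_x ((f x - F k x) ^+ 2)%:E)%E @ \oo --> 0%E -> sqint mu g ->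
  sqint mu f /\ (fun k => \int[mu]_x (F k x * g x)) @ \oo --> \int[mu]_x (f x * g x).
Proof.
move=> sF mf /fine_cvgP[fin cvg0] sg.
have sf : sqint mu f.
  have [k _ /(_ k (leqnn k)) h] := fin; apply: (sqint_dist (sF k)) => //.
  by rewrite ltey_eq h.
split => //; apply/cvgrPdist_lt => e e0.
pose C := \int[mu]_x (g x ^+ 2).
have C0 : 0 <= C by apply: Rintegral_ge0 => x _; exact: sqr_ge0.
have e1 : 0 < e ^+ 2 / (C + 1) by rewrite divr_gt0// ?exprn_gt0// ltr_wpDl.
move/cvgrPdist_lt : cvg0 => /(_ _ e1); apply: filterS => k.
rewrite sub0r normrN => hk.
have sd : sqint mu (fun x => f x - F k x) by exact: sqintB.
have -> : \int[mu]_x (f x * g x) - \int[mu]_x (F k x * g x) =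
    \int[mu]_x ((f x - F k x) * g x).
  rewrite -RintegralB//; [|exact: sqint_mul|exact: sqint_mul].
  by apply: eq_Rintegral => x _; rewrite mulrBl.
rewrite -ltr_sqr ?nnegrE ?normr_ge0 ?ltW// real_normK ?num_real//.
apply: le_lt_trans (cauchy_schwarz sd sg) _.
have := le_lt_trans (ler_norm _) hk; rewrite -/(Rintegral mu setT _) => hk'.
apply: (@le_lt_trans _ _ (fine (\int[mu]_x ((f x - F k x) ^+ 2)%:E) * (C + 1))).
  rewrite ler_wpM2l//; first by apply: Rintegral_ge0 => x _; exact: sqr_ge0.
  by rewrite lerDl.
by rewrite -ltr_pdivlMr// ltr_wpDl.
Qed.

Lemma cvg_sqint_sum_pairing (n : nat -> nat) (F : nat -> nat -> T -> R) f g :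
  (forall k i, (i < n k)%N -> sqint mu (F k i)) -> measurable_fun setT f ->
  (fun k => \int[mu]_x ((f x - \sum_(i < n k) F k i x) ^+ 2)%:E)%E @ \oo --> 0%E ->
  sqint mu g -> sqint mu f /\
  (fun k => \sum_(i < n k) \int[mu]_x (F k i x * g x)) @ \oo --> \int[mu]_x (f x * g x).
Proof.
move=> sF mf cv sg.
have sS k : sqint mu (fun x => \sum_(i < n k) F k i x).
  exact: (@sqint_sum _ _ _ _ (n k) (F k) (sF k)).
have [sf c] := cvg_sqint_pairing sS mf cv sg; split => //.
rewrite [X in X @ _ --> _](_ : _ = (fun k => \int[mu]_x ((\sum_(i < n k) F k i x) * g x)))//.
apply/funext => k; under [RHS]eq_Rintegral do rewrite mulr_suml.
rewrite (@Rintegral_sum_ord _ _ _ _ (n k) (fun i x => F k i x * g x))// => i ik.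
by apply: sqint_mul => //; exact: sF.
Qed.

End cauchy_schwarz.

Section tensor.
Context d1 d2 (T1 : measurableType d1) (T2 : measurableType d2) (R : realType).
Variables (m1 : {sigma_finite_measure set T1 -> \bar R})
          (m2 : {sigma_finite_measure set T2 -> \bar R}).

Lemma summable_tensor (f : T1 -> R) (g : T2 -> R) : summable_fun m1 f ->
  summable_fun m2 g -> summable_fun (m1 \x m2)%E (fun v => f v.1 * g v.2).
Proof.
move=> sf sg; have mf := summable_measurable sf; have mg := summable_measurable sg.
have mfg : measurable_fun setT (fun v : T1 * T2 => f v.1 * g v.2).
  by apply: measurable_funM; exact: measurableT_comp.
apply/integrable12ltyP; first exact/measurable_EFinP.
pose G := \int[m2]_y `|g y|.
have GE : (\int[m2]_y (`|g y|)%:E = G%:E)%E by rewrite Rintegral_fineK//; exact: summable_norm.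
under eq_integral => x _.
  under eq_integral => y _ do rewrite /= normrM EFinM.
  rewrite ge0_integralZl_EFin//; last exact/measurable_EFinP/measurableT_comp.
  rewrite GE -EFinM mulrC; over.
have /integrableP[_] := summableZ G (summable_norm sf).
apply: le_lt_trans; rewrite le_eqVlt; apply/orP; left; apply/eqP.
have G0 : 0 <= G by apply: Rintegral_ge0 => y _.
by apply: eq_integral => x _; rewrite /= normrM (ger0_norm G0) normr_id.
Qed.

Lemma Rintegral_tensor (f : T1 -> R) (g : T2 -> R) : summable_fun m1 f ->
  summable_fun m2 g ->
  \int[(m1 \x m2)%E]_v (f v.1 * g v.2) = \int[m1]_x f x * \int[m2]_y g y.
Proof.
move=> sf sg; rewrite -(Rfubini1 (summable_tensor sf sg))/= -RintegralZr//.
by apply: eq_Rintegral => x _; rewrite RintegralZl.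
Qed.

Lemma sqint_tensor (f : T1 -> R) (g : T2 -> R) : sqint m1 f ->
  sqint m2 g -> sqint (m1 \x m2)%E (fun v => f v.1 * g v.2).
Proof.
move=> [mf sf] [mg sg]; split; first by apply: measurable_funM; exact: measurableT_comp.
have := summable_tensor sf sg.
by under [X in summable_fun _ X -> _]eq_fun do rewrite -exprMn.
Qed.

End tensor.

Section processes.
Context {d : measure_display} {Om : measurableType d} {R : realType}.
Variable P : probability Om R.
Local Notation leb := (@lebesgue_measure R).
Local Notation slab a c := (`[a, c] `*` [set: Om]).
Implicit Types (phi : R -> Om -> R) (f : R * Om -> R).

(** Extension by zero lets all integrals range over the whole line, where times
    can be translated and integrals exchanged without side conditions. *)
Definition cut (a c : R) phi (v : R * Om) : R := \1_(`[a, c]%classic) v.1 * phi v.1 v.2.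

Lemma measurable_slab (a c : R) : measurable (slab a c).
Proof. exact: measurableX. Qed.

Lemma cutE (a c : R) phi : cut a c phi = (fun v => phi v.1 v.2) \_ (slab a c).
Proof.
apply/funext => v; rewrite /cut patchE indicE.
rewrite [in RHS](_ : (v \in slab a c) = (v.1 \in `[a, c]%classic)).
  by case: ifP => _; rewrite ?mul1r ?mul0r.
by apply/idP/idP; rewrite !inE => // -[].
Qed.

Lemma measurable_cut a c phi : jointly_measurable a c phi ->
  measurable_fun setT (cut a c phi).
Proof.
by move=> mphi; rewrite cutE; apply/(measurable_restrictT _ (measurable_slab a c)).
Qed.

Lemma Rintegral_slab a c f :
  \int[(leb \x P)%E]_(v in slab a c) f v = \int[(leb \x P)%E]_v cut a c (fun t w => f (t, w)) v.
Proof.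
rewrite Rintegral_mkcond cutE; apply: eq_Rintegral => v _.
by rewrite !patchE; case: ifP => //; case: v.
Qed.

Lemma sqint_cut M a c phi : prob M = P -> square_integrable M a c phi ->
  sqint (leb \x P)%E (cut a c phi).
Proof.
move=> <- [mphi sphi]; apply: sqint_lty; first exact: measurable_cut.
apply: le_lt_trans sphi; rewrite le_eqVlt; apply/orP; left; apply/eqP.
rewrite [RHS]integral_mkcond; apply: eq_integral => v _.
by rewrite cutE !patchE; case: ifP => //; rewrite expr0n.
Qed.

Lemma summable_indic_oc (l h : R) : summable_fun leb (\1_(`]l, h]%classic) : R -> R).
Proof. exact: integrable_indic_itv. Qed.

Lemma sqint_indic_itv (a b : R) (x y : bool) :
  sqint leb (\1_[set` Interval (BSide x a) (BSide y b)] : R -> R).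
Proof.
split; first by apply: measurable_indic; exact: measurable_itv.
have s1 : summable_fun leb (\1_[set` Interval (BSide x a) (BSide y b)] : R -> R).
  exact: integrable_indic_itv.
apply: eq_integrable s1 => // t _ /=.
by rewrite indicE; case: (_ \in _); rewrite ?expr1n ?expr0n.
Qed.

(** Cauchy-Schwarz with the indicator of the slab, which has finite measure. *)
Lemma sqint_summable_slab (T : R) f : (forall t w, ~ `[0, T]%classic t -> f (t, w) = 0) ->
  sqint (leb \x P)%E f -> summable_fun (leb \x P)%E f.
Proof.
move=> f0 sf.
have q1 : sqint (leb \x P)%E (fun v => \1_(`[0, T]%classic) v.1 * 1).
  apply: (@sqint_tensor _ _ _ _ _ leb P (\1_(`[0, T]%classic)) (fun=> 1)).
    exact: sqint_indic_itv.
  by apply: (@sqint_bounded _ _ _ _ _ 1) => // w; rewrite normr1.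
have := sqint_mul q1 sf; congr (summable_fun _ _); apply/funext => -[t w]; rewrite mulr1/=.
have [tT|nT] := boolP (t \in `[0, T]%classic); first by rewrite indicE tT mul1r.
by rewrite f0 ?mulr0// => tT; rewrite mem_set in nT.
Qed.

Lemma Rintegral_indic_oc (l h : R) : \int[leb]_x \1_(`]l, h]%classic) x = Num.max 0 (h - l) :> R.
Proof.
rewrite /Rintegral integral_indic//= setIT; have := lebesgue_measure_oc l h.
by move=> /(congr1 fine).
Qed.

End processes.

Section pairings.
Context {d : measure_display} {Om : measurableType d} {R : realType}.
Variable M : model Om R.
Hypothesis hM : noisy_setting M.

Local Notation delta := (delay M).
Local Notation P := (prob M).
Local Notation B := (bm M).
Local Notation leb := (@lebesgue_measure R).
Local Notation slab a c := (`[a, c] `*` [set: Om]).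

Definition step_proc (c : Om -> R) (a b : R) (v : R * Om) : R :=
  \1_(`]a, b]%classic) v.1 * c v.2.

Lemma delta_le a : 0 <= a -> - delta <= a.
Proof. by apply: le_trans; rewrite oppr_le0 ltW// (delay_gt0 hM). Qed.

Lemma sqint_step_proc (c : Om -> R) a b (C : R) : measurable_fun setT c -> (forall w, `|c w| <= C) ->
  sqint (leb \x P)%E (step_proc c a b).
Proof.
move=> mc cC; apply: sqint_tensor; first exact: sqint_indic_itv.
exact: sqint_bounded cC.
Qed.

Lemma step_fun_out a T' h t w : adapted_step M a T' h -> ~ `[a, T']%classic t ->
  step_fun h t w = 0.
Proof.
move=> [[al lh hT] _] nt; rewrite /step_fun indicE memNset ?mulr0//.
apply: contra_not nt => /=; rewrite !in_itv/= => /andP[lt th].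
by rewrite (le_trans al (ltW lt)) (le_trans th).
Qed.

Lemma step_pairing a b T' (c : Om -> R) Cc (h : @step d Om R) :
  0 <= a -> a <= b -> measurable_wrt setT (filtration M a) c ->
  (forall w, `|c w| <= Cc) -> adapted_step M a T' h ->
  sqint P (fun w => coef h w * (B (hi h) w - B (lo h) w)) /\
  \int[P]_w (coef h w * (B (hi h) w - B (lo h) w) * (c w * dB M a b w)) =
  \int[(leb \x P)%E]_v (step_fun h v.1 v.2 * step_proc c a b v).
Proof.
move=> a0 ab mc cC [[al lh hT] [mh [Ch hC]]].
have da := delta_le a0; have dl := le_trans da al.
have mhf := measurable_filtration hM mh; have mcf := measurable_filtration hM mc.
split; first exact: (sqint_bounded_dB hM dl lh mhf hC).
rewrite (expectation_step_step hM da ab al lh mh hC mc cC).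
have sx : summable_fun P (fun w => coef h w * c w).
  apply: (@summable_bounded _ _ _ _ _ (Ch * Cc)); first exact: measurable_funM.
  by move=> w; rewrite normrM ler_pM.
rewrite -Rintegral_indic_oc mulrC.
rewrite -(Rintegral_tensor (summable_indic_oc _ _) sx).
apply: eq_Rintegral => v _; rewrite /step_fun /step_proc.
rewrite (_ : \1_(`]lo h, Num.min (hi h) b]%classic) v.1 =
   \1_(`]lo h, hi h]%classic) v.1 * \1_(`]a, b]%classic) v.1); first by ring.
rewrite !indicE -natrM mulnb; congr ((_ : bool)%:R); apply/idP/andP.
  rewrite !inE/= !in_itv/= le_min => /and3P[lv vh vb].
  by rewrite lv vh vb (le_lt_trans al).
by rewrite !inE/= !in_itv/= le_min => -[/andP[-> ->] /andP[_ ->]].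
Qed.

(** Both sides are L^2 continuous and agree for elementary integrals. *)
Lemma ito_pairing a b T' (c : Om -> R) Cc q (I : Om -> R) :
  0 <= a -> a <= b -> measurable_wrt setT (filtration M a) c ->
  (forall w, `|c w| <= Cc) -> ito_integral M a T' q I ->
  [/\ sqint P I, sqint (leb \x P)%E (cut a T' q) &
  \int[P]_w (I w * (c w * dB M a b w)) =
  \int[(leb \x P)%E]_v (cut a T' q v * step_proc c a b v)].
Proof.
move=> a0 ab mc cC [mq mI [n [S [aS cvq cvI]]]].
have mcf := measurable_filtration hM mc.
have pair k i : (i < n k)%N -> _ := fun ik => step_pairing a0 ab mc cC (aS k i ik).
have sY : sqint P (fun w => c w * dB M a b w).
  exact: (sqint_bounded_dB hM (delta_le a0) ab mcf cC).
have sG := sqint_step_proc a b mcf cC.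
have sS k i : (i < n k)%N -> sqint (leb \x P)%E (fun v => step_fun (S k i) v.1 v.2).
  move=> ik; have [_ [mh [Ch hC]]] := aS k i ik.
  have := sqint_step_proc (lo (S k i)) (hi (S k i)) (measurable_filtration hM mh) hC.
  by congr (sqint _ _); apply/funext => v; rewrite /step_proc /step_fun mulrC.
have mcq := measurable_cut mq.
have cvq' : (fun k => \int[leb \x P]_v
     ((cut a T' q v - \sum_(i < n k) step_fun (S k i) v.1 v.2) ^+ 2)%:E)%E @ \oo --> 0%E.
  rewrite [X in X @ _ --> _](_ : _ = (fun k => \int[leb \x P]_(v in slab a T')
    ((q v.1 v.2 - \sum_(i < n k) step_fun (S k i) v.1 v.2) ^+ 2)%:E)%E)//.
  apply/funext => k; apply/esym.
  rewrite integral_mkcond; apply: eq_integral => v _; rewrite patchE cutE patchE.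
  case: ifPn => // vn; rewrite big1 ?subr0 ?expr0n// => i _.
  apply: step_fun_out (aS k i (ltn_ord i)) _ => va.
  by move: vn; rewrite notin_setE; apply; split.
have [sq cq] := @cvg_sqint_sum_pairing _ _ _ (leb \x P)%E n
  (fun k i v => step_fun (S k i) v.1 v.2) _ _ sS mcq cvq' sG.
have [sI cI] := @cvg_sqint_sum_pairing _ _ _ P n
  (fun k i w => coef (S k i) w * (B (hi (S k i)) w - B (lo (S k i)) w)) _ _
  (fun k i ik => (pair k i ik).1) mI cvI sY.
split => //; move: cI; under eq_fun => k do under eq_bigr => i _ do
  rewrite (pair k i (ltn_ord i)).2.
by move=> cI; exact: (cvg_unique (@Rhausdorff R) cI cq).
Qed.

(** Elementary jump integrals are orthogonal to the increments of B, hence so are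
    their L^2 limits. *)
Lemma jump_pairing a b T' (c : Om -> R) Cc r (J : Om -> R) :
  0 <= a -> a <= b -> measurable_wrt setT (filtration M a) c ->
  (forall w, `|c w| <= Cc) -> jump_integral M a T' r J ->
  sqint P J /\ \int[P]_w (J w * (c w * dB M a b w)) = 0.
Proof.
move=> a0 ab mc cC [_ mJ [n [S [A [aS _ cvJ]]]]].
have mcf := measurable_filtration hM mc.
have pair k i : (i < n k)%N ->
  sqint P (fun w => coef (S k i) w *
             compensated M w (`]lo (S k i), hi (S k i)] `*` A k i)) /\
  \int[P]_w (coef (S k i) w *
             compensated M w (`]lo (S k i), hi (S k i)] `*` A k i) * (c w * dB M a b w)) = 0.
  move=> ik; have [[[al lh _] [mh [Ch hC]]] mA nA] := aS k i ik.
  exact: (expectation_jump_step hM a0 ab al lh mA nA mh hC mc cC).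
have sY : sqint P (fun w => c w * dB M a b w).
  exact: (sqint_bounded_dB hM (delta_le a0) ab mcf cC).
have [sJ cJ] := @cvg_sqint_sum_pairing _ _ _ P n
  (fun k i w => coef (S k i) w * compensated M w (`]lo (S k i), hi (S k i)] `*` A k i)) _ _
  (fun k i ik => (pair k i ik).1) mJ cvJ sY.
split => //; move: cJ; under eq_fun => k do under eq_bigr => i _ do
  rewrite (pair k i (ltn_ord i)).2.
under eq_fun do rewrite big1_eq.
by move=> cJ; exact: (cvg_unique (@Rhausdorff R) cJ (cvg_cst _)).
Qed.

End pairings.

(** * Integrals on products *)

Section product_measure_sigma_finite.
Context d1 d2 (T1 : measurableType d1) (T2 : measurableType d2) (R : realType).
Variables (m1 : {sigma_finite_measure set T1 -> \bar R})
          (m2 : {sigma_finite_measure set T2 -> \bar R}).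

(** A name for the product on which its sigma-finiteness can be recorded; triple
    products require it. *)
Definition prod_measure : set (T1 * T2) -> \bar R := (m1 \x m2)%E.

HB.instance Definition _ := Measure.on prod_measure.

Let prod_measure_sigma_finite : sigma_finite setT prod_measure.
Proof.
have /sigma_finiteP[F [FT ndF Foo]] := sigma_finiteT m1.
have /sigma_finiteP[G [GT ndG Goo]] := sigma_finiteT m2.
exists (fun n => F n `*` G n).
  apply/esym/seteqP; split => // -[x y] _.
  have [i _ Fx] : (\bigcup_n F n) x by rewrite -FT.
  have [j _ Gy] : (\bigcup_n G n) y by rewrite -GT.
  exists (i + j)%N => //; split.
    by have /subsetPset := ndF _ _ (leq_addr j i); exact.
  by have /subsetPset := ndG _ _ (leq_addl i j); exact.
move=> n; have [mF Fn] := Foo n; have [mG Gn] := Goo n; split.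
  exact: measurableX.
by rewrite /prod_measure product_measure1E// lte_mul_pinfty// ge0_fin_numE.
Qed.

HB.instance Definition _ :=
  Measure_isSigmaFinite.Build _ _ _ prod_measure prod_measure_sigma_finite.

End product_measure_sigma_finite.

Section integration_tools.
Context d (T : measurableType d) (R : realType).

Lemma Rdominated_cvg (mu : {measure set T -> \bar R}) (F : nat -> T -> R) (f g : T -> R) :
  (forall n, measurable_fun setT (F n)) -> measurable_fun setT f ->
  {ae mu, forall x, (fun n => F n x) @ \oo --> f x} -> summable_fun mu g ->
  {ae mu, forall x, forall n, `|F n x| <= g x} ->
  (fun n => \int[mu]_x F n x) @ \oo --> \int[mu]_x f x.
Proof.
move=> mF mf cF sg Fg.
have [] := @dominated_convergence _ T R mu setT measurableT (fun n => EFin \o F n)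
  (EFin \o f) (EFin \o g).
- by move=> n; exact/measurable_EFinP.
- exact/measurable_EFinP.
- by apply: filterS cF => x cF _; exact: cvg_EFin_comp.
- exact: sg.
- by apply: filterS Fg => x Fg n _; rewrite lee_fin.
move=> sf _ cv; apply: fine_cvg; move: cv; congr (_ --> _).
by rewrite fineK//; exact: integrable_fin_num.
Qed.

End integration_tools.

Section product_tools.
Context d1 d2 (T1 : measurableType d1) (T2 : measurableType d2) (R : realType).
Variables (m1 : {sigma_finite_measure set T1 -> \bar R})
          (m2 : {sigma_finite_measure set T2 -> \bar R}).

Lemma measurable_Rintegral_prod (f : T1 * T2 -> R) : measurable_fun setT f ->
  measurable_fun setT (fun x => \int[m2]_y f (x, y)).
Proof.
move=> mf; apply: measurableT_comp => //.
have mE : measurable_fun setT (EFin \o f) by exact/measurable_EFinP.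
under eq_fun do rewrite integralE.
apply: emeasurable_funB.
  have := measurable_fun_fubini_tonelli_F (m2 := m2) _ (measurable_funepos mE) (fun x => funepos_ge0 _ x).
  by congr (measurable_fun _ _); apply/funext => x;
    apply: eq_integral => y _; rewrite !funeposE.
have := measurable_fun_fubini_tonelli_F (m2 := m2) _ (measurable_funeneg mE) (fun x => funeneg_ge0 _ x).
by congr (measurable_fun _ _); apply/funext => x;
    apply: eq_integral => y _; rewrite !funenegE.
Qed.

Lemma summable_prod_ge0 (f : T1 * T2 -> R) : measurable_fun setT f ->
  (\int[m1]_x \int[m2]_y (`|f (x, y)|)%:E < +oo)%E -> summable_fun (m1 \x m2)%E f.
Proof. by move=> mf foo; apply/integrable12ltyP => //; exact/measurable_EFinP. Qed.

End product_tools.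

Section triple_products.
Context d (Om : measurableType d) (R : realType) (P : probability Om R).
Local Notation leb := (@lebesgue_measure R).
Local Notation lebP := (prod_measure leb P).

Lemma measurable_triple13 (g : R * Om -> R) : measurable_fun setT g ->
  measurable_fun setT (fun v : R * (R * Om) => g (v.1, v.2.2)).
Proof.
move=> mg; apply: (measurableT_comp mg); apply/measurable_fun_pairP; split.
  exact: measurable_fst.
exact: (measurableT_comp measurable_snd measurable_snd).
Qed.

(** For a fixed first coordinate the function is a tensor product. *)
Lemma summable_triple (phi : R -> R) (g : R * Om -> R) : summable_fun leb phi ->
  summable_fun lebP g ->
  summable_fun (leb \x lebP)%E (fun v => phi v.2.1 * g (v.1, v.2.2)).
Proof.
move=> sp sg; have mp := summable_measurable sp; have mg := summable_measurable sg.
have mm : measurable_fun setT (fun v : R * (R * Om) => phi v.2.1 * g (v.1, v.2.2)).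
  apply: measurable_funM; last exact: measurable_triple13.
  apply: measurableT_comp => //.
  exact: (measurableT_comp measurable_fst measurable_snd).
apply: summable_prod_ge0 => //.
have sN := summable_Rintegral1 (summable_norm sg).
have /integrableP[_] := summableZ (\int[leb]_t `|phi t|) sN.
apply: le_lt_trans; apply: ae_ge0_le_integral => //.
- by move=> x _; apply: integral_ge0.
- apply: (measurable_fun_fubini_tonelli_F (m2 := lebP) (fun v => (`|phi v.2.1 * g (v.1, v.2.2)|)%:E)) => //.
  by apply/measurable_EFinP; exact: measurableT_comp.
- apply: measurableT_comp => //; apply/measurable_EFinP.
  by apply: measurable_funM => //; exact: summable_measurable sN.
apply: filterS (ae_summable1 sg) => x sx _.
have st := summable_tensor (summable_norm sp) (summable_norm sx).
have := Rintegral_tensor (summable_norm sp) (summable_norm sx).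
move=> h0; have h := congr1 EFin h0; rewrite Rintegral_fineK// in h.
apply: (@le_trans _ _ (\int[leb \x P]_v (`|phi v.1| * `|g (x, v.2)|)%:E)%E).
  rewrite le_eqVlt; apply/orP; left; apply/eqP.
  by apply: eq_integral => v _; rewrite normrM.
by rewrite h /= lee_fin ler_norm.
Qed.

End triple_products.

Section clip.
Context {R : realType}.
Implicit Types (x : R) (n : nat).

(** Large values are replaced by 0 and not by the bound n, which makes
    x * clip n x the square of clip n x. *)
Definition clip n x : R := if `|x| <= n%:R then x else 0.

Lemma measurable_clip n : measurable_fun setT (clip n).
Proof. by apply: measurable_fun_ifT => //; apply: measurable_fun_ler. Qed.

Lemma clip_le n x : `|clip n x| <= n%:R.
Proof. by rewrite /clip; case: ifP => //; rewrite normr0. Qed.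

Lemma clip_le_id n x : `|clip n x| <= `|x|.
Proof. by rewrite /clip; case: ifP => //; rewrite normr0. Qed.

Lemma clip0 n : clip n 0 = 0. Proof. by rewrite /clip; case: ifP. Qed.

Lemma mul_clip n x : x * clip n x = clip n x ^+ 2.
Proof. by rewrite /clip; case: ifP; rewrite ?expr2 ?mulr0. Qed.

Lemma cvg_clip x : (fun n => clip n x) @ \oo --> x.
Proof.
apply: cvg_near_cst; exists (Num.trunc `|x|).+1 => // n /= nn.
by rewrite /clip ifT// (le_trans (ltW (truncnS_gt _)))// ler_nat.
Qed.

Lemma measurable_wrt_clip S (G : set (set S)) (f : S -> R) n :
  measurable_wrt setT G f -> measurable_wrt setT G (fun w => clip n (f w)).
Proof.
move=> mf A mA; have mA' : measurable (clip n @^-1` A).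
  by rewrite -[X in measurable X]setTI; exact: measurable_clip.
by have := mf _ mA'; rewrite -comp_preimage.
Qed.

End clip.

Section triangle.
Context {R : realType}.
Local Notation leb := (@lebesgue_measure R).

(** By symmetry the triangle above the diagonal carries half of the square. *)
Lemma Rintegral_triangle (g : R -> R) : summable_fun leb g ->
  \int[leb]_t (g t * \int[leb]_u (\1_(`]t, +oo[%classic) u * g u)) =
  (\int[leb]_t g t) ^+ 2 / 2.
Proof.
move=> sg; have mg := summable_measurable sg.
pose U : set (R * R) := [set v | v.1 < v.2].
have mU : measurable U.
  have -> : U = (fun v => v.2 - v.1) @^-1` `]0, +oo[.
    by apply/seteqP; split => v; rewrite /U/= in_itv/= andbT subr_gt0.
  rewrite -[X in measurable X]setTI.
  by apply: (measurable_funB measurable_snd measurable_fst) => //; exact: measurableT.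
have UE t u : \1_U (t, u) = \1_(`]t, +oo[%classic) u :> R.
  by rewrite !indicE; congr ((_ : bool)%:R); apply/idP/idP; rewrite !inE /U/= in_itv/= andbT.
have sgg := summable_tensor sg sg.
have sU : summable_fun (leb \x leb)%E (fun v => \1_U v * (g v.1 * g v.2)).
  apply: (@summable_bounded_mul _ _ _ _ _ _ 1) => // v; exact: normr_indic_le1.
set A := \int[leb]_t _.
have AE : A = \int[leb]_t \int[leb]_u (\1_U (t, u) * (g t * g u)).
  apply: eq_Rintegral => t _.
  rewrite -RintegralZl//; last first.
    by apply: (@summable_bounded_mul _ _ _ _ _ _ 1) => // v; exact: normr_indic_le1.
  by apply: eq_Rintegral => u _; rewrite UE; ring.
have AE' : A = \int[leb]_t \int[leb]_u (\1_U (u, t) * (g t * g u)).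
  rewrite AE (Rfubini sU); apply: eq_Rintegral => t _; apply: eq_Rintegral => u _ /=.
  by ring.
have : A + A = (\int[leb]_t g t) ^+ 2.
  rewrite {1}AE AE' -RintegralD//; last 2 first.
  - exact: (summable_Rintegral1 sU).
  - have := summable_Rintegral2 sU; congr (summable_fun _ _); apply/funext => t.
    by apply: eq_Rintegral => u _ /=; ring.
  transitivity (\int[leb]_t (g t * \int[leb]_u g u)); last by rewrite RintegralZr// expr2.
  apply: ae_eq_Rintegral.
  - apply: measurable_funD; first exact: (measurable_Rintegral1 sU).
    have := measurable_Rintegral2 sU; congr (measurable_fun _ _); apply/funext => t.
    by apply: eq_Rintegral => u _ /=; ring.
  - by apply: measurable_funM.
  have ae1 := ae_summable1 sU; have ae2 := ae_summable2 sU.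
  apply: filterS2 ae1 ae2 => t s1 s2.
  rewrite -RintegralD//; last first.
    by move: s2; congr (summable_fun _ _); apply/funext => u /=; ring.
  rewrite -RintegralZl//; apply: ae_eq_Rintegral.
  - apply: measurable_funD; first exact: summable_measurable s1.
    by move: (summable_measurable s2); congr (measurable_fun _ _); apply/funext => u /=; ring.
  - by apply: measurable_funM.
  exists [set t]; split; [exact: measurable_set1|exact: lebesgue_measure_set1|].
  move=> u /=; apply: contra_notP => /eqP ut.
  rewrite -mulrDl -[RHS]mul1r; congr (_ * _); rewrite !indicE.
  have [tu|tu|e] := ltgtP t u; last by rewrite e eqxx in ut.
  - by rewrite mem_set ?memNset ?addr0// /U/= ltNge (ltW tu).
  - by rewrite memNset ?mem_set ?add0r// /U/= ltNge (ltW tu).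
by move=> <-; field.
Qed.

End triangle.

(** * Grids and moving averages *)

Section grid.
Context {R : realType}.
Local Notation leb := (@lebesgue_measure R).

Lemma summable_shift (g : R -> R) c : summable_fun leb g ->
  summable_fun leb (fun x => g (x + c)).
Proof.
move=> sg; have mg := summable_measurable sg; apply: summable_lty.
  by apply: measurableT_comp => //; exact: measurable_shift.
rewrite (@ge0_integral_shift _ (fun x => (`|g x|)%:E) c)//.
  by case/integrableP: sg.
by apply/measurable_EFinP; exact: measurableT_comp.
Qed.

(** The translates of [0, eta[ by the multiples of eta tile [0, N eta[. *)
Lemma Rintegral_grid (g : R -> R) (eta : R) N : 0 <= eta -> summable_fun leb g ->
  \int[leb]_u (\1_(`[0, eta[%classic) u * \sum_(i < N) g (u + i%:R * eta)) =
  \int[leb]_v (\1_(`[0, N%:R * eta[%classic) v * g v).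
Proof.
move=> eta0 sg; have mg := summable_measurable sg.
have s1 (D : set R) (f : R -> R) : measurable D -> summable_fun leb f ->
    summable_fun leb (fun v => \1_D v * f v).
  move=> mD sf; apply: (@summable_bounded_mul _ _ _ _ _ _ 1) => // v; exact: normr_indic_le1.
elim: N => [|N IH].
  under eq_Rintegral do rewrite big_ord0 mulr0.
  under [RHS]eq_Rintegral do rewrite mul0r indicE set_itvco0 in_set0 mul0r.
  by [].
under eq_Rintegral do rewrite big_ord_recr/= mulrDr.
rewrite RintegralD//; last 2 first.
- apply: (s1 _ (fun u => \sum_(i < N) g (u + i%:R * eta))) => //.
  apply: (@summable_sum _ _ _ leb N (fun i u => g (u + i%:R * eta))) => i _.
  exact: summable_shift.
- by apply: (s1 _ (fun u => g (u + N%:R * eta))) => //; exact: summable_shift.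
rewrite IH.
have -> : \int[leb]_u (\1_(`[0, eta[%classic) u * g (u + N%:R * eta)) =
    \int[leb]_v (\1_(`[N%:R * eta, N.+1%:R * eta[%classic) v * g v).
  rewrite -[RHS](@Rintegral_shift _ _ (N%:R * eta)); last first.
    by apply: measurable_funM.
  apply: eq_Rintegral => u _; congr (_ * _); rewrite !indicE; congr ((_ : bool)%:R).
  apply/idP/idP; rewrite !inE/= !in_itv/= -natr1 mulrDl mul1r lerDr addrC ltrD2l//.
rewrite -RintegralD//; [|exact: (s1 _ g)|exact: (s1 _ g)].
apply: eq_Rintegral => v _; rewrite -mulrDl; congr (_ * _).
have h : N%:R * eta <= N.+1%:R * eta by rewrite ler_wpM2r// ler_nat.
have h0 : 0 <= N%:R * eta by rewrite mulr_ge0.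
rewrite !indicE -natrD; congr (_%:R).
have [vN|Nv] := ltP v (N%:R * eta).
  rewrite [X in (_ + X)%N](_ : _ = 0%N) ?addn0; last first.
    by rewrite memNset//= in_itv/= leNgt vN.
  by congr (nat_of_bool _); apply/idP/idP; rewrite !inE/= !in_itv/= => /andP[->] //= _;
     rewrite ?vN// (lt_le_trans vN).
rewrite [X in (X + _)%N](_ : _ = 0%N) ?add0n; last first.
  by rewrite memNset//= in_itv/= ltNge Nv andbF.
by congr (nat_of_bool _); apply/idP/idP; rewrite !inE/= !in_itv/= Nv (le_trans h0 Nv).
Qed.

Lemma ray_integral_derive (f : R -> R) : summable_fun leb f ->
  {ae leb, forall x, derivable (fun x : R => \int[leb]_(t in `]-oo, x]) f t) x 1 /\
    (fun x : R => \int[leb]_(t in `]-oo, x]) f t)^`()%classic x = f x}.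
Proof.
move=> sf; have mf := summable_measurable sf.
have iS (D : set R) : measurable D -> leb.-integrable D (EFin \o f).
  by move=> mD; apply: integrableS sf.
have locf : locally_integrable setT f.
  split => //; first exact: openT.
  move=> K _ cK; have mK : measurable K by exact: compact_measurable.
  by have /integrableP[_] := iS K mK.
exact: (FTC1Ny (fun y => iS _ (measurable_itv `]-oo, y])) locf).
Qed.

Lemma window_integral_le (f : R -> R) C a b : measurable_fun setT f ->
  (forall x, `|f x| <= C) -> a <= b ->
  summable_fun leb (fun v => \1_(`[a, b[%classic) v * f v) /\
  `|\int[leb]_v (\1_(`[a, b[%classic) v * f v)| <= C * (b - a).
Proof.
move=> mf fC ab; set D := (`[a, b[%classic : set R).
have sD : summable_fun leb (fun v => C * \1_D v) by apply: summableZ; exact: integrable_indic_itv.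
have le v : `|\1_D v * f v| <= C * \1_D v by rewrite normrM mulrC ler_pM// ger0_norm.
have s : summable_fun leb (fun v => \1_D v * f v).
  apply: (@summable_le _ _ _ leb _ (fun v => C * \1_D v)) => //.
  apply: measurable_funM => //.
  by apply: measurable_indic; exact: measurable_itv.
split => //; apply: le_trans (le_normr_Rintegral _ s) _ => //.
apply: (@le_trans _ _ (\int[leb]_v (C * \1_D v))).
  by apply: le_Rintegral => //; exact: summable_norm s.
rewrite RintegralZl//; last exact: integrable_indic_itv.
rewrite /Rintegral integral_indic//; last exact: measurable_itv.
rewrite /= setIT lebesgue_measure_itv/= lte_fin.
have [//|ba] := ltP a b; have -> : a = b by apply/eqP; rewrite eq_le ab ba.
by rewrite subrr.
Qed.

(** Lebesgue differentiation: the averages are difference quotients, at t and with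
    increment -1/(j+1), of the integral over ]-oo, t]. *)
Lemma window_average_cvg (f : R -> R) : summable_fun leb f ->
  {ae leb, forall t, (fun j => j.+1%:R *
     \int[leb]_v (\1_(`[t - j.+1%:R^-1, t[%classic) v * f v)) @ \oo --> f t}.
Proof.
move=> sf; have iS (D : set R) : measurable D -> leb.-integrable D (EFin \o f).
  by move=> mD; apply: integrableS sf.
set F := (fun x : R => \int[leb]_(t in `]-oo, x]) f t).
apply: filterS; last exact: (ray_integral_derive sf).
  exact: (ae_filter_ringOfSetsType leb).
move=> t [/= dF F't].
have -> : (fun j : nat => j.+1%:R * \int[leb]_v (\1_(`[t - j.+1%:R^-1, t[%classic) v * f v)) =
   (fun h => h^-1 *: ((F \o shift t) (h *: 1) - F t)) \o (fun j : nat => - j.+1%:R^-1).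
  apply/funext => j /=; rewrite Rintegral_mulr_indic.
  have j0 : 0 < j.+1%:R^-1 :> R by rewrite invr_gt0.
  rewrite invrN invrK /GRing.scale/= mulNr -mulrN opprB mulr1; congr (_ * _).
  rewrite Rintegral_itv_bndo_bndc; last exact: iS.
  rewrite -Rintegral_itv_obnd_cbnd; last exact: iS.
  rewrite /F [- _ + t]addrC (@Rintegral_itvB _ f -oo%O (BRight t) (t - j.+1%:R^-1))//.
  - exact: iS.
  - by rewrite bnd_simp gerBl ltW.
have cv : (fun h => h^-1 *: ((F \o shift t) (h *: 1) - F t)) @ 0^' --> f t.
  by rewrite -F't derive1E; exact: dF.
apply: (cvg_comp _ _ _ cv) => A; rewrite /dnbhs /within /=.
have c0 : (fun j : nat => - j.+1%:R^-1) @ \oo --> (0 : R).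
  by rewrite -oppr0; apply: cvgN; exact: cvg_harmonic.
move=> /c0 [N _ HN]; exists N => // j Nj; apply: (HN j Nj).
by rewrite oppr_eq0 invr_eq0 pnatr_eq0.
Qed.

End grid.

Section iterated_convergence.
Context d1 d2 (T1 : measurableType d1) (T2 : measurableType d2) (R : realType).
Variables (m1 : {sigma_finite_measure set T1 -> \bar R})
  (m2 : {sigma_finite_measure set T2 -> \bar R}).

(** Dominated convergence in one variable after the other, as convergence is known
    almost everywhere on sections. *)
Lemma Rdominated_cvg_iter (F : nat -> T1 * T2 -> R) (f g : T1 * T2 -> R) :
  (forall n, measurable_fun setT (F n)) -> measurable_fun setT f ->
  {ae m2, forall y, {ae m1, forall x, (fun n => F n (x, y)) @ \oo --> f (x, y)}} ->
  summable_fun (m1 \x m2)%E g ->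
  (forall n v, `|F n v| <= g v) -> (forall v, `|f v| <= g v) ->
  (fun n => \int[(m1 \x m2)%E]_v F n v) @ \oo --> \int[(m1 \x m2)%E]_v f v.
Proof.
move=> mF mf cF sg Fg fg.
have sF n : summable_fun (m1 \x m2)%E (F n) by exact: summable_le (mF n) (Fg n) sg.
have sf : summable_fun (m1 \x m2)%E f by exact: summable_le mf fg sg.
rewrite -(Rfubini2 sf).
rewrite [X in X @ _ --> _](_ : _ = fun n => \int[m2]_y \int[m1]_x F n (x, y)); last first.
  by apply/funext => n; rewrite -(Rfubini2 (sF n)).
apply: (@Rdominated_cvg _ _ _ m2 (fun n y => \int[m1]_x F n (x, y))
  (fun y => \int[m1]_x f (x, y)) (fun y => \int[m1]_x g (x, y))).
- move=> n; exact: measurable_Rintegral2 (sF n).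
- exact: measurable_Rintegral2 sf.
- apply: filterS2 cF (ae_summable2 sg) => y c s.
  apply: (@Rdominated_cvg _ _ _ m1 (fun n x => F n (x, y)) (fun x => f (x, y)) (fun x => g (x, y))) => //.
  + by move=> n; exact: (measurableT_comp (mF n) (measurable_pair2 y)).
  + exact: (measurableT_comp mf (measurable_pair2 y)).
  + by apply: aeW => x n.
- exact: summable_Rintegral2 sg.
- apply: filterS (ae_summable2 sg) => y s n.
  have sy : summable_fun m1 (fun x => F n (x, y)).
    apply: summable_le s => //.
    exact: (measurableT_comp (mF n) (measurable_pair2 y)).
  apply: le_trans (le_normr_Rintegral _ sy) _ => //.
  by apply: le_Rintegral => //; exact: summable_norm sy.
Qed.

End iterated_convergence.

(** * A Bessel inequality for Malliavin derivatives *)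

Section representation.
Context {d : measure_display} {Om : measurableType d} {R : realType}.
Variable M : model Om R.
Hypothesis hM : noisy_setting M.

Local Notation T := (horizon M).
Local Notation delta := (delay M).
Local Notation P := (prob M).
Local Notation leb := (@lebesgue_measure R).
Local Notation lebP := (prod_measure leb P).

(** What is used of the duality formula that characterizes the Malliavin
    derivative: its instances at elementary integrands. *)
Definition represents (h : Om -> R) (k : R -> Om -> R) :=
  [/\ adapted (filtration M) 0 T k, sqint lebP (cut 0 T k) &
   forall a b (c : Om -> R) C, 0 <= a -> a <= b -> b <= T ->
     measurable_wrt setT (filtration M a) c -> (forall w, `|c w| <= C) ->
     \int[P]_w (h w * (c w * dB M a b w)) =
     \int[lebP]_v (cut 0 T k v * step_proc c a b v)].

Lemma malliavin_represents (h : Om -> R) (k : R -> Om -> R) :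
  is_cond_malliavin M h k -> represents h k.
Proof.
move=> [ak sk dual]; split => //; first exact: (@sqint_cut _ _ _ P M).
move=> a b c C a0 ab bT mc cC; have mcf := measurable_filtration hM mc.
pose phi t w := step_proc c a b (t, w).
have sphi := sqint_step_proc M a b mcf cC.
have sqphi : square_integrable M 0 T phi.
  split.
    apply: measurable_funTS; have [mphi _] := sphi.
    by move: mphi; congr (measurable_fun _ _); apply/funext => -[].
  have [_ /integrableP[_]] := sphi; apply: le_lt_trans.
  apply: (@le_trans _ _ (\int[leb \x P]_v ((step_proc c a b v) ^+ 2)%:E)%E); last first.
    rewrite le_eqVlt; apply/orP; left; apply/eqP; apply: eq_integral => v _ /=.
    by rewrite ger0_norm// sqr_ge0.
  rewrite (_ : (fun v => ((phi v.1 v.2) ^+ 2)%:E) = (fun v => ((step_proc c a b v) ^+ 2)%:E)); last first.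
    by apply/funext => -[].
  apply: ge0_subset_integral => //; first exact: measurable_slab.
    by apply/measurable_EFinP; apply: measurable_funX; have [] := sphi.
  by move=> v _; rewrite lee_fin sqr_ge0.
have itophi : ito_integral M 0 T phi (fun w => c w * dB M a b w).
  have [mphi _] := sqphi; split => //.
    by apply: measurable_funM => //; apply: (measurable_dB hM) => //; exact: (delta_le hM).
  exists (fun=> 1%N), (fun _ _ => Step a b c); split.
  - by move=> k' i _; split => //; split => //; exists C.
  - rewrite (_ : (fun _ => _) = cst 0%E); first exact: cvg_cst.
    apply/funext => k'; apply: integral0_eq => v _.
    by rewrite big_ord_recl big_ord0 addr0 /phi /step_proc /step_fun/= mulrC subrr expr0n.
  - rewrite (_ : (fun _ => _) = cst 0%E); first exact: cvg_cst.
    apply/funext => k'; apply: integral0_eq => v _.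
    by rewrite big_ord_recl big_ord0 addr0 /= subrr expr0n.
have adphi : adapted (filtration M) 0 T phi.
  move=> t /andP[t0 tT]; rewrite /phi /step_proc/= indicE.
  have [|_] := boolP (t \in _); last first.
    by under [X in measurable_wrt _ _ X]eq_fun do rewrite mul0r; exact: filtration_cst.
  rewrite inE/= in_itv/= => /andP[at_ _].
  under [X in measurable_wrt _ _ X]eq_fun do rewrite mul1r.
  exact: measurable_wrt_filtration_mono (ltW at_) mc.
rewrite (dual phi _ adphi sqphi itophi) Rintegral_slab.
by apply: eq_Rintegral => -[t w] _; rewrite /cut/= /phi mulrA.
Qed.

Lemma horizon_ge0 : 0 <= T. Proof. exact: ltW (horizon_gt0 hM). Qed.

(** The extended k vanishes after the horizon, so windows may reach beyond it. *)
Lemma represents_window (h : Om -> R) k a b (c : Om -> R) C : represents h k ->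
  0 <= a <= T -> a <= b -> measurable_wrt setT (filtration M a) c ->
  (forall w, `|c w| <= C) ->
  \int[P]_w (h w * (c w * dB M a (Num.min b T) w)) =
  \int[lebP]_v (cut 0 T k v * step_proc c a b v).
Proof.
move=> [_ _ dual] /andP[a0 aT] ab mc cC.
rewrite (dual a _ c C a0 _ _ mc cC) ?le_min ?ab ?ge_min ?lexx ?orbT//.
apply: eq_Rintegral => -[t w] _; rewrite /cut /step_proc/= [in LHS]indicE [in RHS]indicE.
have [tT|] := boolP (t \in `[0, T]%classic); last by rewrite !mul0r.
congr (_ * (_ * _)); rewrite !indicE; congr ((_ : bool)%:R).
move: tT; rewrite inE/= in_itv/= => /andP[_ tT].
by apply/idP/idP; rewrite !inE/= !in_itv/= le_min tT andbT.
Qed.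

Section bound.
Variables (h : Om -> R) (k : R -> Om -> R).
Hypotheses (sh : sqint P h) (hk : represents h k).
Variable n : nat.

Let mk : measurable_fun setT (cut 0 T k). Proof. by have [_ []] := hk. Qed.

Let sk : sqint lebP (cut 0 T k). Proof. by have [] := hk. Qed.

(** Its values at fixed times are bounded and known at these times, hence
    admissible coefficients of elementary integrands. *)
Let ka (v : R * Om) : R := clip n (cut 0 T k v).

Let mka : measurable_fun setT ka.
Proof. exact: (measurableT_comp (measurable_clip n) mk). Qed.

Let ka_le v : `|ka v| <= n%:R. Proof. exact: clip_le. Qed.

Let ka_out t w : ~ `[0, T]%classic t -> ka (t, w) = 0.
Proof.
by move=> nt; rewrite /ka /cut indicE memNset//= mul0r clip0.
Qed.

Let ka_adapted t : 0 <= t <= T -> measurable_wrt setT (filtration M t) (fun w => ka (t, w)).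
Proof.
move=> tT; have [ad _ _] := hk; have := measurable_wrt_clip n (ad t tT).
by under [X in _ -> measurable_wrt _ _ X]eq_fun do rewrite /ka /cut/= indicE mem_set/= ?in_itv//= mul1r.
Qed.

Let ska : sqint lebP ka.
Proof.
split => //; apply: (@summable_le _ _ _ lebP _ (fun v => (cut 0 T k v) ^+ 2)).
- exact: measurable_funX.
- move=> v; rewrite -(real_normK (num_real (cut 0 T k v))) normrX lerXn2r ?nnegrE//.
  exact: clip_le_id.
- by case: sk.
Qed.

Let window (eta v : R) (z : R * Om) : R :=
  cut 0 T k z * step_proc (fun w => ka (v, w)) v (v + eta) z.

Let G eta v := \int[lebP]_z window eta v z.

Let e v := \int[P]_w (ka (v, w) ^+ 2).

(** S is the Ito sum of ka over the grid. By duality E (h S) is the sum of the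
    pairings G, by orthogonality of the increments E S^2 is at most a Riemann sum
    of e, and E (h - S)^2 is nonnegative. *)
Let grid_ineq eta N u : 0 <= eta -> 0 <= u ->
  \sum_(i < N) G eta (u + i%:R * eta) <=
  2^-1 * \int[P]_w (h w ^+ 2) + 2^-1 * (eta * \sum_(i < N) e (u + i%:R * eta)).
Proof.
move=> eta0 u0.
pose t i := u + i%:R * eta.
have tS i : t i.+1 = t i + eta by rewrite /t -natr1 mulrDl mul1r addrA.
have t0 i : 0 <= t i by rewrite addr_ge0// mulr_ge0.
pose m i := Num.min (t i) T.
have m0 i : 0 <= m i by rewrite le_min t0 horizon_ge0.
have mm i : m i <= m i.+1.
  by rewrite /m tS le_min !ge_min lexx orbT andbT lerDl eta0.
have dm i : - delta <= m i by exact: (delta_le hM).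
pose xi i w := ka (t i, w).
have xi_le i w : `|xi i w| <= n%:R by exact: ka_le.
have mxi i : measurable_wrt setT (filtration M (m i)) (xi i).
  have [tT|Tt] := leP (t i) T.
    by rewrite /m min_l//; apply: ka_adapted; rewrite t0.
  rewrite (_ : xi i = fun=> 0); first exact: filtration_cst.
  by apply/funext => w; apply: ka_out => /=; rewrite in_itv/= t0/= leNgt Tt.
pose S j w := \sum_(i < j) xi i w * dB M (m i) (m i.+1) w.
have SS j w : S j.+1 w = S j w + xi j w * dB M (m j) (m j.+1) w.
  by rewrite /S big_ord_recr.
have sterm i : sqint P (fun w => xi i w * dB M (m i) (m i.+1) w).
  by apply: (sqint_bounded_dB hM _ _ _ (xi_le i)) => //; exact: measurable_filtration (mxi i).
have sS j : sqint P (S j).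
  by apply: (@sqint_sum _ _ _ _ j (fun i w => xi i w * dB M (m i) (m i.+1) w)) => i _.
have mS j : measurable_wrt setT (filtration M (m j)) (S j).
  elim: j => [|j IH].
    rewrite (_ : S 0%N = fun=> 0); first exact: filtration_cst.
    by apply/funext => w; rewrite /S big_ord0.
  rewrite (_ : S j.+1 = fun w => S j w + xi j w * dB M (m j) (m j.+1) w); last exact/funext.
  apply: measurable_wrtD; first exact: measurable_wrt_filtration_mono (mm j) IH.
  apply: measurable_wrtM; first exact: measurable_wrt_filtration_mono (mm j) (mxi j).
  exact: (filtration_dB (dm j) (mm j)).
have ES j : \int[P]_w (S j w ^+ 2) <= eta * \sum_(i < j) e (t i).
  elim: j => [|j IH].
    rewrite big_ord0 mulr0; under eq_Rintegral do rewrite /S big_ord0 expr0n/=.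
    by rewrite Rintegral_prob_cst.
  rewrite big_ord_recr/= mulrDr.
  have -> : \int[P]_w (S j.+1 w ^+ 2) = \int[P]_w (S j w ^+ 2) +
      (2 * \int[P]_w (S j w * xi j w * dB M (m j) (m j.+1) w) +
       \int[P]_w (xi j w ^+ 2 * dB M (m j) (m j.+1) w ^+ 2)).
    have sx : summable_fun P (fun w => S j w * xi j w * dB M (m j) (m j.+1) w).
      have := sqint_mul (sS j) (sterm j); congr (summable_fun _ _).
      by apply/funext => w; rewrite mulrA.
    have sy : summable_fun P (fun w => xi j w ^+ 2 * dB M (m j) (m j.+1) w ^+ 2).
      have [_] := sterm j; congr (summable_fun _ _).
      by apply/funext => w; rewrite exprMn.
    rewrite -RintegralZl// -RintegralD//; last exact: summableZ.
    rewrite -RintegralD//; [|by have [] := sS j|by apply: summableD => //; exact: summableZ].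
    by apply: eq_Rintegral => w _; rewrite SS; ring.
  rewrite (expectation_mul_dB_filtration hM (dm j) (mm j)); last 2 first.
  - exact: (measurable_wrtM (mS j) (mxi j)).
  - under [X in sqint _ X]eq_fun do rewrite mulrC.
    exact: (sqint_bounded_mul (measurable_filtration hM (mxi j)) (xi_le j)).
  rewrite mulr0 add0r (@expectation_mul_dB_sqr _ _ _ _ hM (m j) (m j.+1) (fun w => xi j w ^+ 2) (n%:R ^+ 2))//; last 2 first.
  - apply: measurable_wrt_enlarged.
    by under [X in measurable_wrt _ _ X]eq_fun do rewrite expr2; exact: (measurable_wrtM (mxi j) (mxi j)).
  - by move=> w; rewrite normrX lerXn2r ?nnegrE.
  rewrite lerD// mulrC ler_wpM2r//; first by apply: Rintegral_ge0 => w _; exact: sqr_ge0.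
  rewrite /m tS; have [a|a] := leP (t j) T; have [b|b] := leP (t j + eta) T; lra.
have EhS j : \int[P]_w (h w * S j w) = \sum_(i < j) G eta (t i).
  under eq_Rintegral do rewrite /S mulr_sumr.
  rewrite (@Rintegral_sum_ord _ _ _ P j (fun i w => h w * (xi i w * dB M (m i) (m i.+1) w))); last first.
    by move=> i _; exact: sqint_mul.
  apply: eq_bigr => i _; rewrite /G.
  have [tT|Tt] := leP (t i) T; last first.
    have nt : ~ `[0, T]%classic (t i) by rewrite /= in_itv/= t0/= leNgt Tt.
    rewrite !Rintegral_eq0// => [z|w]; last by rewrite /xi ka_out// mul0r mulr0.
    by rewrite /window /step_proc ka_out// !mulr0.
  have mi : m i = t i by rewrite /m min_l.
  rewrite mi /m tS.
  apply: (represents_window hk _ _ _ (xi_le i)) => //.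
  - by rewrite t0.
  - by rewrite lerDl.
  - by rewrite -{1}mi.
rewrite -EhS; apply: le_trans (_ : 2^-1 * \int[P]_w (h w ^+ 2) + 2^-1 * \int[P]_w (S N w ^+ 2) <= _).
  have : 0 <= \int[P]_w ((h w - S N w) ^+ 2) by apply: Rintegral_ge0 => w _; exact: sqr_ge0.
  have -> : \int[P]_w ((h w - S N w) ^+ 2) = \int[P]_w (h w ^+ 2) -
      2 * \int[P]_w (h w * S N w) + \int[P]_w (S N w ^+ 2).
    have shS := sqint_mul sh (sS N).
    rewrite -RintegralZl// -RintegralB//; [|by case: sh|exact: summableZ].
    rewrite -RintegralD//; [|apply: summableB; [by case: sh|exact: summableZ]|by case: (sS N)].
    by apply: eq_Rintegral => w _; ring.
  lra.
by rewrite lerD2l ler_wpM2l// invr_ge0.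
Qed.

Let c0 := cut 0 T k.

Let sc0 : summable_fun lebP c0.
Proof.
apply: (sqint_summable_slab (T := T)) sk => t w nt.
by rewrite /c0 /cut indicE memNset// mul0r.
Qed.

Let swindow eta : summable_fun (leb \x lebP)%E (fun v => window eta v.1 v.2).
Proof.
have mI : measurable_fun setT (fun v : R * (R * Om) => \1_(`]0, eta]%classic) (v.2.1 - v.1) : R).
  apply: (measurableT_comp (measurable_indic _)) => //.
  apply: measurable_funB => //.
  exact: (measurableT_comp measurable_fst measurable_snd).
have IE v t : \1_(`]v, v + eta]%classic) t = \1_(`]0, eta]%classic) (t - v) :> R.
  rewrite !indicE; congr ((_ : bool)%:R).
  by apply/idP/idP; rewrite !inE/= !in_itv/= subr_gt0 lerBlDl.
have sI : summable_fun leb (fun v => n%:R * \1_(`[0, T]%classic) v).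
  by apply: summableZ; exact: integrable_indic_itv.
have st := summable_tensor sI (summable_norm sc0).
apply: summable_le st.
  apply: measurable_funM.
    exact: (measurableT_comp mk measurable_snd).
  rewrite /step_proc; under [X in measurable_fun _ X]eq_fun do rewrite IE.
  apply: measurable_funM => //.
  exact: measurable_triple13.
move=> [v [t w]]; rewrite /window /step_proc/= -/c0 mulrC !normrM ler_wpM2r//.
have [vT|nvT] := boolP (v \in `[0, T]%classic).
  rewrite [\1_(`[0, T]%classic) v]indicE vT mulr1 -[leRHS]mul1r ler_pM//.
  exact: normr_indic_le1.
rewrite ka_out ?normr0 ?mulr0 ?mulr_ge0//.
by move=> vT; rewrite mem_set in nvT.
Qed.

Let G_out eta v : ~ `[0, T]%classic v -> G eta v = 0.
Proof.
move=> nv; apply: Rintegral_eq0 => z.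
by rewrite /window /step_proc ka_out// !mulr0.
Qed.

Let e_out v : ~ `[0, T]%classic v -> e v = 0.
Proof.
by move=> nv; apply: Rintegral_eq0 => w; rewrite ka_out// expr0n.
Qed.

(** Averaging over the origin of the grid makes the Riemann sums integrals. *)
Let window_ineq eta : 0 < eta ->
  \int[leb]_v G eta v <=
  eta * (2^-1 * \int[P]_w (h w ^+ 2) + 2^-1 * \int[lebP]_v (ka v ^+ 2)).
Proof.
move=> eta0; have eta0' := ltW eta0.
have [N NT] : exists N, T < N%:R * eta.
  exists (Num.trunc (T / eta)).+1; rewrite -ltr_pdivrMr//.
  by apply: truncnS_gt.
have sG : summable_fun leb (G eta) by exact: summable_Rintegral1 (swindow eta).
have [_ ska2] := ska.
have se : summable_fun leb e by exact: (summable_Rintegral1 ska2).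
have full (f : R -> R) : (forall v, ~ `[0, T]%classic v -> f v = 0) ->
    \int[leb]_v f v = \int[leb]_v (\1_(`[0, N%:R * eta[%classic) v * f v).
  move=> f0; apply: eq_Rintegral => v _.
  have [vT|nvT] := pselect (`[0, T]%classic v); last by rewrite f0 ?mulr0.
  rewrite indicE mem_set ?mul1r//=; move: vT => /=.
  by rewrite !in_itv/= => /andP[-> /le_lt_trans] /=; apply.
have sI (g : R -> R) : summable_fun leb g ->
    summable_fun leb (fun u => \1_(`[0, eta[%classic) u * \sum_(i < N) g (u + i%:R * eta)).
  move=> sg; apply: (@summable_bounded_mul _ _ _ _ _ _ 1) => //.
    by move=> v; exact: normr_indic_le1.
  by apply: (@summable_sum _ _ _ leb N (fun i u => g (u + i%:R * eta))) => i _; exact: summable_shift.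
rewrite (full (G eta) (G_out eta)) -Rintegral_grid//.
have -> : \int[lebP]_v (ka v ^+ 2) = \int[leb]_v e v by rewrite /e (Rfubini1 ska2).
rewrite (full e e_out) -Rintegral_grid//.
set h2 := \int[P]_w _.
have sE := summableZ eta (sI _ se).
have s1 : summable_fun leb (\1_(`[0, eta[%classic) : R -> R) by exact: integrable_indic_itv.
have I1 : \int[leb]_u \1_(`[0, eta[%classic) u = eta.
  rewrite /Rintegral integral_indic//= setIT lebesgue_measure_itv/= lte_fin eta0.
  by rewrite oppr0 adde0.
have -> : eta * (2^-1 * h2 + 2^-1 * \int[leb]_u (\1_(`[0, eta[%classic) u * \sum_(i < N) e (u + i%:R * eta))) =
  \int[leb]_u ((2^-1 * h2) * \1_(`[0, eta[%classic) u +
     2^-1 * (eta * (\1_(`[0, eta[%classic) u * \sum_(i < N) e (u + i%:R * eta)))).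
  rewrite RintegralD//; [|exact: summableZ|exact: summableZ].
  rewrite RintegralZl// RintegralZl// RintegralZl; [|by []|exact: sI].
  by rewrite I1; ring.
apply: le_Rintegral => //; [exact: sI|by apply: summableD; exact: summableZ|].
move=> u _; have [uI|nu] := boolP (u \in `[0, eta[%classic); rewrite !indicE; last first.
  by rewrite (negbTE nu) !(mul0r, mulr0) addr0.
rewrite uI !mul1r mulr1; apply: grid_ineq => //.
by move: uI; rewrite inE/= in_itv/= => /andP[].
Qed.

Let average j (z : R * Om) : R := c0 z * (j.+1%:R *
   \int[leb]_v (\1_(`[z.1 - j.+1%:R^-1, z.1[%classic) v * ka (v, z.2))).

Let averageE j z : average j z = j.+1%:R * \int[leb]_v window j.+1%:R^-1 v z.
Proof.
rewrite /average mulrCA; congr (_ * _).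
have mka2 : measurable_fun setT (fun v => ka (v, z.2)).
  exact: (measurableT_comp mka (measurable_pair2 z.2)).
have zj : z.1 - j.+1%:R^-1 <= z.1 by rewrite gerBl.
have [sI _] := window_integral_le mka2 (fun v => ka_le (v, z.2)) zj.
rewrite -RintegralZl//; apply: eq_Rintegral => v _.
rewrite /window /step_proc/= -/c0; congr (_ * (_ * _)).
rewrite !indicE; congr ((_ : bool)%:R).
by apply/idP/idP; rewrite !inE/= !in_itv/= lerBlDr => /andP[-> ->].
Qed.

Let average_le j z : `|average j z| <= n%:R * `|c0 z|.
Proof.
rewrite /average normrM mulrC ler_wpM2r//.
have j0 : 0 < j.+1%:R^-1 :> R by rewrite invr_gt0.
rewrite normrM gtr0_norm// -[leRHS]mul1r -[X in X * _ <= _]invrK -ler_pdivlMl ?invr_gt0// invrK mul1r.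
have mka2 : measurable_fun setT (fun v => ka (v, z.2)).
  exact: (measurableT_comp mka (measurable_pair2 z.2)).
have zj : z.1 - j.+1%:R^-1 <= z.1 by rewrite gerBl.
have [_ hw] := window_integral_le mka2 (fun v => ka_le (v, z.2)) zj.
by move: hw; rewrite subKr mulrC.
Qed.

(** For windows shrinking to points, the pairings tend to the integral I of ka^2:
    moving averages converge almost everywhere. So I <= E h^2 / 2 + I / 2. *)
Lemma represents_trunc_bound : \int[lebP]_v (ka v ^+ 2) <= \int[P]_w (h w ^+ 2).
Proof.
have mav j : measurable_fun setT (average j).
  rewrite (_ : average j = fun z => j.+1%:R * \int[leb]_v window j.+1%:R^-1 v z); last first.
    by apply/funext => z; rewrite averageE.
  by apply: measurable_funM => //; exact: measurable_Rintegral2 (swindow _).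
have cv : (fun j => \int[lebP]_z average j z) @ \oo --> \int[lebP]_z (ka z ^+ 2).
  apply: (@Rdominated_cvg_iter _ _ _ _ _ leb P average (fun z => ka z ^+ 2) (fun z => n%:R * `|c0 z|)).
  - by [].
  - exact: measurable_funX.
  - have ska1 : summable_fun lebP ka.
      apply: (@summable_le _ _ _ lebP ka (fun v => `|c0 v|) mka) (summable_norm sc0).
      by move=> v; exact: clip_le_id.
    apply: filterS (ae_summable2 ska1) => w sw.
    apply: filterS; last exact: (window_average_cvg sw).
    move=> t ct.
    rewrite -(mul_clip n) /average/=; apply: cvgM; first exact: cvg_cst.
    exact: ct.
  - by apply: summableZ; exact: summable_norm.
  - exact: average_le.
  - move=> v; rewrite normrX expr2 ler_pM//; exact: clip_le_id.
have le j : \int[lebP]_z average j z <= 2^-1 * \int[P]_w (h w ^+ 2) + 2^-1 * \int[lebP]_v (ka v ^+ 2).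
  have j0 : 0 < j.+1%:R^-1 :> R by rewrite invr_gt0.
  rewrite (_ : \int[lebP]_z average j z = j.+1%:R * \int[leb]_v G j.+1%:R^-1 v).
    by have := window_ineq j0; rewrite -ler_pdivrMl// invrK.
  under eq_Rintegral do rewrite averageE.
  rewrite RintegralZl//; last exact: summable_Rintegral2 (swindow _).
  by rewrite -(Rfubini (swindow _)).
have : \int[lebP]_z (ka z ^+ 2) <= 2^-1 * \int[P]_w (h w ^+ 2) + 2^-1 * \int[lebP]_v (ka v ^+ 2).
  rewrite -[leLHS](cvg_lim (@Rhausdorff R) cv); apply: limr_le; first by apply/cvg_ex; eexists; exact: cv.
  by apply: nearW.
lra.
Qed.

End bound.

(** A Bessel inequality: the bound for the clipped k passes to the limit. *)
Lemma represents_bound (h : Om -> R) k : sqint P h -> represents h k ->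
  \int[lebP]_v (cut 0 T k v ^+ 2) <= \int[P]_w (h w ^+ 2).
Proof.
move=> sh hk; have [_ [mk sk] _] := hk.
pose ka n v := clip n (cut 0 T k v).
have cv : (fun n => \int[lebP]_v (ka n v ^+ 2)) @ \oo --> \int[lebP]_v (cut 0 T k v ^+ 2).
  apply: (@Rdominated_cvg _ _ _ lebP (fun n v => ka n v ^+ 2) (fun v => cut 0 T k v ^+ 2) (fun v => cut 0 T k v ^+ 2)) => //.
  - by move=> n; apply: measurable_funX; exact: (measurableT_comp (measurable_clip n) mk).
  - exact: measurable_funX.
  - apply: aeW => v; rewrite expr2; under eq_fun do rewrite expr2.
    by apply: cvgM; exact: cvg_clip.
  - apply: aeW => v n; rewrite normrX -(real_normK (num_real (cut 0 T k v))) lerXn2r ?nnegrE//.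
    exact: clip_le_id.
rewrite -[leLHS](cvg_lim (@Rhausdorff R) cv); apply: limr_le; first by apply/cvg_ex; eexists; exact: cv.
by apply: nearW => n; exact: (represents_trunc_bound sh hk).
Qed.

End representation.

(** * Processes orthogonal to the elementary processes *)

Section ae_tools.
Context d (T : measurableType d) (R : realType).
Variable mu : {measure set T -> \bar R}.

Lemma summable_le_ae (f g : T -> R) : measurable_fun setT f ->
  {ae mu, forall x, `|f x| <= g x} -> summable_fun mu g -> summable_fun mu f.
Proof.
move=> mf fg sg; have mg := summable_measurable sg; apply: summable_lty => //.
have /integrableP[_] := sg; apply: le_lt_trans; apply: ae_ge0_le_integral => //.
- by apply/measurable_EFinP; exact: measurableT_comp.
- by apply: measurableT_comp => //; apply/measurable_EFinP.
- by apply: filterS fg => x fgx _; rewrite lee_fin (le_trans fgx)// ler_norm.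
Qed.

Lemma Rintegral_eq0_ae (f : T -> R) : summable_fun mu f ->
  {ae mu, forall x, 0 <= f x} -> \int[mu]_x f x = 0 -> {ae mu, forall x, f x = 0}.
Proof.
move=> sf f0 If; have mf := summable_measurable sf.
have mEf : measurable_fun setT (EFin \o f) by exact/measurable_EFinP.
have h : (\int[mu]_x `|(EFin \o f) x| = 0)%E.
  have : \int[mu]_x `|f x| = 0.
    rewrite -If; apply: ae_eq_Rintegral => //; first exact: measurableT_comp.
    by apply: filterS f0 => x; exact: ger0_norm.
  by move=> h; have := congr1 EFin h; rewrite Rintegral_fineK//; exact: summable_norm.
have /(ae_eq_integral_abs _ measurableT mEf) h' := h.
by apply: filterS h' => x /= /(_ I) [].
Qed.

Lemma sqint0_ae (f : T -> R) : sqint mu f -> \int[mu]_x (f x ^+ 2) = 0 ->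
  {ae mu, forall x, f x = 0}.
Proof.
move=> [_ sf] /(Rintegral_eq0_ae sf) h; apply: filterS (h _).
  by move=> x /eqP; rewrite sqrf_eq0 => /eqP.
by apply: aeW => x; exact: sqr_ge0.
Qed.

End ae_tools.

Section marginal.
Context d1 d2 (T1 : measurableType d1) (T2 : measurableType d2) (R : realType).
Variables (m1 : {sigma_finite_measure set T1 -> \bar R})
  (m2 : {sigma_finite_measure set T2 -> \bar R}).

Lemma measurable_Rintegral_prod2 (f : T1 * T2 -> R) : measurable_fun setT f ->
  measurable_fun setT (fun y => \int[m1]_x f (x, y)).
Proof.
move=> mf; have mg : measurable_fun setT (fun v : T2 * T1 => f (v.2, v.1)).
  by apply: (measurableT_comp mf); exact: measurable_swap.
exact: (@measurable_Rintegral_prod _ _ _ _ _ m1 _ mg).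
Qed.

(** Cauchy-Schwarz: integrating out a coordinate over a set of finite measure
    keeps square integrability. *)
Lemma sqint_marginal (f : T1 * T2 -> R) (A : set T1) : sqint m1 (\1_A : T1 -> R) ->
  (forall x y, ~ A x -> f (x, y) = 0) -> sqint (m1 \x m2)%E f ->
  sqint m2 (fun y => \int[m1]_x f (x, y)).
Proof.
move=> sA fA [mf sf]; have mF := measurable_Rintegral_prod2 mf; split => //.
pose a := \int[m1]_x (\1_A x ^+ 2 : R).
apply: (@summable_le_ae _ _ _ m2 _ (fun y => a * \int[m1]_x (f (x, y) ^+ 2))).
- exact: measurable_funX.
- apply: filterS (ae_summable2 sf) => y sy.
  have sfy : sqint m1 (fun x => f (x, y)).
    by split => //; exact: (measurableT_comp mf (measurable_pair2 y)).
  rewrite ger0_norm ?sqr_ge0//; have := cauchy_schwarz sA sfy.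
  rewrite [X in X ^+ 2](_ : _ = \int[m1]_x f (x, y))//.
  apply: eq_Rintegral => x _; rewrite indicE.
  by have [xA|nA] := boolP (x \in A); rewrite ?mul1r// fA ?mulr0// => xA; rewrite mem_set in nA.
- by apply: summableZ; exact: (summable_Rintegral2 sf).
Qed.

Lemma sqint_slices (f : T1 * T2 -> R) (b : T1 -> R) : measurable_fun setT f ->
  summable_fun m1 b ->
  {ae m1, forall x, sqint m2 (fun y => f (x, y)) /\ \int[m2]_y (f (x, y) ^+ 2) <= b x} ->
  sqint (m1 \x m2)%E f.
Proof.
move=> mf sb fb; split => //; apply: summable_prod_ge0; first exact: measurable_funX.
have /integrableP[_] := sb; apply: le_lt_trans; apply: ae_ge0_le_integral => //.
- by move=> x _; exact: integral_ge0.
- apply: (measurable_fun_fubini_tonelli_F (m2 := m2) (fun z => (`|f z ^+ 2|)%:E)) => //.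
  by apply/measurable_EFinP; apply: measurableT_comp => //; exact: measurable_funX.
- by apply: measurableT_comp => //; apply/measurable_EFinP; exact: summable_measurable sb.
apply: filterS fb => x [[_ sfx] fbx] _.
under eq_integral do rewrite ger0_norm ?sqr_ge0//.
by rewrite -Rintegral_fineK// lee_fin (le_trans fbx)// ler_norm.
Qed.

End marginal.

Section rays.
Context {R : realType}.
Local Notation leb := (@lebesgue_measure R).

(** The integrals over the rational rays determine those over all rays by
    dominated convergence, and the derivative of the latter is the function. *)
Lemma ae_eq0_rational_rays (f : R -> R) : summable_fun leb f ->
  (forall q : rat, \int[leb]_t (\1_(`]-oo, ratr q]%classic) t * f t) = 0) ->
  {ae leb, forall t, f t = 0}.
Proof.
move=> sf f0; have mf := summable_measurable sf.
have F0 x : \int[leb]_(t in `]-oo, x]) f t = 0.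
  have xn (n : nat) : x < x + n.+1%:R^-1 by rewrite ltrDl invr_gt0.
  have /choice[q qP] : forall n : nat, exists q : rat, ratr q \in `]x, (x + n.+1%:R^-1)[.
    by move=> n; exact: rat_in_itvoo (xn n).
  have cv : (fun n => \int[leb]_t (\1_(`]-oo, ratr (q n)]%classic) t * f t)) @ \oo -->
      \int[leb]_t (\1_(`]-oo, x]%classic) t * f t).
    apply: (@Rdominated_cvg _ _ _ leb (fun n t => \1_(`]-oo, ratr (q n)]%classic) t * f t)
      (fun t => \1_(`]-oo, x]%classic) t * f t) (fun t => `|f t|)).
    - by move=> n; apply: measurable_funM => //; apply: measurable_indic; exact: measurable_itv.
    - by apply: measurable_funM => //; apply: measurable_indic; exact: measurable_itv.
    - apply: aeW => t; apply: cvgM; last exact: cvg_cst.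
      apply: cvg_near_cst; have [tx|xt] := leP t x.
        exists 0%N => // n _ /=; rewrite !indicE !mem_set//= in_itv/=.
        by have := qP n; rewrite in_itv/= => /andP[/ltW xq _]; exact: le_trans xq.
      have : (fun n : nat => n.+1%:R^-1) @ \oo --> (0 : R) by exact: cvg_harmonic.
      have tx0 : 0 < t - x by rewrite subr_gt0.
      move=> /cvgr_lt /(_ _ tx0) [N _ HN]; exists N => // n Nn /=.
      rewrite !indicE !memNset//= in_itv/=; apply/negP; rewrite -ltNge//.
      have := qP n; rewrite in_itv/= => /andP[_ /lt_trans]; apply.
      by rewrite addrC -ltrBrDr; exact: HN.
    - exact: summable_norm.
    - by apply: aeW => t n; rewrite normrM -[leRHS]mul1r ler_wpM2r// normr_indic_le1.
  rewrite -Rintegral_mulr_indic; move: cv; under eq_fun do rewrite f0.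
  by move=> cv; apply: (cvg_unique (@Rhausdorff R) cv); exact: cvg_cst.
have := ray_integral_derive sf.
rewrite (_ : (fun x : R => _) = cst 0); last by apply/funext => x; exact: F0.
by apply: (@filterS _ _ (ae_filter_ringOfSetsType leb)) => t [_ <-]; rewrite derive1_cst.
Qed.

End rays.

Section uniqueness.
Context {d : measure_display} {Om : measurableType d} {R : realType}.
Variable M : model Om R.
Hypothesis hM : noisy_setting M.

Local Notation T := (horizon M).
Local Notation P := (prob M).
Local Notation leb := (@lebesgue_measure R).
Local Notation lebP := (prod_measure leb P).

Variable D : R * Om -> R.
Hypotheses (sD : sqint lebP D) (D_out : forall t w, ~ `[0, T]%classic t -> D (t, w) = 0).
Hypothesis orth : forall a (c : Om -> R) C x, 0 <= a <= T ->
  measurable_wrt setT (filtration M a) c -> (forall w, `|c w| <= C) ->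
  \int[lebP]_v (D v * step_proc c a x v) = 0.

Let mD : measurable_fun setT D. Proof. by case: sD. Qed.

Let s0T : summable_fun leb (\1_(`[0, T]%classic) : R -> R).
Proof. exact: integrable_indic_itv. Qed.

Let D0T v : \1_(`[0, T]%classic) v.1 * D v = D v.
Proof.
case: v => t w /=; have [tT|nT] := boolP (t \in `[0, T]%classic).
  by rewrite indicE tT mul1r.
by rewrite D_out ?mulr0// => tT; rewrite mem_set in nT.
Qed.

Let sD1 : summable_fun lebP D.
Proof.
exact: (sqint_summable_slab D_out sD).
Qed.

Definition later x u w := \int[leb]_t (\1_(`]u, x]%classic) t * D (t, w)).

Let later_kernel x (v : R * (R * Om)) : R :=
  \1_(`[0, T]%classic) v.2.1 * (\1_(`]v.2.1, x]%classic) v.1 * D (v.1, v.2.2)).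

Let measurable_later_kernel x : measurable_fun setT (later_kernel x).
Proof.
have mu : measurable_fun setT (fun v : R * (R * Om) => v.2.1).
  exact: (measurableT_comp measurable_fst measurable_snd).
apply: measurable_funM.
  exact: (measurableT_comp (measurable_indic _) mu).
apply: measurable_funM; last exact: measurable_triple13.
rewrite (_ : (fun v : R * (R * Om) => _) = fun v => \1_(`]0, +oo[%classic) (v.1 - v.2.1) * \1_(`]-oo, x]%classic) v.1).
  apply: measurable_funM.
    apply: (measurableT_comp (measurable_indic _)) => //.
    exact: measurable_funB.
  by apply: (measurableT_comp (measurable_indic _)).
apply/funext => v; rewrite !indicE -natrM mulnb; congr ((_ : bool)%:R).
apply/idP/idP; rewrite !inE/= !in_itv/= ?andbT ?subr_gt0.
  by move=> /andP[a b]; apply/andP; split; rewrite inE/= in_itv/= ?andbT ?subr_gt0.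
by move=> /andP[]; rewrite !inE/= !in_itv/= andbT subr_gt0 => -> ->.
Qed.

Let sqint_later_kernel x : sqint (leb \x lebP)%E (later_kernel x).
Proof.
have [_ sD2] := sD; split; first exact: measurable_later_kernel.
apply: (@summable_le _ _ _ (leb \x lebP)%E _ (fun v => \1_(`[0, T]%classic) v.2.1 * D (v.1, v.2.2) ^+ 2)) (summable_triple s0T sD2).
  exact: (measurable_funX 2 (measurable_later_kernel x)).
move=> [t [u w]]; rewrite /later_kernel/=; set a := \1__ u; set b := \1__ t.
have a2 : a ^+ 2 = a by rewrite /a indicE; case: (_ \in _); rewrite ?expr1n ?expr0n.
have a0 : 0 <= a by rewrite /a indicE.
have b1 : b ^+ 2 <= 1 by rewrite /b indicE; case: (_ \in _); rewrite ?expr1n ?expr0n.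
rewrite ger0_norm ?sqr_ge0// !exprMn a2 ler_wpM2l//.
by rewrite -[leRHS]mul1r ler_wpM2r// sqr_ge0.
Qed.

Let cut_laterE x v : cut 0 T (later x) v = \int[leb]_t later_kernel x (t, v).
Proof.
rewrite /cut /later /later_kernel/=.
have [vT|nT] := boolP (v.1 \in `[0, T]%classic); rewrite indicE.
  by rewrite vT mul1r; under [RHS]eq_Rintegral do rewrite mul1r.
by rewrite (negbTE nT) mul0r Rintegral_eq0// => t; rewrite mul0r.
Qed.

Lemma sqint_later x : sqint lebP (cut 0 T (later x)).
Proof.
rewrite (_ : cut 0 T (later x) = fun v => \int[leb]_t later_kernel x (t, v)); last first.
  by apply/funext => v; exact: cut_laterE.
apply: (@sqint_marginal _ _ _ _ _ leb lebP (later_kernel x) `[0, T]%classic).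
- exact: sqint_indic_itv.
- by move=> t [u w] nt; rewrite /later_kernel/= D_out// !mulr0.
- exact: sqint_later_kernel.
Qed.

(** The slice at time u of the clipped k is the coefficient of an elementary
    process on ]u, x]. *)
Let later_orth_clip n k x : adapted (filtration M) 0 T k -> measurable_fun setT (cut 0 T k) ->
  \int[lebP]_v (clip n (cut 0 T k v) * cut 0 T (later x) v) = 0.
Proof.
move=> ak mk.
have mck : measurable_fun setT (fun v => clip n (cut 0 T k v)).
  exact: (measurableT_comp (measurable_clip n) mk).
have [mL sL2] := sqint_later x.
have sL : summable_fun lebP (cut 0 T (later x)).
  apply: (sqint_summable_slab (T := T)) (sqint_later x) => t w nt.
  by rewrite /cut indicE memNset// mul0r.
have skL : summable_fun lebP (fun v => clip n (cut 0 T k v) * cut 0 T (later x) v).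
  by apply: (@summable_bounded_mul _ _ _ _ _ _ n%:R) => // v; exact: clip_le.
rewrite -(Rfubini1 skL)/=.
apply: Rintegral_eq0 => u.
have [uT|nT] := boolP (u \in `[0, T]%classic); last first.
  by apply: Rintegral_eq0 => w; rewrite /cut/= indicE (negbTE nT) !mul0r mulr0.
have uT' : 0 <= u <= T by move: uT; rewrite inE/= in_itv.
pose c w := clip n (k u w).
have mc : measurable_wrt setT (filtration M u) c by apply: measurable_wrt_clip; exact: ak.
have cC w : `|c w| <= n%:R by exact: clip_le.
have mcf := measurable_filtration hM mc.
have sDc := sqint_mul sD (sqint_step_proc M u x mcf cC).
rewrite -[RHS](orth x uT' mc cC) -(Rfubini2 sDc)/=.
apply: ae_eq_Rintegral.
- apply: (measurableT_comp (f := fun v => clip n (cut 0 T k v) * cut 0 T (later x) v)).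
    exact: measurable_funM.
  exact: measurable_pair1.
- exact: (measurable_Rintegral2 sDc).
apply: filterS (ae_summable2 sD1) => w sw.
rewrite /cut/= indicE uT !mul1r -/(c w) /later -RintegralZl//; last first.
  apply: (@summable_bounded_mul _ _ _ _ _ _ 1) => //.
  by move=> t; exact: normr_indic_le1.
by apply: eq_Rintegral => t _; rewrite /step_proc/=; ring.
Qed.

Lemma later_orth k x : adapted (filtration M) 0 T k -> sqint lebP (cut 0 T k) ->
  \int[lebP]_v (cut 0 T k v * cut 0 T (later x) v) = 0.
Proof.
move=> ak sk; have [mk _] := sk; have [mL _] := sqint_later x.
have cv : (fun n => \int[lebP]_v (clip n (cut 0 T k v) * cut 0 T (later x) v)) @ \oo -->
    \int[lebP]_v (cut 0 T k v * cut 0 T (later x) v).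
  apply: (@Rdominated_cvg _ _ _ lebP (fun n v => clip n (cut 0 T k v) * cut 0 T (later x) v) _
    (fun v => `|cut 0 T k v * cut 0 T (later x) v|)).
  - by move=> n; apply: measurable_funM => //; exact: (measurableT_comp (measurable_clip n) mk).
  - exact: measurable_funM.
  - by apply: aeW => v; apply: cvgM; [exact: cvg_clip|exact: cvg_cst].
  - by apply: summable_norm; exact: (sqint_mul sk (sqint_later x)).
  - by apply: aeW => v n; rewrite normrM [leRHS]normrM; apply: ler_wpM2r => //; exact: clip_le_id.
move: cv; under eq_fun do rewrite later_orth_clip//.
by move=> cv; apply: (cvg_unique (@Rhausdorff R) cv); exact: cvg_cst.
Qed.

(** A process orthogonal to its own future integrals has, by the triangle
    identity, integrals with zero second moment, hence vanishes. *)
Lemma later_self_orth_eq0 :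
  (forall x, \int[lebP]_v (D v * cut 0 T (later x) v) = 0) ->
  {ae lebP, forall v, D v = 0}.
Proof.
move=> selforth.
pose g x w t := \1_(`]-oo, x]%classic) t * D (t, w).
have sg x w : summable_fun leb (fun t => D (t, w)) -> summable_fun leb (g x w).
  move=> sw; apply: (@summable_bounded_mul _ _ _ _ _ _ 1) => //.
  by move=> t; exact: normr_indic_le1.
have ray x : {ae P, forall w, \int[leb]_t g x w t = 0}.
  have sDL := sqint_mul sD (sqint_later x).
  have half : {ae P, forall w, \int[leb]_u (D (u, w) * cut 0 T (later x) (u, w)) =
      (\int[leb]_t g x w t) ^+ 2 / 2}.
    apply: filterS (ae_summable2 sD1) => w sw; rewrite -Rintegral_triangle; last exact: sg.
    apply: eq_Rintegral => u _; rewrite /cut/= mulrA [D _ * _]mulrC (D0T (u, w)) /g.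
    have [xu|ux] := ltP x u.
      transitivity (0 : R).
        rewrite /later Rintegral_eq0 ?mulr0// => t; rewrite indicE memNset ?mul0r//= in_itv/=.
        by move=> /andP[ut tx]; have := lt_trans xu (lt_le_trans ut tx); rewrite ltxx.
      by rewrite [\1_(`]-oo, x]%classic) u]indicE memNset/= ?in_itv/= ?mul0r// leNgt xu.
    rewrite [\1_(`]-oo, x]%classic) u]indicE mem_set/= ?in_itv//= mul1r; congr (_ * _).
    apply: eq_Rintegral => t _; rewrite mulrA; congr (_ * _).
    rewrite !indicE -natrM mulnb; congr ((_ : bool)%:R).
    rewrite -in_setI; congr (_ \in _); apply/seteqP; split => y /=; rewrite !in_itv/= andbT.
      by move=> /andP[].
    by move=> [-> ->].
  have sH := summable_Rintegral2 sDL.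
  have I0 : \int[P]_w \int[leb]_u (D (u, w) * cut 0 T (later x) (u, w)) = 0.
    by rewrite (Rfubini2 sDL); exact: selforth.
  have H0 : {ae P, forall w, 0 <= \int[leb]_u (D (u, w) * cut 0 T (later x) (u, w))}.
    by apply: filterS half => w ->; rewrite divr_ge0// sqr_ge0.
  apply: filterS2 half (Rintegral_eq0_ae sH H0 I0) => w -> /eqP.
  by rewrite mulf_eq0 invr_eq0 pnatr_eq0 orbF sqrf_eq0 => /eqP.
have rays : {ae P, forall w, forall q : rat, \int[leb]_t g (ratr q) w t = 0}.
  have : {ae P, forall w, forall n, \int[leb]_t g (ratr (odflt 0 (unpickle n))) w t = 0}.
    by apply: ae_foralln => n; exact: ray.
  by apply: filterS => w h q; have := h (pickle q); rewrite pickleK.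
have [_ sD2] := sD; apply: sqint0_ae => //; rewrite -(Rfubini2 sD2)/=.
rewrite -[RHS](@Rintegral_eq0 _ _ _ P (fun=> 0))//; apply: ae_eq_Rintegral => //; first exact: (measurable_Rintegral2 sD2).
apply: filterS2 rays (ae_summable2 sD1) => w r sw.
have h := ae_eq0_rational_rays sw r.
rewrite -[RHS](@Rintegral_eq0 _ _ _ leb (fun=> 0))//; apply: ae_eq_Rintegral => //.
- by apply: measurable_funX; exact: (measurableT_comp mD (measurable_pair2 w)).
- apply: filterS; last exact: h.
  by move=> t /= ->; rewrite expr0n.
Qed.

End uniqueness.

(** * Conditional expectations and predictable processes *)

Section lebesgue_almost_everywhere.
Context {R : realType}.
Local Notation leb := (@lebesgue_measure R).
Implicit Types Q : R -> Prop.

Lemma lebesgue_ae1 Q1 Q2 : (forall x, Q1 x -> Q2 x) ->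
  {ae leb, forall x, Q1 x} -> {ae leb, forall x, Q2 x}.
Proof. exact: (@filterS _ _ (ae_filter_ringOfSetsType leb)). Qed.

Lemma lebesgue_ae2 Q1 Q2 Q3 : (forall x, Q1 x -> Q2 x -> Q3 x) ->
  {ae leb, forall x, Q1 x} -> {ae leb, forall x, Q2 x} -> {ae leb, forall x, Q3 x}.
Proof. exact: (@filterS2 _ _ (ae_filter_ringOfSetsType leb)). Qed.

End lebesgue_almost_everywhere.

Section factor.
Context d1 d2 (T1 : measurableType d1) (T2 : measurableType d2) (R : realType).
Variables (m1 : {sigma_finite_measure set T1 -> \bar R})
  (m2 : {sigma_finite_measure set T2 -> \bar R}).

(** Where g does not vanish, the sections of f are summable. *)
Lemma Rfubini_factor (f : T1 * T2 -> R) (g : T2 -> R) : measurable_fun setT f ->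
  measurable_fun setT g -> summable_fun (m1 \x m2)%E (fun z => f z * g z.2) ->
  \int[m2]_y ((\int[m1]_x f (x, y)) * g y) = \int[m1]_x \int[m2]_y (f (x, y) * g y).
Proof.
move=> mf mg sfg; rewrite (Rfubini sfg)/=; apply: ae_eq_Rintegral.
- by apply: measurable_funM => //; exact: measurable_Rintegral_prod2.
- exact: (measurable_Rintegral2 sfg).
apply: filterS (ae_summable2 sfg) => y /= sy.
have [->|n0] := eqVneq (g y) 0.
  by rewrite mulr0 Rintegral_eq0// => x; rewrite mulr0.
rewrite RintegralZr//.
have := summableZ (g y)^-1 sy; congr (summable_fun _ _).
by apply/funext => x; rewrite mulrCA mulVf// mulr1.
Qed.

End factor.

Section conditional_expectation.
Context {d : measure_display} {Om : measurableType d} {R : realType}.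
Variables (M : model Om R) (G : set (set Om)) (F F' : Om -> R).
Local Notation P := (prob M).
Hypotheses (GM : G `<=` measurable) (hF : is_cond_exp M G F F').

Lemma cond_exp_pairing (psi : Om -> R) : measurable_wrt setT G psi ->
  summable_fun P (fun w => psi w * F w) -> summable_fun P (fun w => psi w * F' w) ->
  \int[P]_w (psi w * F w) = \int[P]_w (psi w * F' w).
Proof.
move=> mpsi s1 s2; have [iF iF' _ eqF] := hF.
have sFF : summable_fun P (fun w => F w - F' w) by exact: summableB.
have z A : G A -> \int[P]_(w in A) (F w - F' w) = 0.
  move=> GA; have mA := GM GA.
  rewrite RintegralB//; [|exact: integrableS iF|exact: integrableS iF'].
  by rewrite /Rintegral eqF// subrr.
have sp : summable_fun P (fun w => psi w * (F w - F' w)).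
  by under [X in summable_fun _ X]eq_fun do rewrite mulrBr; exact: summableB.
have := integral_mul_eq0 GM sFF z mpsi sp.
under eq_Rintegral do rewrite mulrBr.
by rewrite RintegralB// => /eqP; rewrite subr_eq0 => /eqP.
Qed.

(** Conditional expectation contracts the L^2 norm: pair with its truncations. *)
Lemma cond_exp_sqint : sqint P F ->
  sqint P F' /\ \int[P]_w (F' w ^+ 2) <= \int[P]_w (F w ^+ 2).
Proof.
move=> sF; have [iF iF' mF' _] := hF; have mF'f := measurable_wrt_fun GM mF'.
have mc n : measurable_fun setT (fun w => clip n (F' w)).
  exact: (measurableT_comp (measurable_clip n) mF'f).
have bound n : \int[P]_w (clip n (F' w) ^+ 2) <= \int[P]_w (F w ^+ 2).
  have cn w : `|clip n (F' w)| <= n%:R by exact: clip_le.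
  have s1 : summable_fun P (fun w => clip n (F' w) * F w) by exact: summable_bounded_mul cn iF.
  have s2 : summable_fun P (fun w => clip n (F' w) * F' w) by exact: summable_bounded_mul cn iF'.
  have E : \int[P]_w (clip n (F' w) ^+ 2) = \int[P]_w (clip n (F' w) * F w).
    rewrite (cond_exp_pairing (measurable_wrt_clip n mF') s1 s2).
    by apply: eq_Rintegral => w _; rewrite mulrC mul_clip.
  have [_ s3] : sqint P (fun w => clip n (F' w)) by exact: sqint_bounded cn.
  have [_ s4] := sF.
  have : 0 <= \int[P]_w ((clip n (F' w) - F w) ^+ 2) by apply: Rintegral_ge0 => w _; exact: sqr_ge0.
  have -> : \int[P]_w ((clip n (F' w) - F w) ^+ 2) = \int[P]_w (clip n (F' w) ^+ 2) -
      2 * \int[P]_w (clip n (F' w) * F w) + \int[P]_w (F w ^+ 2).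
    rewrite -RintegralZl// -RintegralB//; last exact: summableZ.
    rewrite -RintegralD//; last by apply: summableB => //; exact: summableZ.
    by apply: eq_Rintegral => w _; ring.
  lra.
have bE n : (\int[P]_w (clip n (F' w) ^+ 2)%:E <= (\int[P]_w (F w ^+ 2))%:E)%E.
  have [_ s3] : sqint P (fun w => clip n (F' w)).
    by apply: (@sqint_bounded _ _ _ _ _ n%:R) => // w; exact: clip_le.
  by rewrite -Rintegral_fineK// lee_fin.
have limE w : limn (fun n => (clip n (F' w) ^+ 2)%:E) = (F' w ^+ 2)%:E.
  apply/cvg_lim => //; apply: cvg_EFin; first exact: nearW.
  rewrite expr2; under eq_fun do rewrite /= expr2.
  by apply: cvgM; exact: cvg_clip.
have lim_le : (\int[P]_w (F' w ^+ 2)%:E <= (\int[P]_w (F w ^+ 2))%:E)%E.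
  under eq_integral do rewrite -limE.
  have mcE n : measurable_fun setT (fun w => (clip n (F' w) ^+ 2)%:E).
    by apply/measurable_EFinP; exact: measurable_funX.
  have c0 n w : setT w -> (0 <= (clip n (F' w) ^+ 2)%:E)%E by rewrite lee_fin sqr_ge0.
  have mono w : setT w -> {homo (fun n => (clip n (F' w) ^+ 2)%:E) : n n' / (n <= n')%N >-> (n <= n')%E}.
    move=> _ n n' nn'; rewrite lee_fin /clip.
    have [h|h] := leP `|F' w| n%:R; last by rewrite expr0n/= sqr_ge0.
    by rewrite ifT// (le_trans h)// ler_nat.
  have cv := @cvg_monotone_convergence _ _ _ P setT measurableT _ mcE c0 mono.
  rewrite -(cvg_lim _ cv)//; apply: lime_le; last exact: nearW.
  by apply/cvg_ex; eexists; exact: cv.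
have sF' : sqint P F' by apply: sqint_lty => //; apply: le_lt_trans lim_le _; rewrite ltry.
split => //; have [_ s] := sF'.
by rewrite -lee_fin Rintegral_fineK.
Qed.

End conditional_expectation.

Section predictable.
Context {d : measure_display} {Om : measurableType d} {R : realType}.
Variable M : model Om R.
Local Notation T := (horizon M).

(** The sections at time t of predictable sets belong to the past of t, because
    those of the generators do. *)
Lemma predictable_adapted (q : R -> Om -> R) : predictable M q -> adapted (filtration M) 0 T q.
Proof.
move=> pq t tT A mA.
have sgF : sigma_algebra setT (filtration M t) by exact: smallest_sigma_algebra.
have [F0 FC FU] := sgF.
pose sec (E : set (R * Om)) := filtration M t [set w | E (t, w)].
suff : predictable_sets M `<=` sec.
  move=> /(_ _ (pq A mA)); congr (filtration _ _ _); rewrite setTI.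
  by apply/seteqP; split => w /=; [move=> []|move=> ?; split => //; split => //=; rewrite in_itv].
apply: smallest_sub; first split.
- by rewrite /sec (_ : [set _ | _] = set0)//; apply/seteqP; split.
- move=> E sE; have := FC _ sE; rewrite /sec; congr (filtration _ _ _).
  apply/seteqP; split => w /=; first by move=> [_ ?]; split => //; split => //=; rewrite in_itv.
  by move=> [].
- by move=> E sE; exact: (FU (fun n => [set w | E n (t, w)]) sE).
move=> E [[C FC0 ->]|[s [u [C [s0 su uT FCs ->]]]]]; rewrite /sec.
  have [->|t0] := eqVneq t 0.
    rewrite (_ : [set _ | _] = C)//; apply/seteqP; split => w //=.
    by move=> [].
  rewrite (_ : [set _ | _] = set0)//; apply/seteqP; split => w //= [] /= te.
  by rewrite te eqxx in t0.
have [tsu|nt] := boolP (t \in `]s, u]).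
  have st : s <= t by move: tsu; rewrite in_itv/= => /andP[/ltW].
  rewrite (_ : [set _ | _] = C); first exact: filtration_mono st _ FCs.
  by apply/seteqP; split => w //= [].
rewrite (_ : [set _ | _] = set0)//; apply/seteqP; split => w //= [] /= te.
by rewrite te in nt.
Qed.

End predictable.

(** * The martingale integrand is the memory integral *)

Section memory.
Context {d : measure_display} {Om : measurableType d} {R : realType}.
Variable M : model Om R.
Hypothesis hM : noisy_setting M.

Local Notation T := (horizon M).
Local Notation delta := (delay M).
Local Notation P := (prob M).
Local Notation leb := (@lebesgue_measure R).
Local Notation lebP := (prod_measure leb P).

Variables (H : R -> Om -> R) (K : R -> R -> Om -> R).
Hypotheses (hz : square_integrable M 0 T H) (hK : is_cond_malliavin_kernel M H K).

Local Notation Hc := (cut 0 T H).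

Let sH : sqint lebP Hc. Proof. exact: (@sqint_cut _ _ _ P M). Qed.

Let q0T : sqint leb (\1_(`[0, T]%classic) : R -> R).
Proof. exact: sqint_indic_itv. Qed.

Let sqH : {ae leb, forall s, sqint P (fun w => Hc (s, w))}.
Proof.
have [mHc sH2] := sH; apply: filterS (ae_summable1 sH2) => s ss; split => //.
exact: (measurableT_comp mHc (measurable_pair1 s)).
Qed.

Let Hc_in s w : 0 <= s <= T -> Hc (s, w) = H s w.
Proof. by move=> sT; rewrite /cut/= indicE mem_set/= ?in_itv// mul1r. Qed.

Let Hc_out s w : ~~ (0 <= s <= T) -> Hc (s, w) = 0.
Proof. by move=> /negP sT; rewrite /cut/= indicE memNset/= ?in_itv// mul0r. Qed.

Definition kernel (z : R * (R * Om)) : R := \1_(`[0, T]%classic) z.1 * cut 0 T (K z.1) z.2.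

Let kernel_in s v : 0 <= s <= T -> kernel (s, v) = cut 0 T (K s) v.
Proof. by move=> sT; rewrite /kernel/= indicE mem_set/= ?in_itv// mul1r. Qed.

Let kernel_out s v : ~~ (0 <= s <= T) -> kernel (s, v) = 0.
Proof. by move=> /negP sT; rewrite /kernel/= indicE memNset/= ?in_itv// mul0r. Qed.

Lemma measurable_kernel : measurable_fun setT kernel.
Proof.
have [mK _] := hK.
have mD : measurable (`[0, T]%classic `*` (`[0, T]%classic `*` [set: Om])).
  by apply: measurableX => //; exact: measurableX.
move/(measurable_restrictT _ mD): mK; congr (measurable_fun _ _).
apply/funext => -[s [t w]]; rewrite patchE /kernel /cut/= mulrA.
rewrite (_ : (_ \in _) = (s \in `[0, T]%classic) && (t \in `[0, T]%classic)).
  by rewrite !indicE; case: (s \in _) => /=; case: (t \in _) => /=; rewrite ?mul1r ?mul0r.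
apply/idP/andP; first by rewrite inE/= => -[? [? _]]; rewrite !inE.
by rewrite !inE => -[].
Qed.

Let repK : {ae leb, forall s, 0 <= s <= T -> represents M (H s) (K s)}.
Proof. by have [_] := hK; apply: lebesgue_ae1 => s h /h; exact: malliavin_represents. Qed.

(** The Bessel inequality at each s, integrated over s. *)
Lemma sqint_kernel : sqint (leb \x lebP)%E kernel.
Proof.
have [mHc sH2] := sH; have mk := measurable_kernel.
apply: (@sqint_slices _ _ _ _ _ leb lebP kernel) (summable_Rintegral1 sH2) _ => //.
apply: (lebesgue_ae2 _ sqH repK) => s sHs rK.
have [sT|nT] := boolP (0 <= s <= T); last first.
  have k0 v : kernel (s, v) = 0 by exact: kernel_out.
  under [X in sqint _ X]eq_fun do rewrite k0; split; first exact: sqint0.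
  rewrite Rintegral_eq0 => [|v]; last by rewrite k0 expr0n.
  by apply: Rintegral_ge0 => w _; exact: sqr_ge0.
have [_ sKs _] := rK sT.
have kE : (fun v => kernel (s, v)) = cut 0 T (K s) by apply/funext => v; rewrite kernel_in.
have HE : (fun w => Hc (s, w)) = H s by apply/funext => w; exact: Hc_in.
split; first by rewrite kE.
rewrite HE in sHs; have := represents_bound hM sHs (rK sT); rewrite -kE.
by under [in X in _ -> _ <= X]eq_Rintegral do rewrite (Hc_in _ sT).
Qed.

Let kernel_pairing : {ae leb, forall r, forall a b (c : Om -> R) C,
  0 <= a -> a <= b -> b <= r -> measurable_wrt setT (filtration M a) c ->
  (forall w, `|c w| <= C) ->
  \int[P]_w (Hc (r, w) * (c w * dB M a b w)) =
  \int[lebP]_v (kernel (r, v) * step_proc c a b v)}.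
Proof.
apply: (lebesgue_ae1 _ repK) => r rK a b c C a0 ab br mc cC.
have [rT|nT] := boolP (0 <= r <= T); last first.
  rewrite !Rintegral_eq0// => [v|w]; first by rewrite kernel_out// mul0r.
  by rewrite Hc_out// mul0r.
have [_ _ dual] := rK rT; have /andP[r0 rT'] := rT.
have := dual a b c C a0 ab (le_trans br rT') mc cC.
under eq_Rintegral do rewrite -Hc_in//.
by move=> ->; apply: eq_Rintegral => v _; rewrite kernel_in.
Qed.

(** A window without its right end: it is the difference of the half-lines from 0
    and from delta, which come from the two terms of mu. *)
Definition memory_kernel (z : R * (R * Om)) : R :=
  \1_(`[0, delta[%classic) (z.1 - z.2.1) * kernel z.

Definition memory (v : R * Om) : R := \int[leb]_s memory_kernel (s, v).

Let measurable_lag (D : set R) : measurable D ->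
  measurable_fun setT (fun z : R * (R * Om) => \1_D (z.1 - z.2.1) : R).
Proof.
move=> mD; apply: (measurableT_comp (measurable_indic mD)).
by apply: measurable_funB => //; exact: (measurableT_comp measurable_fst measurable_snd).
Qed.

Lemma sqint_memory_kernel : sqint (leb \x lebP)%E memory_kernel.
Proof.
apply: (@sqint_bounded_mul _ _ _ _ _ _ 1); last exact: sqint_kernel.
  by apply: measurable_lag; exact: measurable_itv.
by move=> z; exact: normr_indic_le1.
Qed.

Lemma sqint_memory : sqint lebP memory.
Proof.
apply: (@sqint_marginal _ _ _ _ _ leb lebP memory_kernel `[0, T]%classic) => //.
  by move=> s v /= /negP; rewrite in_itv/= => sT; rewrite /memory_kernel kernel_out ?mulr0.
exact: sqint_memory_kernel.
Qed.

Lemma memory_out t w : ~ `[0, T]%classic t -> memory (t, w) = 0.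
Proof.
move=> nt; apply: Rintegral_eq0 => s; rewrite /memory_kernel /kernel /cut/=.
by rewrite [\1_(`[0, T]%classic) t]indicE memNset// mul0r !mulr0.
Qed.

(** The two integrals differ by the endpoint of the window only. *)
Lemma memoryE t w : 0 <= t <= T -> memory (t, w) = memory_integral M K t w.
Proof.
move=> tT; rewrite /memory /memory_integral -[RHS]Rintegral_mulr_indic.
have mks : measurable_fun setT (fun s => kernel (s, (t, w))).
  exact: (measurableT_comp measurable_kernel (measurable_pair2 (t, w))).
have KE s : K s t w * \1_(`[0, T]%classic) s = kernel (s, (t, w)).
  by rewrite /kernel/cut/= [\1_(`[0, T]%classic) t]indicE mem_set/= ?in_itv// mul1r mulrC.
under [RHS]eq_Rintegral do rewrite KE.
apply: ae_eq_Rintegral.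
- have [mmk _] := sqint_memory_kernel.
  exact: (measurableT_comp mmk (measurable_pair2 (t, w))).
- by apply: measurable_funM => //; apply: measurable_indic; exact: measurable_itv.
exists [set t + delta]; split; [exact: measurable_set1|exact: lebesgue_measure_set1|].
move=> s /=; apply: contra_notP => /eqP sd; congr (_ * _).
rewrite !indicE; congr ((_ : bool)%:R).
apply/idP/idP; rewrite !inE/= !in_itv/= subr_ge0 ltrBlDl.
  by move=> /andP[-> /ltW ->].
by move=> /andP[-> h] /=; rewrite lt_neqAle sd.
Qed.

Variables (p q : R -> Om -> R) (r : R -> Om -> R -> R).
Let mu t w := H t w - H (t + delta) w * \1_(`[0, T]%classic) (t + delta).
Hypothesis hb : backward_equation M mu (fun=> 0) p q r.

Let muE s w : 0 <= s <= T -> mu s w = Hc (s, w) - Hc (s + delta, w).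
Proof. by move=> sT; rewrite Hc_in// /mu /cut/= [_ * \1__ _]mulrC. Qed.

Let sqmu : {ae leb, forall s, 0 <= s <= T -> sqint P (mu s) /\
  \int[P]_w (mu s w ^+ 2) <=
  2 * \int[P]_w (Hc (s, w) ^+ 2) + 2 * \int[P]_w (Hc (s + delta, w) ^+ 2)}.
Proof.
apply: (lebesgue_ae2 _ sqH (ae_shift delta sqH)) => s s1 s2 sT.
have smu : sqint P (mu s).
  by have := sqintB s1 s2; congr (sqint _ _); apply/funext => w; rewrite muE.
split => //; have [_ s1'] := s1; have [_ s2'] := s2; have [_ smu'] := smu.
rewrite -!RintegralZl// -RintegralD//; [|exact: summableZ|exact: summableZ].
apply: le_Rintegral => //; first by apply: summableD; exact: summableZ.
move=> w _; rewrite muE//; set x := Hc _; set y := Hc _.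
by have := sqr_ge0 (x + y); rewrite !expr2; lra.
Qed.

Let sqint_drift m : is_cond_exp_process M mu m -> sqint lebP (cut 0 T m).
Proof.
move=> [mm cem]; have [_ sH2] := sH; have sE := summable_Rintegral1 sH2.
have sE2 : summable_fun leb (fun s => 2 * \int[P]_w (Hc (s, w) ^+ 2) + 2 * \int[P]_w (Hc (s + delta, w) ^+ 2)).
  apply: summableD; apply: summableZ => //; exact: (summable_shift delta sE).
apply: (@sqint_slices _ _ _ _ _ leb P (cut 0 T m)) sE2 _; first exact: measurable_cut.
apply: (lebesgue_ae2 _ sqmu cem) => s smu ce.
have [sT|nT] := boolP (0 <= s <= T); last first.
  have m0 w : cut 0 T m (s, w) = 0.
    by move/negP: nT => nT; rewrite /cut/= indicE memNset/= ?in_itv// mul0r.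
  under [X in sqint _ X]eq_fun do rewrite m0; split; first exact: sqint0.
  rewrite Rintegral_eq0 => [|w]; last by rewrite m0 expr0n.
  by rewrite addr_ge0// mulr_ge0//; apply: Rintegral_ge0 => w _; exact: sqr_ge0.
have mE : (fun w => cut 0 T m (s, w)) = m s.
  by apply/funext => w; rewrite /cut/= indicE mem_set/= ?in_itv// mul1r.
have [s1 s2] := smu sT.
have [s3 s4] := cond_exp_sqint (filtration_measurable hM (a := s)) (ce sT) s1.
split; first by rewrite mE.
apply: le_trans s2; apply: le_trans s4; rewrite le_eqVlt; apply/orP; left; apply/eqP.
by apply: eq_Rintegral => w _; rewrite -[in RHS]mE.
Qed.

Section pairing.
Variables (a b C : R) (c : Om -> R).
Hypotheses (a0 : 0 <= a) (ab : a <= b) (bT : b <= T)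
  (mc : measurable_wrt setT (filtration M a) c) (cC : forall w, `|c w| <= C).

Let X w := c w * dB M a b w.

Let dle x : a <= x -> - delta <= x.
Proof. by move=> ax; apply: (delta_le hM); exact: le_trans ax. Qed.

Let mcf : measurable_fun setT c. Proof. exact: (measurable_filtration hM mc). Qed.

Let sX : sqint P X. Proof. exact: (sqint_bounded_dB hM (dle (lexx a)) ab mcf cC). Qed.

Let sstep : sqint lebP (step_proc c a b). Proof. exact: (sqint_step_proc M a b mcf cC). Qed.

Let base (z : R * (R * Om)) := kernel z * step_proc c a b z.2.

Let sbase : summable_fun (leb \x lebP)%E base.
Proof.
have := sqint_mul sqint_kernel (sqint_tensor q0T sstep); congr (summable_fun _ _).
apply/funext => -[s v]; rewrite /base /kernel/=.
by rewrite !indicE; case: (_ \in _); rewrite ?mul1r ?mul0r.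
Qed.

(** The integral of after 0 at time s is the contribution of H(s) to the drift, and
    that of after delta at time s + delta is the contribution of H(s + delta). *)
Let after l (z : R * (R * Om)) := \1_(`[l, +oo[%classic) (z.1 - z.2.1) * base z.

Let safter l : summable_fun (leb \x lebP)%E (after l).
Proof.
apply: (@summable_bounded_mul _ _ _ _ _ _ 1) => //; last by move=> z; exact: normr_indic_le1.
by apply: measurable_lag; exact: measurable_itv.
Qed.

(** The part of the increment of B after time s is orthogonal to the past of s;
    on the part before s the drift may be replaced by mu(s), and the duality
    formula applies to the two terms of mu(s). *)
Let drift_pairing m : is_cond_exp_process M mu m ->
  {ae leb, forall s, \int[P]_w (cut a T m (s, w) * X w) =
     \int[lebP]_v after 0 (s, v) - \int[lebP]_v after delta (s + delta, v)}.
Proof.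
move=> [mm cem].
have := lebesgue_ae2 (fun x a b => conj a b) (lebesgue_ae2 (fun x a b => conj a b) sqH (ae_shift delta sqH))
  (lebesgue_ae2 (fun x a b => conj a b) kernel_pairing (ae_shift delta kernel_pairing)).
have := lebesgue_ae2 (fun x a b => conj a b) sqmu cem.
apply: lebesgue_ae2 => s [smu ce] [[s1 s2] [k1 k2]].
have [saT|ns] := boolP (a <= s <= T); last first.
  rewrite Rintegral_eq0 => [|w]; last first.
    by rewrite /cut/= indicE memNset/= ?in_itv ?mul0r//; exact/negP.
  have [sa|as_] := ltP s a.
    have out l s' v : s' = s + l -> after l (s', v) = 0.
      move=> ->; rewrite /after /base /step_proc/=.
      have [tI|nI] := boolP (v.1 \in `]a, b]%classic); last first.
        by rewrite [\1_(`]a, b]%classic) _]indicE (negbTE nI) mul0r !mulr0.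
      rewrite [\1_(`[_, +oo[%classic) _]indicE memNset ?mul0r//= in_itv/= andbT => h.
      by move: tI; rewrite inE/= in_itv/= => /andP[at_ _]; lra.
    by rewrite !Rintegral_eq0 ?subr0// => v; apply: out; rewrite ?addr0.
  have Ts : T < s by rewrite ltNge; apply: contra ns => ->; rewrite as_.
  have d0 := delay_gt0 hM.
  rewrite !Rintegral_eq0 ?subr0// => v; rewrite /after /base kernel_out ?mul0r ?mulr0//.
    by rewrite negb_and -!ltNge; apply/orP; right; lra.
  by rewrite negb_and -!ltNge Ts orbT.
have /andP[as_ sT'] := saT; have sT : 0 <= s <= T by rewrite sT' (le_trans a0).
have [sqm _] := smu sT.
have [sms _] := cond_exp_sqint (filtration_measurable hM (a := s)) (ce sT) sqm.
have [_ _ msF _] := ce sT.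
have mcs : measurable_wrt setT (filtration M s) c by exact: measurable_wrt_filtration_mono as_ mc.
pose b' := Num.min b s.
have ab' : a <= b' by rewrite le_min ab as_.
have b's : b' <= s by rewrite ge_min lexx orbT.
have b'b : b' <= b by rewrite ge_min lexx.
pose X' w := c w * dB M a b' w.
have sX' : sqint P X' by exact: (sqint_bounded_dB hM (dle (lexx a)) ab' mcf cC).
have mX' : measurable_wrt setT (filtration M s) X'.
  apply: measurable_wrtM => //; apply: measurable_wrt_filtration_mono b's _.
  exact: (filtration_dB (dle (lexx a)) ab').
have sXd : sqint P (fun w => c w * dB M b' b w).
  exact: (sqint_bounded_dB hM (dle ab') b'b mcf cC).
have -> : \int[P]_w (cut a T m (s, w) * X w) = \int[P]_w (X' w * m s w).
  transitivity (\int[P]_w (X' w * m s w) + \int[P]_w (m s w * (c w * dB M b' b w))).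
    rewrite -RintegralD//; [|exact: sqint_mul|exact: sqint_mul].
    apply: eq_Rintegral => w _; rewrite /cut/= indicE mem_set/= ?in_itv// /X (dB_split M a b' b) /X'.
    by ring.
  rewrite [X in _ + X](_ : _ = 0) ?addr0//.
  have [bs|sb] := leP b s.
    rewrite /b' min_l//; apply: Rintegral_eq0 => w; by rewrite dBii !mulr0.
  rewrite /b' min_r; last exact: ltW.
  under eq_Rintegral do rewrite mulrA.
  apply: (expectation_mul_dB_filtration hM (dle as_) (ltW sb)).
    exact: measurable_wrtM.
  by under [X in sqint _ X]eq_fun do rewrite mulrC; exact: (sqint_bounded_mul mcf cC sms).
rewrite -(cond_exp_pairing (filtration_measurable hM (a := s)) (ce sT) mX'); [|exact: sqint_mul|exact: sqint_mul].
have -> : \int[P]_w (X' w * mu s w) = \int[P]_w (Hc (s, w) * X' w) - \int[P]_w (Hc (s + delta, w) * X' w).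
  rewrite -RintegralB//; [|exact: sqint_mul|exact: sqint_mul].
  by apply: eq_Rintegral => w _; rewrite muE//; ring.
have d0 := delay_gt0 hM.
rewrite (k1 a b' c C)// (k2 a b' c C)//; last by rewrite (le_trans b's)// lerDl ltW.
have stepE (l t : R) w : step_proc c a b' (t, w) = \1_(`[l, +oo[%classic) (s + l - t) * step_proc c a b (t, w).
  rewrite /step_proc/= mulrA; congr (_ * _); rewrite !indicE -natrM mulnb; congr ((_ : bool)%:R).
  apply/idP/andP; rewrite !inE/= !in_itv/= andbT le_min.
    by move=> /andP[-> /andP[-> ts]]; split => //; lra.
  by move=> [sl /andP[-> ->]] /=; lra.
congr (_ - _).
  apply: eq_Rintegral => -[t w] _; rewrite (stepE 0) addr0 /after /base/=.
  by rewrite mulrCA.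
by apply: eq_Rintegral => -[t w] _; rewrite (stepE delta) /after /base/= mulrCA.
Qed.

(** Translating the second term by delta leaves the indicator of the window. *)
Let memory_after : \int[leb]_s (\int[lebP]_v after 0 (s, v) - \int[lebP]_v after delta (s + delta, v)) =
  \int[lebP]_v (memory v * step_proc c a b v).
Proof.
have s1 := summable_Rintegral1 (safter 0); have s2 := summable_Rintegral1 (safter delta).
rewrite RintegralB//; last exact: (summable_shift delta s2).
rewrite (@Rintegral_shift _ (fun s => \int[lebP]_v after delta (s, v)) delta); last exact: summable_measurable s2.
rewrite -RintegralB//.
have d0 := delay_gt0 hM.
have afterE z : after 0 z - after delta z = memory_kernel z * step_proc c a b z.2.
  rewrite /after /memory_kernel /base -mulrBl mulrA; congr (_ * _ * _).
  set x := z.1 - z.2.1.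
  have mi (i : interval R) : (x \in [set` i]) = (x \in i).
    by apply/idP/idP => [/set_mem|h]//; apply/mem_set.
  rewrite !indicE !mi !in_itv/= !andbT.
  have [xd|xd] := leP delta x.
    by rewrite (le_trans (ltW d0) xd) andbF subrr.
  by case: (0 <= x); rewrite subr0.
have sd : summable_fun (leb \x lebP)%E (fun z => memory_kernel z * step_proc c a b z.2).
  by have := summableB (safter 0) (safter delta); congr (summable_fun _ _); apply/funext => z.
transitivity (\int[leb]_s \int[lebP]_v (memory_kernel (s, v) * step_proc c a b v)).
  have := ae_summable1 (safter delta); have := ae_summable1 (safter 0).
  move=> h1 h2; apply: ae_eq_Rintegral.
  - by apply: measurable_funB; [exact: summable_measurable s1|exact: summable_measurable s2].
  - exact: (measurable_Rintegral1 sd).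
  apply: (lebesgue_ae2 _ h1 h2) => s t1 t2; rewrite -RintegralB//.
  by apply: eq_Rintegral => v _; rewrite afterE.
have [mmk _] := sqint_memory_kernel; have [mst _] := sstep.
by rewrite -(Rfubini_factor mmk mst sd).
Qed.

Let indicaT s : \1_(`[a, T]%classic) s * \1_(`[0, T]%classic) s = \1_(`[a, T]%classic) s :> R.
Proof.
rewrite !indicE -natrM mulnb -in_setI; congr ((_ \in _)%:R).
apply/seteqP; split => x /=; rewrite !in_itv/=; first by move=> [].
by move=> /andP[ax ->]; split; [rewrite ax|rewrite (le_trans a0 ax)].
Qed.

Let sqint_drift_from m : is_cond_exp_process M mu m -> sqint lebP (cut a T m).
Proof.
move=> cem.
have := @sqint_bounded_mul _ _ _ lebP (fun v => \1_(`[a, T]%classic) v.1) _ 1 _ _ (sqint_drift cem).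
have -> : (fun v => \1_(`[a, T]%classic) v.1 * cut 0 T m v) = cut a T m.
  by apply/funext => v; rewrite /cut mulrA indicaT.
apply; last by move=> v; exact: normr_indic_le1.
apply: (measurableT_comp (measurable_indic _)) => //.
Qed.

(** In the equation at time a, the value p(a) is known before the increment of B
    and the jump integral is orthogonal to it; the Ito integral of q and that of
    the drift remain. *)
Let control_pairing m I J : is_cond_exp_process M mu m ->
  ito_integral M a T q I -> jump_integral M a T r J ->
  {ae P, forall w, p a w = 0 + \int[leb]_(s in `[a, T]) m s w - I w - J w} ->
  \int[lebP]_v (cut a T q v * step_proc c a b v) =
  \int[leb]_s \int[P]_w (cut a T m (s, w) * X w).
Proof.
move=> cem iI jJ eqp; have aT := le_trans ab bT.
have [sI sq EI] := ito_pairing hM a0 ab mc cC iI.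
have [sJ EJ] := jump_pairing hM a0 ab mc cC jJ.
have sm := sqint_drift_from cem.
pose A w := \int[leb]_s cut a T m (s, w).
have sA : sqint P A.
  apply: (@sqint_marginal _ _ _ _ _ leb P (cut a T m) `[0, T]%classic) => //.
  move=> s w /= ns; rewrite /cut/= indicE memNset ?mul0r//=.
  by move=> h; apply: ns; move: h; rewrite !in_itv/= => /andP[/(le_trans a0)-> ->].
have AE w : \int[leb]_(s in `[a, T]) m s w = A w.
  by rewrite -Rintegral_mulr_indic /A /cut.
have [[_ adp _ _] _] := hb.
have mpa : measurable_wrt setT (filtration M a) (p a) by apply: adp; rewrite a0.
have mpf := measurable_filtration hM mpa.
pose p' w := A w - I w - J w.
have sp' : sqint P p' by apply: sqintB => //; exact: sqintB.
have pp' : {ae P, forall w, p a w = p' w} by apply: filterS eqp => w ->; rewrite AE add0r.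
have sp : sqint P (p a).
  split => //; have [_ sp2] := sp'; apply: (@summable_le_ae _ _ _ P _ (fun w => p' w ^+ 2)) => //.
    exact: measurable_funX.
  by apply: filterS pp' => w ->; rewrite ger0_norm// sqr_ge0.
have Ep : \int[P]_w (p' w * X w) = 0.
  have [mp' _] := sp'; have [mX _] := sX.
  transitivity (\int[P]_w (p a w * c w * dB M a b w)).
    apply: ae_eq_Rintegral; first exact: measurable_funM.
      apply: measurable_funM; last exact: (measurable_dB hM (dle (lexx a)) ab).
      exact: measurable_funM.
    by apply: filterS pp' => w ->; rewrite mulrA.
  apply: (expectation_mul_dB_filtration hM (dle (lexx a)) ab).
    exact: measurable_wrtM.
  by under [X in sqint _ X]eq_fun do rewrite mulrC; exact: (sqint_bounded_mul mcf cC sp).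
rewrite -EI.
have : \int[P]_w (p' w * X w) = \int[P]_w (A w * X w) - \int[P]_w (I w * X w) - \int[P]_w (J w * X w).
  rewrite -RintegralB//; [|exact: sqint_mul|exact: sqint_mul].
  rewrite -RintegralB//; [|apply: summableB; exact: sqint_mul|exact: sqint_mul].
  by apply: eq_Rintegral => w _; rewrite /p'; ring.
rewrite Ep EJ subr0 => /esym/eqP; rewrite subr_eq0 => /eqP <-.
have sAX : summable_fun lebP (fun v => cut a T m v * X v.2).
  have := sqint_mul sm (sqint_tensor q0T sX); congr (summable_fun _ _).
  apply/funext => -[s w]; rewrite mulrA /=; congr (_ * _).
  by rewrite /cut/= mulrAC indicaT.
have [mX _] := sX; have [mm _] := sm.
by rewrite -(Rfubini_factor mm mX sAX).
Qed.

Lemma memory_pairing :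
  \int[lebP]_v (cut 0 T q v * step_proc c a b v) = \int[lebP]_v (memory v * step_proc c a b v).
Proof.
have [_ [_ [m [cem _ eqs]]]] := hb; have aT := le_trans ab bT.
have [|I [J [iI jJ eqp]]] := eqs a; first by rewrite a0.
rewrite -memory_after.
transitivity (\int[lebP]_v (cut a T q v * step_proc c a b v)).
  apply: eq_Rintegral => -[t w] _; rewrite /cut /step_proc/=.
  have [tI|nI] := boolP (t \in `]a, b]%classic); last by rewrite ![\1_(`]a, b]%classic) _]indicE (negbTE nI) mul0r !mulr0.
  congr (_ * _ * _); move: tI; rewrite inE/= in_itv/= => /andP[/ltW at_ tb].
  by rewrite !indicE !mem_set//= in_itv/= (le_trans tb bT) ?at_ ?(le_trans a0 at_).
rewrite (control_pairing cem iI jJ eqp); apply: ae_eq_Rintegral; last exact: drift_pairing.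
- have [msm _] := sqint_drift_from cem; have [mX _] := sX.
  apply: (@measurable_Rintegral_prod _ _ _ _ _ P (fun v => cut a T m v * X v.2)).
  apply: measurable_funM => //; exact: (measurableT_comp mX measurable_snd).
- apply: measurable_funB; first exact: measurable_Rintegral1 (safter 0).
  exact: (summable_measurable (summable_shift delta (summable_Rintegral1 (safter delta)))).
Qed.

End pairing.

(** Both processes have the same pairings with the elementary adapted
    processes; their difference is orthogonal to its own future integrals. *)
Lemma control_eq_memory : {ae lebP, forall v, cut 0 T q v = memory v}.
Proof.
have T0 := horizon_ge0 hM; have smem := sqint_memory.
have sq : sqint lebP (cut 0 T q).
  have [_ [_ [m [_ _ eqs]]]] := hb.
  have [|I [J [iI _ _]]] := eqs 0; first by rewrite lexx.
  have c0 (w : Om) : `|(0 : R)| <= 0 by rewrite normr0.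
  by have [_ ? _] := ito_pairing hM (lexx 0) (lexx 0) (@filtration_cst _ _ _ M 0 0) c0 iI.
pose D v := cut 0 T q v - memory v.
have sD : sqint lebP D by exact: sqintB.
have D_out t w : ~ `[0, T]%classic t -> D (t, w) = 0.
  by move=> nt; rewrite /D memory_out// /cut/= indicE memNset// mul0r subrr.
have orth a (c : Om -> R) C x : 0 <= a <= T -> measurable_wrt setT (filtration M a) c ->
    (forall w, `|c w| <= C) -> \int[lebP]_v (D v * step_proc c a x v) = 0.
  move=> /andP[a0 aT] mc cC; have [xa|ax] := leP x a.
    apply: Rintegral_eq0 => v; rewrite /step_proc indicE memNset ?mul0r ?mulr0//=.
    by rewrite in_itv/= => /andP[av vx]; lra.
  have ab : a <= Num.min x T by rewrite le_min aT (ltW ax).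
  have bT : Num.min x T <= T by rewrite ge_min lexx orbT.
  have sst := sqint_step_proc M a (Num.min x T) (measurable_filtration hM mc) cC.
  transitivity (\int[lebP]_v (D v * step_proc c a (Num.min x T) v)).
    apply: eq_Rintegral => -[t w] _.
    have [tT|nT] := boolP (t \in `[0, T]%classic); last first.
      by rewrite D_out ?mul0r// => tT; rewrite mem_set in nT.
    rewrite /step_proc/=; congr (_ * (_ * _)); rewrite !indicE; congr ((_ : bool)%:R).
    move: tT; rewrite inE/= in_itv/= => /andP[_ tT].
    by apply/idP/idP; rewrite !inE/= !in_itv/= le_min tT andbT.
  transitivity (\int[lebP]_v (cut 0 T q v * step_proc c a (Num.min x T) v) -
      \int[lebP]_v (memory v * step_proc c a (Num.min x T) v)).
    rewrite -RintegralB//; [|exact: sqint_mul|exact: sqint_mul].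
    by apply: eq_Rintegral => v _; rewrite mulrBl.
  by rewrite (memory_pairing a0 ab bT mc cC) subrr.
have adq : adapted (filtration M) 0 T q.
  by have [[_ _ pq _] _] := hb; exact: predictable_adapted.
have selforth x : \int[lebP]_v (D v * cut 0 T (later D x) v) = 0.
  have sL := sqint_later sD D_out x.
  transitivity (\int[lebP]_v (cut 0 T q v * cut 0 T (later D x) v) -
      \int[lebP]_v (memory v * cut 0 T (later D x) v)).
    rewrite -RintegralB//; [|exact: sqint_mul|exact: sqint_mul].
    by apply: eq_Rintegral => v _; rewrite mulrBl.
  rewrite (later_orth hM sD D_out orth x adq sq) sub0r; apply/eqP; rewrite oppr_eq0; apply/eqP.
  have [mmk _] := sqint_memory_kernel; have [mL _] := sL.
  have sML : summable_fun (leb \x lebP)%E (fun z => memory_kernel z * cut 0 T (later D x) z.2).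
    have := sqint_mul sqint_memory_kernel (sqint_tensor q0T sL); congr (summable_fun _ _).
    apply/funext => -[s v]; rewrite /memory_kernel /kernel/=.
    by rewrite ![\1_(`[0, T]%classic) s]indicE; case: (_ \in _); rewrite ?mul1r ?mul0r ?mulr0 ?mul0r.
  rewrite /memory (Rfubini_factor mmk mL sML).
  rewrite -[RHS](@Rintegral_eq0 _ _ _ leb (fun=> 0))//; apply: ae_eq_Rintegral => //.
    exact: (measurable_Rintegral1 sML).
  apply: (lebesgue_ae1 _ repK) => s rs.
  have [sT|nT] := boolP (0 <= s <= T); last first.
    by apply: Rintegral_eq0 => v; rewrite /memory_kernel kernel_out// mulr0 mul0r.
  have [ak sk _] := rs sT.
  pose ks t w := \1_(`[0, delta[%classic) (s - t) * K s t w.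
  have ksE : cut 0 T ks = fun v => \1_(`[0, delta[%classic) (s - v.1) * cut 0 T (K s) v.
    by apply/funext => v; rewrite /cut mulrCA.
  have aks : adapted (filtration M) 0 T ks.
    by move=> t tT; apply: measurable_wrtM; [exact: filtration_cst|exact: ak].
  have sks : sqint lebP (cut 0 T ks).
    rewrite ksE; apply: (@sqint_bounded_mul _ _ _ _ _ _ 1) => //; last by move=> v; exact: normr_indic_le1.
    apply: (measurableT_comp (measurable_indic _)) => //; exact: measurable_funB.
  rewrite -[RHS](later_orth hM sD D_out orth x aks sks).
  by apply: eq_Rintegral => v _; rewrite ksE /memory_kernel kernel_in.
have := later_self_orth_eq0 sD D_out selforth.
by apply: (@filterS _ _ (ae_filter_ringOfSetsType lebP)) => v /eqP; rewrite subr_eq0 => /eqP.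
Qed.

End memory.

(** * From the advanced system to the noisy memory equation *)

Section ae_sections.
Context d1 d2 (T1 : measurableType d1) (T2 : measurableType d2) (R : realType).
Variables (m1 : {sigma_finite_measure set T1 -> \bar R})
  (m2 : {sigma_finite_measure set T2 -> \bar R}).

(** The measure of a null set is the integral of the measures of its sections. *)
Lemma ae_sections (Q : T1 * T2 -> Prop) : {ae (m1 \x m2)%E, forall v, Q v} ->
  {ae m1, forall x, {ae m2, forall y, Q (x, y)}}.
Proof.
move=> [N [mN N0 QN]].
have mx : measurable_fun setT (m2 \o xsection N) by exact: measurable_fun_xsection.
have : (\int[m1]_x `|(m2 \o xsection N) x| = 0)%E.
  by rewrite -[RHS]N0; apply: eq_integral => x _; rewrite gee0_abs.
move=> /(ae_eq_integral_abs _ measurableT mx); apply: filterS => x /(_ I) /= Nx.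
exists (xsection N x); split => //; first exact: measurable_xsection.
by move=> y nQ; rewrite /xsection/= inE; exact: QN.
Qed.

End ae_sections.

Section modification.
Context {d : measure_display} {Om : measurableType d} {R : realType}.
Variable M : model Om R.
Local Notation P := (prob M).

(** Completeness makes a modification of a measurable function measurable. *)
Lemma is_cond_exp_ae (G : set (set Om)) (F1 F2 F' : Om -> R) :
  measure_is_complete P -> G `<=` measurable -> {ae P, forall w, F1 w = F2 w} ->
  is_cond_exp M G F1 F' -> is_cond_exp M G F2 F'.
Proof.
move=> cP GM F12 [i1 i' mF' eqF].
have e12 : ae_eq P setT (EFin \o F1) (EFin \o F2).
  by apply: filterS F12 => w /= -> _.
have m1 : measurable_fun setT (EFin \o F1) by case/integrableP: i1.
have m2 : measurable_fun setT (EFin \o F2) := ae_measurable_fun cP e12 m1.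
split => //.
  apply: (@summable_le_ae _ _ _ P F2 (fun w => `|F1 w|)); last exact: summable_norm.
    exact/measurable_EFinP.
  by apply: filterS F12 => w ->.
move=> A GA; have mA := GM _ GA; rewrite -eqF//; apply/esym; apply: ae_eq_integral => //.
- exact: measurable_funTS.
- exact: measurable_funTS.
- by apply: filterS F12 => w /= -> _.
Qed.

End modification.

Theorem theorem6p1 (R : realType) (d : measure_display) (Om : measurableType d)
    (M : model Om R) (G : R -> set (set Om)) (AG : set (R -> Om -> R))
    (hM : noisy_setting M) (hG : subfiltration M G)
    (hAG : admissible_controls M G AG)
    (h1 : assumption1 M) (h2 : assumption2 M AG)
    (pi X Z : R -> Om -> R) (hpi : AG pi) (hX : state_solution M pi X Z)
    (p1 q1 p2 q2 : R -> Om -> R) (r1 r2 : R -> Om -> R -> R)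
    (hp : advanced_bsde_solution M pi X Z p1 q1 r1 p2 q2 r2)
    (hz : square_integrable M 0 (horizon M) (dH_dz M X Z pi p1 q1 r1))
    (K : R -> R -> Om -> R)
    (hK : is_cond_malliavin_kernel M (dH_dz M X Z pi p1 q1 r1) K) :
  noisy_memory_bsde_solution M pi X Z K p1 q1 r1 /\
  {ae (@lebesgue_measure R \x prob M)%E, forall v,
     0 <= v.1 <= horizon M -> q2 v.1 v.2 = memory_integral M K v.1 v.2}.
Proof.
have [B1 B2 bd1 _] := hp.
have q2E : {ae (@lebesgue_measure R \x prob M)%E, forall v,
    0 <= v.1 <= horizon M -> q2 v.1 v.2 = memory_integral M K v.1 v.2}.
  have := control_eq_memory hM hz hK B2.
  apply: (@filterS _ _ (ae_filter_ringOfSetsType (@lebesgue_measure R \x prob M)%E)).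
  move=> [t w] e /= tT; rewrite -(memoryE hM hz hK)// -e /cut/= indicE mem_set/= ?mul1r//.
split => //; split => //.
have [data [term [m [[mm cem] im eqs]]]] := B1.
split => //; split => //; exists m; split => //; split => //.
apply: (lebesgue_ae2 _ cem (ae_sections q2E)) => t ce q2t tT.
apply: (is_cond_exp_ae (complete_prob hM) (filtration_measurable hM (a := t)) _ (ce tT)).
apply: filterS q2t => w /= /(_ tT) q2w.
rewrite /mu_first /mu_noisy q2w.
(* t + delta is positive, so only the upper bound of [0, T] matters *)
have -> : \1_(`[0, horizon M]%classic) (t + delay M) = \1_(`[0, horizon M - delay M]%classic) t :> R.
  have d0 := delay_gt0 hM; have /andP[t0 _] := tT; rewrite !indicE; congr ((_ : bool)%:R).
  by apply/idP/idP; rewrite !inE/= !in_itv/= => /andP[_ h]; apply/andP; split=> //; lra.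
by ring.
Qed.
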